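(* Let $s$ be a positive integer and $n=2^{s+1}+2^{s}-2$. (i) For each $s\geqslant 2$, the space of $G(4)$-invariants of the kernel of the Kameko map $[\overline{Sq}^{0}]_{n}:\pmb{Q}^4_{n}\to\pmb{Q}^4_{(n-4)/2}$ is trivial: $\big(\mathrm{Ker}[\overline{Sq}^{0}]_{n}\big)^{G(4)}=0$. (ii) For each $s\geqslant 2$, $$\dim\big(\pmb{Q}^4_{n}\big)^{G(4)}=\begin{cases}0 & \text{if } s=2,4,\\ 1 & \text{if } s\geqslant 3,\ s\neq 4.\end{cases}$$
   Context: $k=\mathbb{Z}/2$, $A$ is the mod 2 Steenrod algebra with augmentation ideal $\overline{A}$ (spanned by the $Sq^i$, $i>0$, and their composites), and $G(4)=GL_4(k)$. $P_4=k[x_1,\dots,x_4]$, $\deg x_i=1$, with the usual $A$-action and $G(4)$ acting by linear substitution; $(P_4)_m$ is the degree-$m$ part. $\pmb{Q}^4_m=(P_4)_m/((P_4)_m\cap\overline{A}P_4)$, a $G(4)$-module; $(\pmb{Q}^4_m)^{G(4)}$ denotes its $G(4)$-invariants. For $m\geqslant 0$ the Kameko map $\overline{Sq}^0:(P_4)_{2m+4}\to(P_4)_m$ is the linear map sending a monomial $x_1x_2x_3x_4 g^2$ to $g$ and all other monomials to $0$; it induces a $G(4)$-module homomorphism $[\overline{Sq}^0]_{2m+4}:\pmb{Q}^4_{2m+4}\to\pmb{Q}^4_m$. *)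

(* Defs.v *)
From HB Require Import structures.
From mathcomp Require Import all_boot all_order all_algebra.
From mathcomp Require Import mpoly.
Set Implicit Arguments. Unset Strict Implicit. Unset Printing Implicit Defensive.
Import GRing.Theory.
Local Open Scope ring_scope.

Notation F2 := ('F_2).
Notation P4 := ({mpoly F2[4]}).

Definition hcomp (d : nat) (p : P4) : P4 :=
  \sum_(m <- msupp p | mdeg m == d) p@_m *: 'X_[m].

(* Steenrod squares: the total square is the ring map x_i |-> x_i + x_i^2;
   Sq^k x^m is the component of degree |m| + k of prod_i (x_i + x_i^2)^(m_i). *)
Definition SqMon (k : nat) (m : 'X_{1..4}) : P4 :=
  hcomp (mdeg m + k) (\prod_(i < 4) ('X_i + 'X_i ^+ 2) ^+ (m i)).
Definition Sq (k : nat) (p : P4) : P4 :=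
  \sum_(m <- msupp p) p@_m *: SqMon k m.

Definition act (g : 'M[F2]_4) (p : P4) : P4 :=
  p \mPo [tuple \sum_(j < 4) g j i *: 'X_j | i < 4].

(* Kameko map: x1x2x3x4 g^2 |-> g, other monomials |-> 0 *)
Definition kameko (p : P4) : P4 :=
  \sum_(m <- msupp p) p@_m *:
     (if [forall i : 'I_4, odd (m i)] then 'X_[[multinom (m i)./2 | i < 4]]
      else 0).

(* Coordinates: (P_4)_d is identified with functions from degree-d exponent
   vectors to k. *)
Notation monD d := {e : {ffun 'I_4 -> 'I_d.+1} | (\sum_(i < 4) (e i : nat) == d)%N}.
Definition mnm_of d (e : monD d) : 'X_{1..4} := [multinom ((val e) i : nat) | i < 4].
Notation Pd d := {ffun monD d -> F2^o}.
Definition coord (d : nat) (p : P4) : Pd d := [ffun e => p@_(mnm_of e)].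
Definition poly_of (d : nat) (v : Pd d) : P4 := \sum_(e : monD d) v e *: 'X_[mnm_of e].

(* (P_4)_d \cap \bar{A} P_4 : spanned by Sq^i(x^a), i > 0, |a| + i = d *)
Definition hit_gens (d : nat) : seq (Pd d) :=
  [seq coord d (SqMon (p.1 : nat) [multinom ((p.2 : {ffun 'I_4 -> 'I_d.+1}) i : nat) | i < 4])
  | p : 'I_d.+1 * {ffun 'I_4 -> 'I_d.+1} <- enum [pred p : 'I_d.+1 * {ffun 'I_4 -> 'I_d.+1} |
               (0 < (p.1 : nat))%N && ((p.1 : nat) + \sum_(i < 4) (p.2 i : nat) == d)%N]].
Definition Hit (d : nat) : {vspace Pd d} := <<hit_gens d>>%VS.

(* f in (P_4)_d represents a G(4)-invariant class of Q^4_d *)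
Definition invariant (d : nat) (v : Pd d) : bool :=
  [forall g : 'M[F2]_4, (g \in unitmx) ==>
     (coord d (act g (poly_of v) - poly_of v) \in Hit d)].

(* preimage in (P_4)_d of (Q^4_d)^{G(4)} *)
Definition InvPre (d : nat) : {vspace Pd d} :=
  <<[seq v <- enum (Pd d) | invariant v]>>%VS.

Definition dimQG (d : nat) : nat := (\dim (InvPre d) - \dim (Hit d))%N.

(* preimage in (P_4)_n of (Ker [Sq^0]_n)^{G(4)}, target degree (n-4)/2 *)
Definition KerInvPre (n : nat) : {vspace Pd n} :=
  <<[seq v <- enum (Pd n) | invariant v &&
        (coord ((n - 4) %/ 2) (kameko (poly_of v)) \in Hit ((n - 4) %/ 2))]>>%VS.

(* Main.v *)
(* Call a polynomial hit when it lies in the image of the positive-degree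
   Steenrod squares.  Modulo hit polynomials, the kernel of the Kameko map in
   degree 2^(s+1) + 2^s - 2 is spanned by words p_1 (p_2 (... (p_s x^2)^2 ...)^2)^2
   whose letters p_i are products of two variables, and the degree of its target
   by words whose letters are products of three variables.  A linear substitution
   followed by the coefficient of a spike is a functional that vanishes on hit
   polynomials; on a word it is a product of minors of the substitution.  A finite
   computation at word length 3, propagated by commutation of letters, shows that
   for length at least 3 these functionals separate the classes of words.

   On an invariant class all functionals take one common value c.  In the kernel,
   the functionals attached to the three lines of a plane add up to 0, so c = 0,
   which is (i).  In the target, c = 1 is realised in word length at least 3; in
   lengths 0, 1, 2 parity forces c = 0, and the only class that survives is
   that of the sum f0 of the x_i^6 x_j x_k x_l in length 1, which no spike
   detects.  An invariant class g in the target lifts: correcting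
   x_1 x_2 x_3 x_4 g^2 in the kernel so that every functional vanishes on it makes
   it invariant. *)
Require Import Defs.
From HB Require Import structures.
From mathcomp Require Import all_boot all_order all_algebra.
From mathcomp Require Import mpoly ring zify.
Set Implicit Arguments. Unset Strict Implicit. Unset Printing Implicit Defensive.
Import GRing.Theory.
Local Open Scope ring_scope.

(** * Steenrod squares and hit polynomials *)

Lemma F2_cases (c : F2) : c = 0 \/ c = 1.
Proof.
by case: c => [[|[|m]]] i //; [left | right]; apply/eqP; rewrite -val_eqE.
Qed.

Lemma F2_sqr (c : F2) : c ^+ 2 = c.
Proof. by case: (F2_cases c) => ->; rewrite expr2 ?mulr0 ?mulr1. Qed.

Lemma F2_odd n : n%:R = (odd n)%:R :> F2.
Proof. by apply/eqP; rewrite -val_eqE /= !val_Fp_nat // modn2; case: (odd n). Qed.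

Lemma addpp (p : P4) : p + p = 0.
Proof.
by rewrite -mulr2n -scaler_nat (F2_odd 2) scale0r.
Qed.

Lemma oppp (p : P4) : - p = p.
Proof. by apply/eqP; rewrite eq_sym -addr_eq0 addpp. Qed.

Lemma eq_add2 (p q r : P4) : p = q + (r + r) -> p = q.
Proof. by rewrite addpp addr0. Qed.

Lemma sqrDp (p q : P4) : (p + q) ^+ 2 = p ^+ 2 + q ^+ 2.
Proof. by apply: (@eq_add2 _ _ (p * q)); ring. Qed.

Lemma sqr_sum I (r : seq I) (P : pred I) (F : I -> P4) :
  (\sum_(i <- r | P i) F i) ^+ 2 = \sum_(i <- r | P i) F i ^+ 2.
Proof.
elim/big_rec2: _ => [|i y1 y2 _ <-]; first by rewrite expr0n.
by rewrite sqrDp.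
Qed.

Lemma sqrZp (c : F2) (p : P4) : (c *: p) ^+ 2 = c *: p ^+ 2.
Proof. by rewrite exprZn F2_sqr. Qed.

(* The total square with a grading variable: Sq k f is its coefficient of t^k. *)
Definition Sqt (p : P4) : {poly P4} :=
  mmap (polyC \o @mpolyC 4 F2) (fun i => ('X_i)%:P + ('X_i ^+ 2)%:P * 'X) p.

Lemma Sqt_is_additive : additive Sqt.
Proof. exact: mmap_is_additive. Qed.
Lemma Sqt_is_multiplicative : multiplicative Sqt.
Proof. exact: mmap_is_multiplicative. Qed.
HB.instance Definition _ := GRing.isAdditive.Build P4 {poly P4} Sqt Sqt_is_additive.
HB.instance Definition _ := GRing.isMultiplicative.Build P4 {poly P4} Sqt Sqt_is_multiplicative.

Lemma SqtX i : Sqt 'X_i = ('X_i)%:P + ('X_i ^+ 2)%:P * 'X.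
Proof. by rewrite /Sqt mmapX mmap1U. Qed.

Lemma SqtXm m : Sqt 'X_[m] = \prod_(i < 4) (('X_i)%:P + ('X_i ^+ 2)%:P * 'X) ^+ m i.
Proof. by rewrite /Sqt mmapX. Qed.

Lemma SqtZ c p : Sqt (c *: p) = (c%:MP)%:P * Sqt p.
Proof. by rewrite /Sqt mmapZ. Qed.

Definition graded d (F : {poly P4}) := forall k, F`_k \is (d + k)%N.-homog.

Lemma gradedM d e F G : graded d F -> graded e G -> graded (d + e) (F * G).
Proof.
move=> hF hG k; rewrite coefM; apply: rpred_sum => i _.
have hi : (i <= k)%N by rewrite -ltnS.
have -> : (d + e + k = (d + i) + (e + (k - i)))%N by lia.
by apply: dhomogM.
Qed.

Lemma graded1 : graded 0 1.
Proof. by move=> k; rewrite coef1; case: k => [|k] /=; rewrite ?dhomog1 // rpred0. Qed.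

Lemma gradedXn d F n : graded d F -> graded (n * d) (F ^+ n).
Proof.
move=> hF; elim: n => [|n IH]; first exact: graded1.
by rewrite exprS mulSn; apply: gradedM.
Qed.

Lemma Sqt_graded m : graded (mdeg m) (Sqt 'X_[m]).
Proof.
rewrite SqtXm mdegE.
elim/big_rec2: _ => [|i y1 y2 _ IH]; first exact: graded1.
apply: gradedM => //; rewrite -[X in graded X _]muln1; apply: gradedXn => k.
rewrite coefD coefC coefCM coefX; case: k => [|[|k]] /=.
- by rewrite mulr0 addr0 dhomogX; apply/eqP; apply: mdeg1.
- rewrite mulr1 add0r mpolyXn dhomogX /=; apply/eqP; rewrite mdegMn mdeg1 //.
- by rewrite mulr0 addr0 rpred0.
Qed.

Lemma hcomp_pihomog d p : hcomp d p = pihomog mdeg d p.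
Proof. by rewrite /hcomp pihomogE. Qed.

Lemma SqMonE k m : SqMon k m = (Sqt 'X_[m])`_k.
Proof.
rewrite /SqMon; set F := Sqt 'X_[m].
have -> : \prod_(i < 4) ('X_i + 'X_i ^+ 2) ^+ m i = F.[1] :> P4.
  rewrite /F SqtXm horner_prod; apply: eq_bigr => i _.
  by rewrite horner_exp hornerD hornerM hornerX !hornerC mulr1.
rewrite horner_coef hcomp_pihomog linear_sum /=.
have hF := Sqt_graded m; rewrite -/F in hF.
under eq_bigr => i _ do rewrite expr1n mulr1.
case: (ltnP k (size F)) => hk.
  rewrite (bigD1 (Ordinal hk)) //= big1 ?addr0; first by apply/pihomog_dE/hF.
  move=> i ne; apply: pihomog_ne0 (hF i); rewrite eqn_add2l.
  by apply: contraNneq ne => e; apply/eqP/val_inj.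
rewrite big1 ?nth_default // => i _; apply: pihomog_ne0 (hF i).
by rewrite eqn_add2l neq_ltn (leq_trans (ltn_ord i) hk).
Qed.

Lemma SqE k p : Sq k p = (Sqt p)`_k.
Proof.
rewrite /Sq [in RHS](mpolyE p) raddf_sum coef_sum; apply: eq_bigr => m _.
by rewrite SqMonE /= SqtZ coefCM mul_mpolyC.
Qed.

Lemma SqD k p q : Sq k (p + q) = Sq k p + Sq k q.
Proof. by rewrite !SqE raddfD coefD. Qed.
Lemma Sq_0 k : Sq k 0 = 0.
Proof. by rewrite SqE raddf0 coef0. Qed.
Lemma SqZ k c p : Sq k (c *: p) = c *: Sq k p.
Proof. by rewrite !SqE SqtZ coefCM mul_mpolyC. Qed.
Lemma Sq_sum k I (r : seq I) (P : pred I) (F : I -> P4) :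
  Sq k (\sum_(i <- r | P i) F i) = \sum_(i <- r | P i) Sq k (F i).
Proof. by apply: (big_morph _ (SqD k) (Sq_0 k)). Qed.
Lemma SqX k m : Sq k 'X_[m] = SqMon k m.
Proof. by rewrite SqE SqMonE. Qed.

Lemma Sq_homog k d f : f \is d.-homog -> Sq k f \is (d + k).-homog.
Proof.
move=> hf; rewrite /Sq big_seq; apply: rpred_sum => m hm.
rewrite rpredZ // SqMonE; have := Sqt_graded m k.
by rewrite (dhomog_mf hf hm).
Qed.

Lemma Sq0E p : Sq 0 p = p.
Proof.
rewrite [in RHS](mpolyE p) /Sq; apply: eq_bigr => m _; rewrite SqMonE.
rewrite -horner_coef0 SqtXm horner_prod mpolyXE_id; congr (_ *: _).
apply: eq_bigr => i _.
by rewrite horner_exp hornerD hornerM hornerX !hornerC mulr0 addr0.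
Qed.

Lemma Cartan k u v : Sq k (u * v) = \sum_(i < k.+1) Sq i u * Sq (k - i) v.
Proof. by rewrite SqE rmorphM coefM; apply: eq_bigr => i _; rewrite !SqE. Qed.

Lemma Cartan1 u v : Sq 1 (u * v) = u * Sq 1 v + Sq 1 u * v.
Proof. by rewrite Cartan !big_ord_recl big_ord0 /= !Sq0E addr0. Qed.

Lemma Cartan2 u v : Sq 2 (u * v) = u * Sq 2 v + Sq 1 u * Sq 1 v + Sq 2 u * v.
Proof. by rewrite Cartan !big_ord_recl big_ord0 /= !Sq0E addr0 addrA. Qed.

Lemma coef_sqr (F : {poly P4}) k :
  (F ^+ 2)`_k = if odd k then 0 else F`_(k./2) ^+ 2.
Proof.
elim/poly_ind: F k => [|F c IH] k; first by rewrite expr0n !coef0 expr0n if_same.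
have -> : (F * 'X + c%:P) ^+ 2 = F ^+ 2 * 'X^2 + (c ^+ 2)%:P.
  have addPP (G : {poly P4}) : G + G = 0.
    by apply/polyP => i; rewrite coefD addpp coef0.
  by rewrite rmorphXn /= -[RHS]addr0 -(addPP (F * 'X * c%:P)); ring.
rewrite [LHS]coefD [X in X + _ = _]coefMXn [X in _ + X = _]coefC.
case: k => [|[|k]].
- by rewrite /= add0r [X in _ = X ^+ 2]coefD coefMX coefC /= add0r.
- by rewrite /= addr0.
rewrite /= addr0 negbK !subSS subn0 IH; case: (odd k) => //.
by rewrite [X in _ = X ^+ 2]coefD coefMX coefC /= addr0.
Qed.

Lemma Sq_sqr k h : Sq k (h ^+ 2) = if odd k then 0 else Sq k./2 h ^+ 2.
Proof. by rewrite !SqE rmorphXn coef_sqr. Qed.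

Lemma CartanSq k u h :
  Sq k.*2 (u * h ^+ 2) = \sum_(i < k.+1) Sq i.*2 u * Sq (k - i) h ^+ 2.
Proof.
rewrite Cartan -(big_mkord xpredT (fun i => Sq i u * Sq (k.*2 - i) (h ^+ 2))).
rewrite -(big_mkord xpredT (fun i => Sq i.*2 u * Sq (k - i) h ^+ 2)).
have ev i : Sq i.*2 (h ^+ 2) = Sq i h ^+ 2 by rewrite Sq_sqr odd_double doubleK.
have gen n m : (m <= n)%N -> \sum_(0 <= i < m.*2.+1) Sq i u * Sq (n.*2 - i) (h ^+ 2) =
  \sum_(0 <= i < m.+1) Sq i.*2 u * Sq (n - i) h ^+ 2.
  elim: m => [|m IHm] hm; first by rewrite !big_nat1 !subn0 ev.
  rewrite doubleS !(big_nat_recr _.+1) //= IHm ?(ltnW hm) // big_nat_recr //=.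
  rewrite -addrA; congr (_ + _).
  have -> : (n.*2 - m.*2.+1 = (n - m.+1).*2.+1)%N by lia.
  have -> : (n.*2 - m.*2.+2 = (n - m.+1).*2)%N by lia.
  by rewrite ev Sq_sqr /= odd_double mulr0 add0r.
exact: (gen k k (leqnn k)).
Qed.

Inductive hit : P4 -> Prop :=
| hit0 : hit 0
| hitS k f p of (0 < k)%N & hit p : hit (Sq k f + p).

Lemma hitD p q : hit p -> hit q -> hit (p + q).
Proof.
elim=> [|k f r k0 _ IH] hq; first by rewrite add0r.
by rewrite -addrA; constructor=> //; apply: IH.
Qed.

Lemma hit_Sq k f : (0 < k)%N -> hit (Sq k f).
Proof. by move=> k0; rewrite -[Sq k f]addr0; constructor=> //; constructor. Qed.

Lemma hitZ c p : hit p -> hit (c *: p).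
Proof. by case: (F2_cases c) => ->; rewrite ?scale0r ?scale1r // => _; apply: hit0. Qed.

Lemma hit_sum I (r : seq I) (P : pred I) (F : I -> P4) :
  (forall i, P i -> hit (F i)) -> hit (\sum_(i <- r | P i) F i).
Proof. by move=> h; elim/big_ind: _ => //; [exact: hit0 | exact: hitD]. Qed.

Lemma hit_sub p q : hit (p + q) -> hit q -> hit p.
Proof. by move=> h1 h2; rewrite -[p]addr0 -(addpp q) addrA; apply: hitD. Qed.

Definition heq p q := hit (p + q).
Notation "p ~= q" := (heq p q) (at level 70).

Lemma heq_refl p : p ~= p. Proof. by rewrite /heq addpp; constructor. Qed.
Lemma heqS p q : p ~= q -> q ~= p. Proof. by rewrite /heq addrC. Qed.
Lemma heqT q p r : p ~= q -> q ~= r -> p ~= r.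
Proof.
rewrite /heq => h1 h2; have := hitD h1 h2.
by rewrite addrA -(addrA p q q) addpp addr0.
Qed.
Lemma heqD p q p' q' : p ~= q -> p' ~= q' -> p + p' ~= q + q'.
Proof. by rewrite /heq => h1 h2; rewrite addrACA; apply: hitD. Qed.
Lemma heq_hit p q : p ~= q -> hit q -> hit p.
Proof. exact: hit_sub. Qed.
Lemma heq0 p : hit p -> p ~= 0. Proof. by rewrite /heq addr0. Qed.
Lemma heq_sum I (r : seq I) (P : pred I) (F G : I -> P4) :
  (forall i, P i -> F i ~= G i) ->
  \sum_(i <- r | P i) F i ~= \sum_(i <- r | P i) G i.
Proof. by move=> h; rewrite /heq -big_split; apply: hit_sum. Qed.

(* Sq k u = 0 for k > n, as for products of n linear forms. *)
Definition sqdeg n u := forall k, (n < k)%N -> Sq k u = 0.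

Lemma sqdegM m n u v : sqdeg m u -> sqdeg n v -> sqdeg (m + n) (u * v).
Proof.
move=> hu hv k hk; rewrite Cartan big1 // => i _.
have [hi|hi] := ltnP m i; first by rewrite hu // mul0r.
by rewrite hv ?mulr0 //; lia.
Qed.

Lemma Sq_top m n u v : sqdeg m u -> sqdeg n v ->
  Sq (m + n) (u * v) = Sq m u * Sq n v.
Proof.
move=> hu hv; rewrite Cartan.
have hm : (m < (m + n).+1)%N by lia.
rewrite (bigD1 (Ordinal hm)) //= addKn big1 ?addr0 // => i ne.
have [hi|hi] := ltnP m i; first by rewrite hu // mul0r.
rewrite hv ?mulr0 //.
have : (i : nat) != m by apply: contraNneq ne => e; apply/eqP/val_inj.
lia.
Qed.

Definition lin (x : P4) := Sq 1 x = x ^+ 2 /\ sqdeg 1 x.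

Lemma linX i : lin 'X_i.
Proof.
split=> [|k hk]; rewrite SqE SqtX coefD coefC coefCM coefX.
  by rewrite add0r mulr1.
by case: k hk => [|[|k]] //= _; rewrite mulr0 addr0.
Qed.

Lemma sqdeg1 : sqdeg 0 1.
Proof. by move=> [|k] // _; rewrite SqE rmorph1 coef1. Qed.

Lemma Sq_mdegX m : sqdeg (mdeg m) 'X_[m] /\ Sq (mdeg m) 'X_[m] = 'X_[m] ^+ 2.
Proof.
rewrite mpolyXE_id mdegE.
elim/big_rec2: _ => [|i d p _ [IH1 IH2]].
  by rewrite Sq0E expr1n; split => //; apply: sqdeg1.
have [h1 h2] : sqdeg (m i) ('X_i ^+ m i) /\ Sq (m i) ('X_i ^+ m i) = 'X_i ^+ m i ^+ 2.
  elim: (m i) => [|k [IHk1 IHk2]]; first by rewrite expr0 Sq0E expr1n; split => //; apply: sqdeg1.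
  have [l1 l2] := linX i.
  rewrite exprS -add1n; split; first exact: sqdegM.
  by rewrite Sq_top // IHk2 l1 exprMn.
by split; [exact: sqdegM | rewrite Sq_top // IH2 h2 exprMn].
Qed.

Lemma hit_sqrX m : (0 < mdeg m)%N -> hit ('X_[m] ^+ 2).
Proof. by move=> h; rewrite -(Sq_mdegX m).2; apply: hit_Sq. Qed.

Lemma hit_sqr p : p@_0%MM = 0 -> hit (p ^+ 2).
Proof.
move=> h; rewrite [p]mpolyE sqr_sum; apply: hit_sum => m _; rewrite sqrZp.
have [->|ne] := eqVneq m 0%MM; first by rewrite h scale0r; constructor.
by apply/hitZ/hit_sqrX; rewrite lt0n mdeg_eq0.
Qed.

Lemma mcoeff0M (p q : P4) : (p * q)@_0%MM = p@_0%MM * q@_0%MM.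
Proof. exact: (rmorphM (mcoeff 0%MM)). Qed.

Lemma mcoeff0_lin x : lin x -> x@_0%MM = 0.
Proof.
case=> [h1 _].
have: (Sq 1 x)@_0%MM = 0.
  rewrite /Sq raddf_sum big1 // => m _ /=; rewrite mcoeffZ SqMonE.
  rewrite (dhomog_nemf_coeff (Sqt_graded m 1)) ?mulr0 //.
  by rewrite [X in X != _]mdeg0 addn1.
by rewrite h1 expr2 mcoeff0M -expr2 F2_sqr.
Qed.

Lemma Sq1_lin2 x y : lin x -> lin y ->
  Sq 1 (x * y) = x ^+ 2 * y + x * y ^+ 2.
Proof. by move=> hx hy; rewrite Cartan1 hx.1 hy.1 addrC. Qed.
Lemma Sq2_lin2 x y : lin x -> lin y ->
  Sq 2 (x * y) = x ^+ 2 * y ^+ 2.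
Proof.
move=> hx hy.
by rewrite Cartan2 hx.1 hy.1 (hx.2 2 isT) (hy.2 2 isT) mulr0 mul0r addr0 add0r. Qed.

Lemma Sq1_lin3 x y z : lin x -> lin y -> lin z ->
  Sq 1 (x * y * z) = x ^+ 2 * y * z + x * y ^+ 2 * z + x * y * z ^+ 2.
Proof. by move=> hx hy hz; rewrite Cartan1 (Sq1_lin2 hx hy) hz.1; ring. Qed.
Lemma Sq2_lin3 x y z : lin x -> lin y -> lin z ->
  Sq 2 (x * y * z) = x * (y * z) ^+ 2 + y * (x * z) ^+ 2 + z * (x * y) ^+ 2.
Proof.
move=> hx hy hz; rewrite Cartan2 (Sq1_lin2 hx hy) (Sq2_lin2 hx hy) hz.1 (hz.2 2 isT); ring.
Qed.
Lemma Sq1_lin4 x y z w : lin x -> lin y -> lin z -> lin w ->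
  Sq 1 (x * y * z * w) = y * z * w * x ^+ 2 + x * z * w * y ^+ 2
     + x * y * w * z ^+ 2 + x * y * z * w ^+ 2.
Proof. by move=> hx hy hz hw; rewrite Cartan1 (Sq1_lin3 hx hy hz) hw.1; ring. Qed.
Lemma Sq2_lin4 x y z w : lin x -> lin y -> lin z -> lin w ->
  Sq 2 (x * y * z * w) = x * y * (z * w) ^+ 2 + x * z * (y * w) ^+ 2
     + x * w * (y * z) ^+ 2 + y * z * (x * w) ^+ 2 + y * w * (x * z) ^+ 2
     + z * w * (x * y) ^+ 2.
Proof. by move=> hx hy hz hw; rewrite Cartan2 (Sq1_lin3 hx hy hz) (Sq2_lin3 hx hy hz) hw.1 (hw.2 2 isT); ring. Qed.

Lemma sqdeg_lin2 x y : lin x -> lin y -> sqdeg 2 (x * y).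
Proof. by move=> hx hy; apply: (sqdegM hx.2 hy.2). Qed.
Lemma sqdeg_lin3 x y z : lin x -> lin y -> lin z -> sqdeg 3 (x * y * z).
Proof. by move=> hx hy hz; apply: (sqdegM (sqdeg_lin2 hx hy) hz.2). Qed.
Lemma sqdeg_lin4 x y z w : lin x -> lin y -> lin z -> lin w -> sqdeg 4 (x * y * z * w).
Proof. by move=> hx hy hz hw; apply: (sqdegM (sqdeg_lin3 hx hy hz) hw.2). Qed.

(* Multiplying a square by a product of linear forms: Sq^{2k}(u h^2) is
   u (Sq^k h)^2 up to terms with fewer odd exponents. *)
Lemma lift1 x k h : lin x -> (0 < k)%N -> hit (x * Sq k h ^+ 2).
Proof.
move=> hx k0; have := CartanSq k x h.
rewrite big_ord_recl Sq0E subn0 big1 ?addr0 => [<-|i _].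
  by apply: hit_Sq; rewrite double_gt0.
by rewrite hx.2 ?mul0r //; rewrite /bump; lia.
Qed.

Lemma lift2 x y k h : lin x -> lin y -> (0 < k)%N -> hit (x * y * Sq k h ^+ 2).
Proof.
move=> hx hy; case: k => // k _; have := CartanSq k.+1 (x * y) h.
rewrite !big_ord_recl !Sq0E subn0 big1 ?addr0 => [e|i _]; last first.
  by rewrite (sqdeg_lin2 hx hy) ?mul0r //; rewrite /bump; lia.
apply: (@hit_sub _ ((x * y * Sq k h) ^+ 2)); last first.
  by apply: hit_sqr; rewrite !mcoeff0M (mcoeff0_lin hx) !mul0r.
rewrite /bump /= subSS subn0 (Sq2_lin2 hx hy) -!exprMn in e.
by rewrite -e; apply: hit_Sq.
Qed.

Lemma lift3 x y z k h : lin x -> lin y -> lin z ->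
  heq (x * y * z * Sq k.+1 h ^+ 2)
    (x * (y * z * Sq k h) ^+ 2 + y * (x * z * Sq k h) ^+ 2 + z * (x * y * Sq k h) ^+ 2).
Proof.
move=> hx hy hz; have := CartanSq k.+1 (x * y * z) h.
rewrite !big_ord_recl !Sq0E subn0 big1 ?addr0 => [e|i _]; last first.
  by rewrite (sqdeg_lin3 hx hy hz) ?mul0r //; rewrite /bump; lia.
rewrite /bump /= subSS subn0 (Sq2_lin3 hx hy hz) in e.
rewrite /heq; have -> : x * y * z * Sq k.+1 h ^+ 2 + (x * (y * z * Sq k h) ^+ 2 +
  y * (x * z * Sq k h) ^+ 2 + z * (x * y * Sq k h) ^+ 2) = Sq k.+1.*2 (x * y * z * h ^+ 2).
  by rewrite e; ring.
exact: hit_Sq.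
Qed.

Lemma lift4 x y z w k h : lin x -> lin y -> lin z -> lin w ->
  heq (x * y * z * w * Sq k.+1 h ^+ 2)
    (x * y * (z * w * Sq k h) ^+ 2 + x * z * (y * w * Sq k h) ^+ 2
     + x * w * (y * z * Sq k h) ^+ 2 + y * z * (x * w * Sq k h) ^+ 2
     + y * w * (x * z * Sq k h) ^+ 2 + z * w * (x * y * Sq k h) ^+ 2).
Proof.
move=> hx hy hz hw; have := CartanSq k.+1 (x * y * z * w) h.
have top : Sq 4 (x * y * z * w) = (x * y * z * w) ^+ 2.
  rewrite (Sq_top (sqdeg_lin3 hx hy hz) hw.2) (Sq_top (sqdeg_lin2 hx hy) hz.2).
  by rewrite (Sq_top hx.2 hy.2) hx.1 hy.1 hz.1 hw.1 -!exprMn.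
have hsq g : hit ((x * y * z * w * g) ^+ 2).
  by apply: hit_sqr; rewrite !mcoeff0M (mcoeff0_lin hx) !mul0r.
rewrite big_ord_recl big_ord_recl !Sq0E subn0 /bump /= subSS subn0 (Sq2_lin4 hx hy hz hw).
set R := \sum_(i < k) _ => e.
have hR : hit R.
  apply: hit_sum => i _; case: i => [[|i] hi] /=.
    by rewrite /bump /= top -exprMn; apply: hsq.
  have -> : Sq (bump 0 (bump 0 i.+1)).*2 (x * y * z * w) = 0.
    by apply: (sqdeg_lin4 hx hy hz hw); rewrite /bump; lia.
  by rewrite mul0r; apply: hit0.
apply: (@hit_sub _ R) => //.
set T := (X in hit X).
have -> : T = Sq k.+1.*2 (x * y * z * w * h ^+ 2) by rewrite e /T; ring.
exact: hit_Sq.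
Qed.

Lemma hit_eq p q : hit p -> p = q -> hit q.
Proof. by move=> h <-. Qed.

Lemma hit_lift1 x f : lin x -> hit f -> hit (x * f ^+ 2).
Proof.
move=> hx; elim=> [|k h p k0 _ IH]; first by rewrite expr0n mulr0; apply: hit0.
by rewrite sqrDp mulrDr; apply: hitD IH; apply: lift1.
Qed.

Lemma hit_lift2 x y f : lin x -> lin y -> hit f -> hit (x * y * f ^+ 2).
Proof.
move=> hx hy; elim=> [|k h p k0 _ IH]; first by rewrite expr0n mulr0; apply: hit0.
by rewrite sqrDp mulrDr; apply: hitD IH; apply: lift2.
Qed.

Inductive ghit d : P4 -> Prop :=
| ghit0 : ghit d 0
| ghitS k m p of (0 < k)%N & (mdeg m + k = d)%N & ghit d p :
    ghit d (Sq k 'X_[m] + p).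

Lemma ghitD d p q : ghit d p -> ghit d q -> ghit d (p + q).
Proof.
elim=> [|k m r k0 e _ IH] hq; first by rewrite add0r.
by rewrite -addrA; constructor=> //; apply: IH.
Qed.

Lemma ghitZ d c p : ghit d p -> ghit d (c *: p).
Proof. by case: (F2_cases c) => ->; rewrite ?scale0r ?scale1r // => _; apply: ghit0. Qed.

Lemma hit_pihomog d p : hit p -> ghit d (pihomog mdeg d p).
Proof.
elim=> [|k f r k0 _ IH]; first by rewrite linear0; apply: ghit0.
rewrite linearD; apply: ghitD IH; rewrite /Sq linear_sum.
elim/big_rec: _ => [|m q _ IH]; first exact: ghit0.
apply: ghitD IH; rewrite linearZ; apply: ghitZ => /=; rewrite SqMonE.
have hm := Sqt_graded m k.
have [e|ne] := eqVneq (mdeg m + k)%N d; last first.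
  by rewrite (pihomog_ne0 ne hm); apply: ghit0.
rewrite e in hm; rewrite (pihomog_dE hm) -[_`_k]addr0 -SqMonE -SqX.
by constructor=> //; apply: ghit0.
Qed.

Lemma hit_ghit d p : p \is d.-homog -> hit p -> ghit d p.
Proof. by move=> hp /(hit_pihomog d); rewrite pihomog_dE. Qed.

Lemma Sq1_sqr p : Sq 1 (p ^+ 2) = 0.
Proof. by rewrite Sq_sqr. Qed.

(** * Relations modulo hit polynomials *)

Lemma koszul3 x y z g : lin x -> lin y -> lin z ->
  hit (y * z * (x * g) ^+ 2 + x * z * (y * g) ^+ 2 + x * y * (z * g) ^+ 2).
Proof.
move=> hx hy hz; set T := (X in hit X).
have -> : T = Sq 1 (x * y * z * g ^+ 2).
  by rewrite Cartan1 Sq1_sqr (Sq1_lin3 hx hy hz) /T; ring.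
exact: hit_Sq.
Qed.

Lemma koszul4 x y z w g : lin x -> lin y -> lin z -> lin w ->
  hit (y * z * w * (x * g) ^+ 2 + x * z * w * (y * g) ^+ 2
     + x * y * w * (z * g) ^+ 2 + x * y * z * (w * g) ^+ 2).
Proof.
move=> hx hy hz hw; set T := (X in hit X).
have -> : T = Sq 1 (x * y * z * w * g ^+ 2).
  by rewrite Cartan1 Sq1_sqr (Sq1_lin4 hx hy hz hw) /T; ring.
exact: hit_Sq.
Qed.

Lemma Sq2_quad u g : Sq 2 (u * (g ^+ 2) ^+ 2) = Sq 2 u * (g ^+ 2) ^+ 2.
Proof. by rewrite Cartan2 Sq1_sqr Sq_sqr /= Sq1_sqr expr0n !mulr0 !add0r. Qed.

Lemma Sq1_quad u g : Sq 1 (u * g ^+ 2) = Sq 1 u * g ^+ 2.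
Proof. by rewrite Cartan1 Sq1_sqr mulr0 add0r. Qed.

Lemma six_sum x y z w g : lin x -> lin y -> lin z -> lin w ->
  hit (x * y * (z * w * g ^+ 2) ^+ 2 + x * z * (y * w * g ^+ 2) ^+ 2
     + x * w * (y * z * g ^+ 2) ^+ 2 + y * z * (x * w * g ^+ 2) ^+ 2
     + y * w * (x * z * g ^+ 2) ^+ 2 + z * w * (x * y * g ^+ 2) ^+ 2).
Proof.
move=> hx hy hz hw; set T := (X in hit X).
have -> : T = Sq 2 (x * y * z * w * (g ^+ 2) ^+ 2).
  by rewrite Sq2_quad (Sq2_lin4 hx hy hz hw) /T; ring.
exact: hit_Sq.
Qed.

Lemma plucker x y z w g : lin x -> lin y -> lin z -> lin w ->
  hit (y * z * (x * w * g ^+ 2) ^+ 2 + x * z * (y * w * g ^+ 2) ^+ 2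
       + x * y * (z * w * g ^+ 2) ^+ 2).
Proof.
move=> hx hy hz hw; have := koszul3 (w * g ^+ 2) hx hy hz.
by rewrite !(mulrA _ w).
Qed.

Lemma comm2 x y z w g : lin x -> lin y -> lin z -> lin w ->
  x * y * (z * w * g ^+ 2) ^+ 2 ~= z * w * (x * y * g ^+ 2) ^+ 2.
Proof.
move=> hx hy hz hw; rewrite /heq.
have h := hitD (hitD (plucker g hx hy hz hw) (plucker g hx hy hw hz)) (six_sum g hx hy hz hw).
apply: (hit_sub _ h); set T := (X in hit X).
set P := y * z * (x * w * g ^+ 2) ^+ 2 + x * z * (y * w * g ^+ 2) ^+ 2
  + y * w * (x * z * g ^+ 2) ^+ 2 + x * w * (y * z * g ^+ 2) ^+ 2
  + 2%:R * (x * y * (z * w * g ^+ 2) ^+ 2) + z * w * (x * y * g ^+ 2) ^+ 2.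
have -> : T = P + P by rewrite /T /P; ring.
by rewrite addpp; apply: hit0.
Qed.

Lemma koszul3_level2 x y z h : lin x -> lin y -> lin z ->
  hit (y * z * (y * z * (x * h) ^+ 2) ^+ 2 + x * z * (x * z * (y * h) ^+ 2) ^+ 2
       + x * y * (x * y * (z * h) ^+ 2) ^+ 2).
Proof.
move=> hx hy hz; apply: (hit_eq (koszul3 (x * y * z * h ^+ 2) hx hy hz)); ring.
Qed.

Lemma koszul3_level3 x y z h : lin x -> lin y -> lin z ->
  hit (y * z * (y * z * (y * z * (x * h) ^+ 2) ^+ 2) ^+ 2
       + x * z * (x * z * (x * z * (y * h) ^+ 2) ^+ 2) ^+ 2
       + x * y * (x * y * (x * y * (z * h) ^+ 2) ^+ 2) ^+ 2).
Proof.
move=> hx hy hz; apply: (hit_eq (koszul3_level2 (x * y * z * h ^+ 2) hx hy hz)); ring.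
Qed.

Lemma square_swap2 x y z g : lin x -> lin y -> lin z ->
  x * z * (x * z * (x * y * g ^+ 2) ^+ 2) ^+ 2 ~=
  x * y * (x * y * (x * z * g ^+ 2) ^+ 2) ^+ 2.
Proof.
move=> hx hy hz; rewrite /heq.
have h := koszul3_level2 (x * g ^+ 2) hx hy hz.
have e : hit (y * z * (y * z * (x * (x * g ^+ 2)) ^+ 2) ^+ 2).
  do 2!apply: hit_lift2 => //.
  have -> : x * (x * g ^+ 2) = (x * g) ^+ 2 by ring.
  by apply: hit_sqr; rewrite mcoeff0M (mcoeff0_lin hx) mul0r.
apply: (hit_eq (hitD h e)); apply: (eq_add2 (r := y * z * (y * z * (x * (x * g ^+ 2)) ^+ 2) ^+ 2)); ring.
Qed.

Lemma mixed_rel x y b l h : lin x -> lin y -> lin b -> lin l ->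
  hit (y * b * (y * b * (y * l * (x * h) ^+ 2) ^+ 2) ^+ 2
     + x * b * (x * b * (x * l * (y * h) ^+ 2) ^+ 2) ^+ 2
     + x * y * (x * b * (x * l * (y * h) ^+ 2) ^+ 2) ^+ 2
     + x * y * (y * b * (y * l * (x * h) ^+ 2) ^+ 2) ^+ 2).
Proof.
move=> hx hy hb hl.
have h1 := koszul3_level2 (x * y * l * h ^+ 2) hx hy hb.
have h2 := hit_lift2 hx hy (koszul3 (x * y * l * h ^+ 2) hx hy hb).
apply: (hit_eq (hitD h1 h2)); rewrite !sqrDp !mulrDr.
apply: (eq_add2 (r := x * y * (x * y * (b * (x * y * l * h ^+ 2)) ^+ 2) ^+ 2)); ring.
Qed.

Lemma all_odd_conv x y z w h : lin x -> lin y -> lin z -> lin w ->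
  x * y * (x * y * z * w * h ^+ 2) ^+ 2 ~=
  x * z * (x * w * (y * h) ^+ 2) ^+ 2 + y * z * (y * w * (x * h) ^+ 2) ^+ 2.
Proof.
move=> hx hy hz hw; apply: (hit_eq (koszul3 (x * y * w * h ^+ 2) hx hy hz)); ring.
Qed.

(* [x * g ^+ 2] has a single odd exponent in each monomial; such classes
   vanish as soon as [g] has positive even degree. *)
Lemma single_odd2 x y z h : lin x -> lin y -> lin z ->
  hit (x * (y * z * h ^+ 2) ^+ 2).
Proof.
move=> hx hy hz.
have h1 : Sq 1 (x * z * (y * h ^+ 2) ^+ 2) = (x ^+ 2 * z + x * z ^+ 2) * (y * h ^+ 2) ^+ 2.
  by rewrite Sq1_quad (Sq1_lin2 hx hz).
have h2 : Sq 1 (x * y * (z * h ^+ 2) ^+ 2) = (x ^+ 2 * y + x * y ^+ 2) * (z * h ^+ 2) ^+ 2.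
  by rewrite Sq1_quad (Sq1_lin2 hx hy).
have h3 : Sq 2 (x * y * z * (h ^+ 2) ^+ 2) =
    (x * (y * z) ^+ 2 + y * (x * z) ^+ 2 + z * (x * y) ^+ 2) * (h ^+ 2) ^+ 2.
  by rewrite Sq2_quad (Sq2_lin3 hx hy hz).
apply: (hit_eq (hitD (hitD (hit_Sq (x * z * (y * h ^+ 2) ^+ 2) (ltn0Sn 0))
  (hit_Sq (x * y * (z * h ^+ 2) ^+ 2) (ltn0Sn 0))) (hit_Sq (x * y * z * (h ^+ 2) ^+ 2) (ltn0Sn 1)))).
rewrite h1 h2 h3.
apply: (eq_add2 (r := x * (y * z * h ^+ 2) ^+ 2 + y * (x * z * h ^+ 2) ^+ 2
   + z * (x * y * h ^+ 2) ^+ 2)); ring.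
Qed.

Lemma single_odd4 x y z w h : lin x -> lin y -> lin z -> lin w ->
  hit (x * (x * y * z * w * h ^+ 2) ^+ 2).
Proof.
move=> hx hy hz hw.
have h1 : Sq 1 (x * y * (x * z * w * h ^+ 2) ^+ 2) =
    (x ^+ 2 * y + x * y ^+ 2) * (x * z * w * h ^+ 2) ^+ 2.
  by rewrite Sq1_quad (Sq1_lin2 hx hy).
apply: (hit_eq (hitD (hit_Sq (x * y * (x * z * w * h ^+ 2) ^+ 2) (ltn0Sn 0))
  (single_odd2 (x * h) hy hz hw))).
rewrite h1.
apply: (eq_add2 (r := y * (z * w * (x * h) ^+ 2) ^+ 2)); ring.
Qed.

Definition xv (i : nat) : P4 := 'X_(inord i).

Lemma lin_xv i : lin (xv i). Proof. exact: linX. Qed.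
#[local] Hint Resolve lin_xv : core.

Lemma xv_homog i : xv i \is 1.-homog.
Proof. by rewrite dhomogX; apply/eqP/mdeg1. Qed.

Definition halfm (m : 'X_{1..4}) : 'X_{1..4} := [multinom (m i)./2 | i < 4].

Lemma sum_ord4 (F : 'I_4 -> nat) :
  (\sum_(i < 4) F i = F (inord 0) + F (inord 1) + F (inord 2) + F (inord 3))%N.
Proof.
rewrite !big_ord_recl big_ord0 addn0 !addnA.
by do !congr addn; congr F; apply/val_inj; rewrite /= inordK.
Qed.

Lemma sumr_ord4 (V : nmodType) (F : 'I_4 -> V) :
  \sum_(i < 4) F i = F (inord 0) + F (inord 1) + F (inord 2) + F (inord 3).
Proof.
rewrite !big_ord_recl big_ord0 addr0 !addrA.
by do !congr (_ + _); congr F; apply/val_inj; rewrite /= inordK.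
Qed.

Lemma prod_ord4 (F : 'I_4 -> P4) :
  \prod_(i < 4) F i = F (inord 0) * F (inord 1) * F (inord 2) * F (inord 3).
Proof.
rewrite !big_ord_recl big_ord0 mulr1 !mulrA.
by do !congr (_ * _); congr F; apply/val_inj; rewrite /= inordK.
Qed.

Lemma mpolyX_half m : 'X_[m] =
  xv 0 ^+ odd (m (inord 0)) * xv 1 ^+ odd (m (inord 1)) *
  xv 2 ^+ odd (m (inord 2)) * xv 3 ^+ odd (m (inord 3)) * 'X_[halfm m] ^+ 2.
Proof.
rewrite -[LHS]mul1r mpolyXE_id (mpolyXE_id _ (halfm m)) mul1r -prodrXl.
have -> : \prod_(i < 4) 'X_i ^+ m i =
   \prod_(i < 4) ('X_i ^+ odd (m i) * ('X_i ^+ halfm m i) ^+ 2) :> P4.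
  apply: eq_bigr => i _; rewrite mnmE -exprM -exprD; congr (_ ^+ _).
  by rewrite muln2 odd_double_half.
by rewrite big_split /= prod_ord4.
Qed.

Lemma mdeg_half m : (mdeg m = odd (m (inord 0)) + odd (m (inord 1)) +
  odd (m (inord 2)) + odd (m (inord 3)) + (mdeg (halfm m)).*2)%N.
Proof.
rewrite !mdegE -muln2 -(sum_ord4 (fun i => odd (m i) : nat)) big_distrl -big_split /=.
by apply: eq_bigr => i _; rewrite mnmE muln2 odd_double_half.
Qed.

Lemma single_odd_X i m : (i < 4)%N -> ~~ odd (mdeg m) -> (0 < mdeg m)%N ->
  hit (xv i * 'X_[m] ^+ 2).
Proof.
move=> hi; rewrite mdeg_half mpolyX_half; set h := 'X_[halfm m].
have hsq : (0 < mdeg (halfm m))%N -> hit (h ^+ 2) by apply: hit_sqrX.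
move: (odd (m (inord 0))) (odd (m (inord 1))) (odd (m (inord 2))) (odd (m (inord 3))) hsq.
move: (mdeg _) => d b0 b1 b2 b3 hsq ev pos.
have H2 a b : hit (xv i * (xv a * xv b * h ^+ 2) ^+ 2) by apply: single_odd2.
have H4 : hit (xv i * (xv 0 * xv 1 * xv 2 * xv 3 * h ^+ 2) ^+ 2).
  have H a b c e := single_odd4 h (lin_xv a) (lin_xv b) (lin_xv c) (lin_xv e).
  case: i hi {H2} => [|[|[|[|//]]]] _.
  - exact: (H 0%N 1%N 2%N 3%N).
  - by apply: (hit_eq (H 1%N 0%N 2%N 3%N)); ring.
  - by apply: (hit_eq (H 2%N 0%N 1%N 3%N)); ring.
  - by apply: (hit_eq (H 3%N 0%N 1%N 2%N)); ring.
clearbody h.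
case: b0 ev pos => ev pos; case: b1 ev pos => ev pos; case: b2 ev pos => ev pos;
  case: b3 ev pos => ev pos; rewrite ?expr0 ?expr1 ?mul1r ?mulr1;
  try (by exfalso; move: ev; rewrite /= ?odd_double).
- exact: H4.
- exact: H2.
- exact: H2.
- exact: H2.
- exact: H2.
- exact: H2.
- exact: H2.
by apply: hit_lift1 => //; apply: hsq; rewrite -double_gt0.
Qed.

Lemma single_odd i d g : (i < 4)%N -> g \is d.-homog -> ~~ odd d -> (0 < d)%N ->
  hit (xv i * g ^+ 2).
Proof.
move=> hi hg ev pos; rewrite [g]mpolyE sqr_sum mulr_sumr big_seq.
apply: hit_sum => m hm; rewrite sqrZp -scalerAr; apply: hitZ.
by apply: single_odd_X => //; rewrite (dhomog_mf hg hm).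
Qed.

Lemma hit_lift3 i j k d f : (i < 4)%N -> (j < 4)%N -> (k < 4)%N ->
  f \is d.-homog -> odd d -> hit f -> hit (xv i * xv j * xv k * f ^+ 2).
Proof.
move=> hi hj hk hf od /(hit_ghit hf).
elim=> [|[//|e] m p _ ed _ IH]; first by rewrite expr0n mulr0; apply: hit0.
rewrite sqrDp mulrDr; apply: hitD IH.
apply: (heq_hit (lift3 e 'X_[m] (lin_xv i) (lin_xv j) (lin_xv k))).
have ho a b : (xv a * xv b * Sq e 'X_[m]) \is (1 + 1 + (mdeg m + e))%N.-homog.
  by do !apply: dhomogM; rewrite ?xv_homog // Sq_homog // dhomogX.
have ev : ~~ odd (1 + 1 + (mdeg m + e))%N by move: od; rewrite -ed; lia.
by do !apply: hitD; apply: (single_odd _ (ho _ _) ev).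
Qed.

Lemma comm3 i j k l d g : (i < 4)%N -> (j < 4)%N -> (k < 4)%N -> (l < 4)%N ->
  g \is d.-homog -> odd d ->
  xv j * xv k * xv l * (xv i * xv k * xv l * g ^+ 2) ^+ 2 ~=
  xv i * xv k * xv l * (xv j * xv k * xv l * g ^+ 2) ^+ 2.
Proof.
move=> hi hj hk hl hg od.
have h := koszul4 (xv k * xv l * g ^+ 2) (lin_xv i) (lin_xv j) (lin_xv k) (lin_xv l).
have aux a b : (a < 4)%N -> (b < 4)%N -> hit (xv a * (xv b * g) ^+ 2) /\
    xv a * (xv b * g) ^+ 2 \is (1 + (1 + d) * 2)%N.-homog.
  move=> ha hb; have hbg : xv b * g \is (1 + d)%N.-homog by rewrite dhomogM ?xv_homog.
  split; first by apply: (single_odd ha hbg) => //; lia.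
  by rewrite dhomogM ?xv_homog // dhomogMn.
have [h1 h1'] := aux l k hl hk; have [h2 h2'] := aux k l hk hl.
have u1 := hit_lift3 hi hj hl h1' _ h1.
have u2 := hit_lift3 hi hj hk h2' _ h2.
have od' : odd (1 + (1 + d) * 2) by lia.
apply: (hit_eq (hitD h (hitD (u1 od') (u2 od')))).
apply: (eq_add2 (r := xv i * xv j * xv l * (xv l * (xv k * g) ^+ 2) ^+ 2
  + xv i * xv j * xv k * (xv k * (xv l * g) ^+ 2) ^+ 2)); ring.
Qed.

Definition qv (a : nat) : P4 :=
  match a with
  | 0 => xv 1 * xv 2 * xv 3
  | 1 => xv 0 * xv 2 * xv 3
  | 2 => xv 0 * xv 1 * xv 3
  | _ => xv 0 * xv 1 * xv 2
  end.

Lemma qv_homog a : qv a \is 3.-homog.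
Proof.
have h i j k : xv i * xv j * xv k \is (1 + 1 + 1)%N.-homog by rewrite !dhomogM ?xv_homog.
by case: a => [|[|[|a]]]; apply: h.
Qed.

Lemma hit_lift_cubic a d f : f \is d.-homog -> odd d -> hit f -> hit (qv a * f ^+ 2).
Proof.
move=> hf od h; have H i j k hi hj hk := @hit_lift3 i j k d f hi hj hk hf od h.
case: a => [|[|[|a]]].
- exact: (H 1%N 2%N 3%N isT isT isT).
- exact: (H 0%N 2%N 3%N isT isT isT).
- exact: (H 0%N 1%N 3%N isT isT isT).
- exact: (H 0%N 1%N 2%N isT isT isT).
Qed.

Lemma comm_cubic a b d g : g \is d.-homog -> odd d ->
  qv a * (qv b * g ^+ 2) ^+ 2 ~= qv b * (qv a * g ^+ 2) ^+ 2.
Proof.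
move=> hg od.
have h i j k l hi hj hk hl := @comm3 i j k l d g hi hj hk hl hg od.
case: a => [|[|[|a]]]; case: b => [|[|[|b]]].
- exact: heq_refl.
- apply: (hit_eq (h 0%N 1%N 2%N 3%N isT isT isT isT)); rewrite /qv; ring.
- apply: (hit_eq (h 0%N 2%N 1%N 3%N isT isT isT isT)); rewrite /qv; ring.
- apply: (hit_eq (h 0%N 3%N 1%N 2%N isT isT isT isT)); rewrite /qv; ring.
- apply: (hit_eq (h 1%N 0%N 2%N 3%N isT isT isT isT)); rewrite /qv; ring.
- exact: heq_refl.
- apply: (hit_eq (h 1%N 2%N 0%N 3%N isT isT isT isT)); rewrite /qv; ring.
- apply: (hit_eq (h 1%N 3%N 0%N 2%N isT isT isT isT)); rewrite /qv; ring.
- apply: (hit_eq (h 2%N 0%N 1%N 3%N isT isT isT isT)); rewrite /qv; ring.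
- apply: (hit_eq (h 2%N 1%N 0%N 3%N isT isT isT isT)); rewrite /qv; ring.
- exact: heq_refl.
- apply: (hit_eq (h 2%N 3%N 0%N 1%N isT isT isT isT)); rewrite /qv; ring.
- apply: (hit_eq (h 3%N 0%N 1%N 2%N isT isT isT isT)); rewrite /qv; ring.
- apply: (hit_eq (h 3%N 1%N 0%N 2%N isT isT isT isT)); rewrite /qv; ring.
- apply: (hit_eq (h 3%N 2%N 0%N 1%N isT isT isT isT)); rewrite /qv; ring.
- exact: heq_refl.
Qed.

Lemma koszul_cubic1 g : hit (qv 0 * (xv 0 * g) ^+ 2 + qv 1 * (xv 1 * g) ^+ 2
  + qv 2 * (xv 2 * g) ^+ 2 + qv 3 * (xv 3 * g) ^+ 2).
Proof. exact: koszul4. Qed.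

Lemma koszul_cubic2 g : hit (qv 0 * (qv 0 * (xv 0 * g) ^+ 2) ^+ 2
  + qv 1 * (qv 1 * (xv 1 * g) ^+ 2) ^+ 2
  + qv 2 * (qv 2 * (xv 2 * g) ^+ 2) ^+ 2 + qv 3 * (qv 3 * (xv 3 * g) ^+ 2) ^+ 2).
Proof.
apply: (hit_eq (koszul_cubic1 (xv 0 * xv 1 * xv 2 * xv 3 * g ^+ 2))); rewrite /qv; ring.
Qed.

Lemma koszul_cubic3 g : hit (qv 0 * (qv 0 * (qv 0 * (xv 0 * g) ^+ 2) ^+ 2) ^+ 2
  + qv 1 * (qv 1 * (qv 1 * (xv 1 * g) ^+ 2) ^+ 2) ^+ 2
  + qv 2 * (qv 2 * (qv 2 * (xv 2 * g) ^+ 2) ^+ 2) ^+ 2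
  + qv 3 * (qv 3 * (qv 3 * (xv 3 * g) ^+ 2) ^+ 2) ^+ 2).
Proof.
apply: (hit_eq (koszul_cubic2 (xv 0 * xv 1 * xv 2 * xv 3 * g ^+ 2))); rewrite /qv; ring.
Qed.

(* Apply the second Koszul relation to [x_k x_l g^2], {k, l} being the
   complement of {a, b}: the terms at k and l are of single-odd type. *)
Lemma square_swap_cubic a b d g : g \is d.-homog -> odd d ->
  qv a * (qv a * (qv b * g ^+ 2) ^+ 2) ^+ 2 ~=
  qv b * (qv b * (qv a * g ^+ 2) ^+ 2) ^+ 2.
Proof.
move=> hg od.
have aux k c e : (c < 4)%N -> (e < 4)%N ->
    hit (qv k * (qv k * (xv c * (xv e * g) ^+ 2) ^+ 2) ^+ 2).
  move=> hc he; have hcg : xv e * g \is (1 + d)%N.-homog by rewrite dhomogM ?xv_homog.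
  have h1 : hit (xv c * (xv e * g) ^+ 2) by apply: (single_odd hc hcg) => //; lia.
  have ho1 : xv c * (xv e * g) ^+ 2 \is (1 + (1 + d) * 2)%N.-homog.
    by rewrite dhomogM ?xv_homog // dhomogMn.
  have ho2 : qv k * (xv c * (xv e * g) ^+ 2) ^+ 2 \is (3 + (1 + (1 + d) * 2) * 2)%N.-homog.
    by rewrite dhomogM ?qv_homog // dhomogMn.
  apply: (hit_lift_cubic _ ho2); first by lia.
  by apply: (hit_lift_cubic _ ho1) => //; lia.
have fin k l : (k < 4)%N -> (l < 4)%N ->
  forall T, T = qv 0 * (qv 0 * (xv 0 * (xv k * xv l * g ^+ 2)) ^+ 2) ^+ 2
  + qv 1 * (qv 1 * (xv 1 * (xv k * xv l * g ^+ 2)) ^+ 2) ^+ 2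
  + qv 2 * (qv 2 * (xv 2 * (xv k * xv l * g ^+ 2)) ^+ 2) ^+ 2
  + qv 3 * (qv 3 * (xv 3 * (xv k * xv l * g ^+ 2)) ^+ 2) ^+ 2
  + qv k * (qv k * (xv l * (xv k * g) ^+ 2) ^+ 2) ^+ 2
  + qv l * (qv l * (xv k * (xv l * g) ^+ 2) ^+ 2) ^+ 2 -> hit T.
  by move=> hk hl T ->; exact: (hitD (hitD (koszul_cubic2 _) (aux k l k hl hk)) (aux l k l hk hl)).
case: a => [|[|[|a]]]; case: b => [|[|[|b]]].
- exact: heq_refl.
- apply: (fin 2%N 3%N isT isT); apply: esym; apply: (eq_add2 (r := qv 2 * (qv 2 * (xv 3 * (xv 2 * g) ^+ 2) ^+ 2) ^+ 2
    + qv 3 * (qv 3 * (xv 2 * (xv 3 * g) ^+ 2) ^+ 2) ^+ 2)); rewrite /qv; ring.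
- apply: (fin 1%N 3%N isT isT); apply: esym; apply: (eq_add2 (r := qv 1 * (qv 1 * (xv 3 * (xv 1 * g) ^+ 2) ^+ 2) ^+ 2
    + qv 3 * (qv 3 * (xv 1 * (xv 3 * g) ^+ 2) ^+ 2) ^+ 2)); rewrite /qv; ring.
- apply: (fin 1%N 2%N isT isT); apply: esym; apply: (eq_add2 (r := qv 1 * (qv 1 * (xv 2 * (xv 1 * g) ^+ 2) ^+ 2) ^+ 2
    + qv 2 * (qv 2 * (xv 1 * (xv 2 * g) ^+ 2) ^+ 2) ^+ 2)); rewrite /qv; ring.
- apply: (fin 2%N 3%N isT isT); apply: esym; apply: (eq_add2 (r := qv 2 * (qv 2 * (xv 3 * (xv 2 * g) ^+ 2) ^+ 2) ^+ 2
    + qv 3 * (qv 3 * (xv 2 * (xv 3 * g) ^+ 2) ^+ 2) ^+ 2)); rewrite /qv; ring.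
- exact: heq_refl.
- apply: (fin 0%N 3%N isT isT); apply: esym; apply: (eq_add2 (r := qv 0 * (qv 0 * (xv 3 * (xv 0 * g) ^+ 2) ^+ 2) ^+ 2
    + qv 3 * (qv 3 * (xv 0 * (xv 3 * g) ^+ 2) ^+ 2) ^+ 2)); rewrite /qv; ring.
- apply: (fin 0%N 2%N isT isT); apply: esym; apply: (eq_add2 (r := qv 0 * (qv 0 * (xv 2 * (xv 0 * g) ^+ 2) ^+ 2) ^+ 2
    + qv 2 * (qv 2 * (xv 0 * (xv 2 * g) ^+ 2) ^+ 2) ^+ 2)); rewrite /qv; ring.
- apply: (fin 1%N 3%N isT isT); apply: esym; apply: (eq_add2 (r := qv 1 * (qv 1 * (xv 3 * (xv 1 * g) ^+ 2) ^+ 2) ^+ 2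
    + qv 3 * (qv 3 * (xv 1 * (xv 3 * g) ^+ 2) ^+ 2) ^+ 2)); rewrite /qv; ring.
- apply: (fin 0%N 3%N isT isT); apply: esym; apply: (eq_add2 (r := qv 0 * (qv 0 * (xv 3 * (xv 0 * g) ^+ 2) ^+ 2) ^+ 2
    + qv 3 * (qv 3 * (xv 0 * (xv 3 * g) ^+ 2) ^+ 2) ^+ 2)); rewrite /qv; ring.
- exact: heq_refl.
- apply: (fin 0%N 1%N isT isT); apply: esym; apply: (eq_add2 (r := qv 0 * (qv 0 * (xv 1 * (xv 0 * g) ^+ 2) ^+ 2) ^+ 2
    + qv 1 * (qv 1 * (xv 0 * (xv 1 * g) ^+ 2) ^+ 2) ^+ 2)); rewrite /qv; ring.
- apply: (fin 1%N 2%N isT isT); apply: esym; apply: (eq_add2 (r := qv 1 * (qv 1 * (xv 2 * (xv 1 * g) ^+ 2) ^+ 2) ^+ 2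
    + qv 2 * (qv 2 * (xv 1 * (xv 2 * g) ^+ 2) ^+ 2) ^+ 2)); rewrite /qv; ring.
- apply: (fin 0%N 2%N isT isT); apply: esym; apply: (eq_add2 (r := qv 0 * (qv 0 * (xv 2 * (xv 0 * g) ^+ 2) ^+ 2) ^+ 2
    + qv 2 * (qv 2 * (xv 0 * (xv 2 * g) ^+ 2) ^+ 2) ^+ 2)); rewrite /qv; ring.
- apply: (fin 0%N 1%N isT isT); apply: esym; apply: (eq_add2 (r := qv 0 * (qv 0 * (xv 1 * (xv 0 * g) ^+ 2) ^+ 2) ^+ 2
    + qv 1 * (qv 1 * (xv 0 * (xv 1 * g) ^+ 2) ^+ 2) ^+ 2)); rewrite /qv; ring.
- exact: heq_refl.
Qed.

(** * Words and their linear algebra *)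

(* A word (l, v) stands for l_1 (l_2 (... (l_n v^2)^2 ...)^2)^2. *)
Definition word := (seq nat * nat)%type.

Fixpoint cmpl (a b : seq nat) : comparison :=
  match a, b with
  | [::], [::] => Eq
  | [::], _ => Lt
  | _, [::] => Gt
  | x :: a', y :: b' => if Nat.compare x y is Eq then cmpl a' b' else Nat.compare x y
  end.

Definition cmpw (u w : word) : comparison :=
  if cmpl u.1 w.1 is Eq then Nat.compare u.2 w.2 else cmpl u.1 w.1.

Lemma cmpw_eq u w : cmpw u w = Eq -> u = w.
Proof.
have cmpn x y : Nat.compare x y = Eq -> x = y by move/PeanoNat.Nat.compare_eq.
have h a b : cmpl a b = Eq -> a = b.
  elim: a b => [|x a IH] [|y b] //=.
  by case e: Nat.compare => // /IH ->; rewrite (cmpn _ _ e).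
case: u w => [a x] [b y]; rewrite /cmpw /=.
by case e: cmpl => // /cmpn ->; rewrite (h _ _ e).
Qed.

Fixpoint xorw (a : seq word) : seq word -> seq word :=
  fix xr b := match a, b with
  | [::], _ => b
  | _, [::] => a
  | x :: a', y :: b' => match cmpw x y with
      | Eq => xorw a' b' | Lt => x :: xorw a' b | Gt => y :: xr b' end
  end.

(* Rows of an echelon are sorted by strictly increasing leading words. *)
Fixpoint reduce (ech : seq (seq word)) : seq word -> seq word :=
  fix red r := match ech, r with
  | [::], _ => r
  | _, [::] => [::]
  | b :: ech', x :: r' => if b is y :: _ then
      match cmpw x y with
      | Lt => x :: red r' | Eq => reduce ech' (xorw r b) | Gt => reduce ech' r end
      else reduce ech' r
  end.

Fixpoint insert_row (r : seq word) (ech : seq (seq word)) :=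
  match ech, r with
  | (y :: b) :: ech', x :: _ =>
      if cmpw x y is Lt then r :: ech else (y :: b) :: insert_row r ech'
  | _, _ => r :: ech
  end.

Definition echelon rels :=
  foldl (fun ech r => if reduce ech r is x :: r' then insert_row (x :: r') ech else ech)
    [::] rels.

Fixpoint insert_letter (c : nat) (l : seq nat) :=
  if l is b :: l' then if (c <= b)%N then c :: l else b :: insert_letter c l' else [:: c].
Definition sort_letters l := foldr insert_letter [::] l.
Definition normalize (ws : seq word) : seq word :=
  foldr (fun w acc => xorw [:: (sort_letters w.1, w.2)] acc) [::] ws.
Definition consw c (ws : seq word) : seq word := [seq (c :: w.1, w.2) | w <- ws].
Definition catw t (ws : seq word) : seq word := [seq (t ++ w.1, w.2) | w <- ws].

Record wordsys := Wordsys {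
  wlet : nat -> P4; winn : nat -> P4; wdeg : nat -> nat;
  wlet_homog : forall c n f, f \is (wdeg n).-homog ->
    wlet c * f ^+ 2 \is (wdeg n.+1).-homog;
  winn_homog : forall v, winn v \is (wdeg 0).-homog;
  wlift : forall c n f, f \is (wdeg n).-homog -> hit f -> hit (wlet c * f ^+ 2);
  wcomm : forall b c n g, g \is (wdeg n).-homog ->
    wlet b * (wlet c * g ^+ 2) ^+ 2 ~= wlet c * (wlet b * g ^+ 2) ^+ 2 }.

Section Words.
Variable W : wordsys.

Fixpoint evl l p := if l is c :: l' then wlet W c * evl l' p ^+ 2 else p.
Definition evw (w : word) := evl w.1 (winn W w.2).
Definition evs (ws : seq word) := \sum_(w <- ws) evw w.
Definition len n (ws : seq word) := all (fun w => size w.1 == n) ws.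

Lemma evl_homog n l p : p \is (wdeg W n).-homog ->
  evl l p \is (wdeg W (size l + n)).-homog.
Proof. by move=> hp; elim: l => //= c l IH; rewrite addSn; apply: wlet_homog. Qed.

Lemma evl_hit n l p : p \is (wdeg W n).-homog -> hit p -> hit (evl l p).
Proof.
move=> hp h; elim: l => //= c l IH.
exact: (wlift c (evl_homog l hp) IH).
Qed.

Lemma evlD l p q : evl l (p + q) = evl l p + evl l q.
Proof. by elim: l => //= c l ->; rewrite sqrDp mulrDr. Qed.

Lemma evl_cat l1 l2 p : evl (l1 ++ l2) p = evl l1 (evl l2 p).
Proof. by elim: l1 => //= c l ->. Qed.

Lemma evl_heq n l p q : p \is (wdeg W n).-homog -> q \is (wdeg W n).-homog ->
  p ~= q -> evl l p ~= evl l q.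
Proof. by move=> hp hq h; rewrite /heq -evlD; apply: (@evl_hit n) h; rewrite rpredD. Qed.

Lemma evw_homog w : evw w \is (wdeg W (size w.1)).-homog.
Proof. by rewrite -[size _]addn0; apply/evl_homog/winn_homog. Qed.

Lemma evs_homog n ws : len n ws -> evs ws \is (wdeg W n).-homog.
Proof.
move/allP=> h; rewrite /evs big_seq; apply: rpred_sum => w /h /eqP <-.
exact: evw_homog.
Qed.

Lemma evs_cons w ws : evs (w :: ws) = evw w + evs ws.
Proof. by rewrite /evs big_cons. Qed.
Lemma evs_nil : evs [::] = 0. Proof. by rewrite /evs big_nil. Qed.
Lemma evs_cat a b : evs (a ++ b) = evs a + evs b.
Proof. by rewrite /evs big_cat. Qed.

Lemma evs_consw c ws : evs (consw c ws) = wlet W c * evs ws ^+ 2.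
Proof.
elim: ws => [|w ws IH]; first by rewrite evs_nil expr0n mulr0.
by rewrite /= !evs_cons IH sqrDp mulrDr.
Qed.

Lemma evs_catw t ws : evs (catw t ws) = evl t (evs ws).
Proof.
elim: ws => [|w ws IH].
  by rewrite evs_nil; elim: t => //= c t <-; rewrite expr0n mulr0.
by rewrite /= !evs_cons IH evlD /evw /= evl_cat.
Qed.

Lemma len_consw n c ws : len n ws -> len n.+1 (consw c ws).
Proof. by rewrite /len all_map. Qed.

Lemma evs_xor a b : evs (xorw a b) = evs a + evs b.
Proof.
elim: a b => [|x a IHa] b; first by case: b => *; rewrite evs_nil add0r.
elim: b => [|y b IHb]; first by rewrite evs_nil addr0.
rewrite /=; case e: cmpw.
- by rewrite (cmpw_eq e) IHa !evs_cons addrACA addpp add0r.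
- by rewrite !evs_cons IHa evs_cons addrA.
- by rewrite !evs_cons [LHS](congr1 _ IHb) evs_cons addrCA.
Qed.

Lemma insert_letter_heq n c l p : p \is (wdeg W n).-homog -> evl (insert_letter c l) p ~= evl (c :: l) p.
Proof.
move=> hp; elim: l => [|b l IH]; first exact: heq_refl.
rewrite /=; case: leqP => _; first exact: heq_refl.
have hl := evl_homog l hp.
have hb : wlet W c * evl l p ^+ 2 \is (wdeg W (size l + n).+1).-homog by apply: wlet_homog.
have ho : evl (insert_letter c l) p \is (wdeg W (size l + n).+1).-homog.
  have -> : (size l + n).+1 = (size (insert_letter c l) + n)%N.
    by rewrite -addSn; congr addn; elim: (l) => //= a l' IH'; case: ifP => //= _; rewrite -IH'.
  exact: evl_homog.
apply: heqT (wcomm b c hl).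
exact: (@evl_heq _ [:: b] _ _ ho hb IH).
Qed.

Lemma size_insert_letter c l : size (insert_letter c l) = (size l).+1.
Proof. by elim: l => //= a l IH; case: ifP => //= _; rewrite IH. Qed.
Lemma size_sort_letters l : size (sort_letters l) = size l.
Proof. by elim: l => //= a l IH; rewrite size_insert_letter IH. Qed.
Lemma all_insert_letter P c l : all P (insert_letter c l) = P c && all P l.
Proof. by elim: l => //= a l IH; case: ifP => //= _; rewrite IH andbCA. Qed.
Lemma all_sort_letters P l : all P (sort_letters l) = all P l.
Proof. by elim: l => //= a l IH; rewrite all_insert_letter IH. Qed.

Lemma sort_letters_heq n l p : p \is (wdeg W n).-homog -> evl (sort_letters l) p ~= evl l p.
Proof.
move=> hp; elim: l => [|c l IH]; first exact: heq_refl.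
apply: heqT (insert_letter_heq c _ hp) _.
have h1 := evl_homog (sort_letters l) hp; have h2 := evl_homog l hp.
by rewrite size_sort_letters in h1; apply: (@evl_heq _ [:: c] _ _ h1 h2 IH).
Qed.

Lemma normalize_heq ws : evs (normalize ws) ~= evs ws.
Proof.
elim: ws => [|w ws IH]; first exact: heq_refl.
have -> : normalize (w :: ws) = xorw [:: (sort_letters w.1, w.2)] (normalize ws) by [].
rewrite evs_xor !evs_cons evs_nil addr0.
exact: (heqD (sort_letters_heq _ (winn_homog W _)) IH).
Qed.

Section Engine.
Variable H : P4 -> Prop.
Hypotheses (H0 : forall p, hit p -> H p) (HD : forall p q, H p -> H q -> H (p + q)).

Definition allH (rows : seq (seq word)) := forall r, r \in rows -> H (evs r).

Lemma allH_cons r rows : allH (r :: rows) <-> H (evs r) /\ allH rows.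
Proof.
split=> [h | [h1 h2] x].
  by split=> [|x hx]; apply: h; rewrite ?mem_head // in_cons hx orbT.
by rewrite in_cons => /orP[/eqP ->|/h2].
Qed.

Lemma reduceP ech r : allH ech -> H (evs (reduce ech r) + evs r).
Proof.
elim: ech r => [|b ech IH] r.
  by move=> _; case: r => *; apply/H0; rewrite addpp; apply: hit0.
case/allH_cons=> hb /IH {}IH; elim: r => [|x r IHr].
  by rewrite evs_nil addr0; apply/H0/hit0.
case: b hb IHr => [|y b] hb IHr; first exact: IH.
rewrite [reduce _ _]/=; case e: cmpw.
- have := HD (IH (xorw r b)) hb; rewrite (cmpw_eq e) evs_xor !evs_cons.
  by rewrite -!addrA (addrCA (evs b)) addpp addr0 (addrC (evs r)).
- by rewrite !evs_cons addrACA addpp add0r; apply: IHr.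
- exact: IH.
Qed.

Lemma reduce_nil ech r : allH ech -> reduce ech r = [::] -> H (evs r).
Proof. by move=> h e; have := reduceP r h; rewrite e evs_nil add0r. Qed.

Lemma insert_rowP r ech : H (evs r) -> allH ech -> allH (insert_row r ech).
Proof.
move=> hr; elim: ech => [|b ech IH] h /=; first by apply/allH_cons.
case: b h => [|y b] h; first by apply/allH_cons.
case: r hr IH => [|x r] hr IH; first by apply/allH_cons.
case: cmpw; try by apply/allH_cons.
all: by case/allH_cons: h => h1 h2; apply/allH_cons; split=> //; apply: IH.
Qed.

Lemma echelonP rels : allH rels -> allH (echelon rels).
Proof.
rewrite /echelon; have : allH [::] by [].
elim: rels [::] => //= r rels IH ech hech /allH_cons[hr hrels].
apply: IH => //; case e: reduce => [|x r'] //.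
apply: insert_rowP => //; rewrite -e.
have := HD (reduceP r hech) hr.
by rewrite -addrA addpp addr0.
Qed.

End Engine.

Section Functionals.
Variables (Lts : seq nat) (V : nat).

(* A functional is the pair of its tables of values on letters and on
   innermost factors. *)
Definition lam (i : seq bool * seq bool) c := nth false i.1 c.
Definition mu (i : seq bool * seq bool) v := nth false i.2 v.
Local Notation I := (seq bool * seq bool)%type.

Definition phi (i : I) (w : word) := all (lam i) w.1 && mu i w.2.
Definition valid (w : word) := all (mem Lts) w.1 && (w.2 < V)%N.

Lemma phi_sort_letters i l v : phi i (sort_letters l, v) = phi i (l, v).
Proof. by rewrite /phi /= all_sort_letters. Qed.

Definition comb (DW : seq (I * seq word)) w :=
  foldr (fun e acc => if phi e.1 w then xorw e.2 acc else acc) [::] DW.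

Lemma comb_evs DW w : evs (comb DW w) = \sum_(e <- DW | phi e.1 w) evs e.2.
Proof.
elim: DW => [|e DW IH]; first by rewrite big_nil evs_nil.
by rewrite big_cons /= -IH; case: ifP => // _; rewrite evs_xor.
Qed.

Definition represents (H : P4 -> Prop) n DW :=
  forall w, size w.1 = n -> valid w ->
    H (evw w + \sum_(e <- DW | phi e.1 w) evs e.2).

Fixpoint tuples n : seq (seq nat) :=
  if n is n'.+1 then [seq c :: l | c <- Lts, l <- tuples n'] else [:: [::]].
Definition sorted_lists n := undup (map sort_letters (tuples n)).
Definition words n : seq word := [seq (l, v) | l <- sorted_lists n, v <- iota 0 V].

Lemma tuplesP l : all (mem Lts) l -> l \in tuples (size l).
Proof.
elim: l => //= c l IH /andP[hc /IH hl].
by apply/allpairsP; exists (c, l).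
Qed.

Lemma wordsP w : valid w -> (sort_letters w.1, w.2) \in words (size w.1).
Proof.
case: w => l v /andP[hl hv]; apply/allpairsP; exists (sort_letters l, v).
by rewrite mem_iota mem_undup; split=> //; apply/map_f/tuplesP.
Qed.

Definition rep_check rels n (DW : seq (I * seq word)) :=
  let ech := echelon rels in
  all (fun w => nilp (reduce ech (xorw [:: w] (comb DW w)))) (words n).

Lemma rep_checkP (H : P4 -> Prop) rels n DW :
  (forall p, hit p -> H p) -> (forall p q, H p -> H q -> H (p + q)) ->
  allH H rels -> rep_check rels n DW -> represents H n DW.
Proof.
move=> H0 HD hr /allP hc [l v] /= sl hw.
have hm := wordsP hw; rewrite /= sl in hm; have /nilP e := hc _ hm.
have := reduce_nil H0 HD (echelonP H0 HD hr) e.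
rewrite evs_xor evs_cons evs_nil addr0 comb_evs => h.
under eq_bigl => i do rewrite -phi_sort_letters.
have := HD _ _ (H0 _ (sort_letters_heq l (winn_homog W v))) h.
by rewrite addrACA addpp add0r.
Qed.

Definition lead i := head 0%N (filter (lam i) Lts).
Definition extend (DW : seq (I * seq word)) :=
  [seq (e.1, consw (lead e.1) e.2) | e <- DW].

Definition absorbs (DW : seq (I * seq word)) := forall e c, e \in DW -> c \in Lts ->
  hit (evs (consw c e.2 ++ if lam e.1 c then consw (lead e.1) e.2 else [::])).

Definition absorb_check rels (DW : seq (I * seq word)) :=
  let ech := echelon rels in
  all (fun e => all (fun c => nilp (reduce ech (normalize (consw c e.2 ++
     if lam e.1 c then consw (lead e.1) e.2 else [::])))) Lts) DW.

Lemma absorb_checkP rels DW : allH hit rels -> absorb_check rels DW -> absorbs DW.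
Proof.
move=> hr hc e c he hc'; have /allP/(_ _ hc')/nilP := allP hc _ he.
move/(reduce_nil (fun p h => h) hitD (echelonP (fun p h => h) hitD hr)).
exact/heq_hit/heqS/normalize_heq.
Qed.

Lemma absorbs_extend n DW : (forall e, e \in DW -> len n e.2) ->
  absorbs DW -> absorbs (extend DW).
Proof.
move=> hn ha e c /mapP[[i ws] he ->] hc /=.
have hw := evs_homog (hn _ he); rewrite /= in hw.
rewrite evs_cat; apply: (@heqT (evs (consw (lead i) (consw c ws)))).
  by rewrite !evs_consw; apply: wcomm hw.
rewrite evs_consw; have := ha _ _ he hc; rewrite /= evs_cat => h0.
have ho b : evs (consw b ws) \is (wdeg W n.+1).-homog.
  by rewrite evs_consw; apply: wlet_homog.
case: (boolP (lam i c)) h0 => hl h0.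
  rewrite [X in _ ~= X]evs_consw /heq -mulrDr -sqrDp.
  by apply: (@wlift W _ n.+1 _ _ h0); apply: rpredD; apply: ho.
rewrite evs_nil addr0 in h0; rewrite evs_nil; apply: heq0.
exact: (@wlift W _ n.+1 _ (ho _) h0).
Qed.

Lemma represents_extend n DW : (forall e, e \in DW -> len n e.2) ->
  absorbs DW -> represents hit n DW -> represents hit n.+1 (extend DW).
Proof.
move=> hn ha hr [[|c l] v] //= [sl] /andP[/= /andP[hc hl] hv].
have hw := hr (l, v) sl; rewrite /valid /= hl hv in hw.
have {hw} := hw isT; set T := \sum_(e <- DW | _) _ => hw.
have hT : T \is (wdeg W n).-homog.
  by rewrite /T big_seq_cond; apply: rpred_sum => e /andP[/hn + _]; apply: evs_homog.
have h1 : evw (c :: l, v) ~= wlet W c * T ^+ 2.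
  rewrite /heq -mulrDr -sqrDp; apply: (@wlift W _ n _ _ hw).
  by apply: rpredD hT; have := evw_homog (l, v); rewrite /= sl.
apply: (heqT h1); rewrite /T sqr_sum mulr_sumr /extend big_map.
rewrite big_seq_cond [X in _ ~= X]big_seq_cond big_mkcond [X in _ ~= X]big_mkcond.
apply: heq_sum => -[i ws] _ /=; case he: ((i, ws) \in DW) => //=; last exact: heq_refl.
have := ha _ _ he hc; rewrite /= evs_cat evs_consw /phi /= -andbA.
case: (all (lam i) l && mu i v); last by rewrite andbF => _; apply: heq_refl.
by case: (lam i c); rewrite ?evs_consw ?evs_nil.
Qed.

Lemma len_extend n DW : (forall e, e \in DW -> len n e.2) ->
  forall e, e \in extend DW -> len n.+1 e.2.
Proof. by move=> hn e /mapP[e' /hn h ->]; apply: len_consw. Qed.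

(* Gauss-Jordan elimination of the matrix [phi i w], recording the row
   operations: the words attached to the pivot [i] are dual to the
   functionals at the pivots. *)
Definition vxor (u v : seq bool) := [seq x.1 (+) x.2 | x <- zip u v].
Definition gauss_row (B : seq (nat * (seq bool * seq word))) (r : seq bool * seq word) :=
  let add p (x y : seq bool * seq word) :=
    if nth false y.1 p then (vxor x.1 y.1, xorw x.2 y.2) else y in
  let r' := foldl (fun y b => add b.1 b.2 y) r B in
  let p := index true r'.1 in
  if (p < size r'.1)%N then (p, r') :: [seq (b.1, add p r' b.2) | b <- B] else B.
Definition dual_basis n (idx : seq I) : seq (I * seq word) :=
  let B := foldl gauss_row [::]
    [seq ([seq phi i w | i <- idx], [:: w]) | w <- words n] in
  [seq (ik.1, flatten [seq b.2.2 | b <- B & b.1 == ik.2]) | ik <- zip idx (iota 0 (size idx))].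
End Functionals.
End Words.

(** * Spikes *)

Lemma odd_bin2 n k : odd 'C(n.*2, k.*2) = odd 'C(n, k) /\ ~~ odd 'C(n.*2, k.*2.+1).
Proof.
elim: n k => [|n IH] k; first by case: k.
rewrite doubleS; split.
  case: k => [|k]; first by rewrite !bin0.
  rewrite doubleS !binS !oddD (IH k).1 -doubleS (IH k.+1).1.
  by rewrite (negPf (IH k).2) addbF.
case: k => [|k]; first by rewrite double0 bin1 /= odd_double.
rewrite binS (binS n.*2 k.+1.*2) binS -doubleS.
rewrite !oddD (negPf (IH k.+1).2) (negPf (IH k).2).
by case: (odd _).
Qed.

Lemma odd_bin2S n k : odd 'C(n.*2.+1, k.*2) = odd 'C(n, k).
Proof.
case: k => [|k]; first by rewrite !bin0.
by rewrite doubleS binS oddD -doubleS (odd_bin2 n k.+1).1 (negPf (odd_bin2 n k).2) addbF.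
Qed.

(* The coefficient of x^m in (x + x^2)^e. *)
Definition sqbin e m : bool := (e <= m)%N && odd 'C(e, m - e).

Lemma sqbin_dS e m : sqbin e.*2 m.*2.+1 = false.
Proof.
rewrite /sqbin; case: leqP => //= h.
have -> : (m.*2.+1 - e.*2 = (m - e).*2.+1)%N by lia.
by rewrite (negPf (odd_bin2 _ _).2).
Qed.

Lemma sqbin_SS e m : sqbin e.*2.+1 m.*2.+1 = sqbin e m.
Proof.
rewrite /sqbin ltnS leq_double; case: leqP => //= h.
by rewrite subSS -doubleB odd_bin2S.
Qed.

Fixpoint ones k := if k is k'.+1 then (ones k').*2.+1 else 0%N.

Lemma sqbin_ones e k : sqbin e (ones k) -> e = ones k.
Proof.
elim: k e => [|k IH] e /=; first by case: e.
rewrite -[e]odd_double_half; case: (odd e) => /=; last by rewrite add0n sqbin_dS.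
by rewrite add1n sqbin_SS => /IH <-.
Qed.

Lemma mcoeff_prod_sq (e m : 'X_{1..4}) :
  (\prod_(i < 4) ('X_i + 'X_i ^+ 2) ^+ e i : P4)@_m = [forall i, sqbin (e i) (m i)]%:R.
Proof.
set N := (mdeg e + mdeg m).+1.
have le_mdeg (x : 'X_{1..4}) i : (x i <= mdeg x)%N.
  by rewrite mdegE (bigD1 i) //= leq_addr.
have -> : \prod_(i < 4) ('X_i + 'X_i ^+ 2) ^+ e i =
    \prod_(i < 4) \sum_(j < N) 'C(e i, j)%:R *: ('X_i : P4) ^+ (e i + j).
  apply: eq_bigr => i _; rewrite exprDn.
  have hN : ((e i).+1 <= N)%N by rewrite ltnS (leq_trans (le_mdeg e i)) ?leq_addr.
  rewrite (big_ord_widen _ (fun j => ('X_i ^+ (e i - j) * ('X_i ^+ 2) ^+ j) *+ 'C(e i, j)) hN).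
  rewrite big_mkcond; apply: eq_bigr => j _; rewrite ltnS.
  case: leqP => h; last by rewrite bin_small // scale0r.
  by rewrite scaler_nat -exprM -exprD; congr (_ ^+ _ *+ _); lia.
rewrite bigA_distr_bigA raddf_sum /=.
have cf (f : {ffun 'I_4 -> 'I_N}) :
   (\prod_i ('C(e i, f i)%:R *: ('X_i : P4) ^+ (e i + f i)))@_m =
   (\prod_i 'C(e i, f i)%:R) * ([multinom e i + f i | i < 4]%N == m)%:R.
  rewrite scaler_prod mcoeffZ -mcoeffX (mpolyXE_id _ [multinom _ | _ < _]); congr (_ * _@__).
  by apply: eq_bigr => i _; rewrite mnmE.
rewrite (eq_bigr _ (fun f _ => cf f)).
case: (boolP [forall i, e i <= m i]%N) => [/forallP hle | /forallPn[i hi]]; last first.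
  rewrite big1 => [|f _].
    by case: forallP => [/(_ i)|_]; rewrite /sqbin ?(negPf hi).
  case: eqP => [h|_]; last by rewrite mulr0.
  by move/mnmP: h hi => /(_ i); rewrite mnmE => <-; rewrite leq_addr.
have hlt i : (m i - e i < N)%N.
  by rewrite ltnS (leq_trans (leq_subr _ _)) // (leq_trans (le_mdeg m i)) ?leq_addl.
pose f0 : {ffun 'I_4 -> 'I_N} := [ffun i => Ordinal (hlt i)].
rewrite (bigD1 f0) //= [X in _ + X]big1 ?addr0 => [|f ne].
  have -> : [multinom e i + f0 i | i < 4]%N == m.
    by apply/eqP/mnmP => i; rewrite mnmE ffunE /= subnKC.
  rewrite mulr1 (eq_bigr (fun i => (sqbin (e i) (m i))%:R)) => [|i _]; last first.
    by rewrite [LHS]F2_odd /f0 ffunE /sqbin hle.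
  case: forallP => [h|/forallP/forallPn[i hi]]; first by rewrite big1 // => i _; rewrite h.
  by rewrite (bigD1 i) //= (negPf hi) mul0r.
case: eqP => [h|_]; last by rewrite mulr0.
case/eqP: ne; apply/ffunP => i; apply: val_inj; rewrite ffunE /=.
by rewrite -h mnmE addKn.
Qed.

Lemma mcoeff_pihomog d (p : P4) m : (pihomog mdeg d p)@_m = if mdeg m == d then p@_m else 0.
Proof.
rewrite pihomogE raddf_sum /=.
case: ifP => hm.
  rewrite [in RHS](mpolyE p) raddf_sum /= big_mkcond; apply: eq_bigr => k _ /=.
  rewrite mcoeffZ mcoeffX; case: ifP => // /negbT ne.
  by case: eqP => [e|]; rewrite ?mulr0 //; rewrite e hm in ne.
rewrite big1 // => k /eqP e; rewrite mcoeffZ mcoeffX.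
by case: eqP => [ek|]; rewrite ?mulr0 //; rewrite -ek e eqxx in hm.
Qed.

Lemma mcoeff_SqX k (e m : 'X_{1..4}) : (Sq k 'X_[e])@_m =
  ((mdeg m == mdeg e + k)%N && [forall i, sqbin (e i) (m i)])%:R.
Proof.
rewrite SqX /SqMon hcomp_pihomog mcoeff_pihomog mcoeff_prod_sq.
by case: ifP.
Qed.

Definition spike (m : 'X_{1..4}) := forall i, exists k, m i = ones k.

Lemma mcoeff_hit_spike p m : spike m -> hit p -> p@_m = 0.
Proof.
move=> hm; elim=> [|k f q k0 _ IH]; first exact: mcoeff0.
rewrite mcoeffD IH addr0 (mpolyE f) Sq_sum raddf_sum big1 // => e _ /=.
rewrite SqZ mcoeffZ mcoeff_SqX; case: eqP => //= [hd|_]; last by rewrite mulr0.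
case: forallP => [h|_]; last by rewrite mulr0.
suff em : e = m by rewrite em in hd; lia.
by apply/mnmP => i; have := h i; have [j ->] := hm i; apply: sqbin_ones.
Qed.

Lemma mcoeff_mul_sqr d (p F : P4) (r m : 'X_{1..4}) :
  p \is d.-homog -> (d <= mdeg r)%N -> (forall i, r i <= 1)%N ->
  (p * F ^+ 2)@_(r + m *+ 2) = p@_r * F@_m.
Proof.
move=> hp hd hr.
have key n k : mdeg n = d -> (n + k *+ 2 == r + m *+ 2)%MM -> n = r /\ k = m.
  move=> hn /eqP/mnmP h.
  have hi i : (n i + (k i).*2 = r i + (m i).*2)%N.
    by have := h i; rewrite !mnmDE -!addnn.
  have le i : (r i <= n i)%N by have := hi i; have := hr i; lia.
  have en : n = r.
    apply/mnmP => i; apply/eqP; rewrite eqn_leq le andbT leqNgt; apply/negP => lt.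
    have : (mdeg r < mdeg n)%N.
      rewrite !mdegE (bigD1 i) //= [X in (_ < X)%N](bigD1 i) //=.
      by rewrite -addSn leq_add // leq_sum.
    by rewrite hn ltnNge hd.
  by split=> //; apply/mnmP => i; have := hi i; rewrite en; lia.
rewrite [in LHS](mpolyE p) [in LHS](mpolyE F) sqr_sum big_distrlr /= raddf_sum /=.
have hc n k : (p@_n *: 'X_[n] * (F@_k *: 'X_[k]) ^+ 2)@_(r + m *+ 2) =
    p@_n * F@_k * (n + k *+ 2 == r + m *+ 2)%MM%:R.
  by rewrite sqrZp mpolyXn -scalerAl -scalerAr -mpolyXD !mcoeffZ mcoeffX mulrA.
rewrite (eq_big_seq (fun n => if n == r then p@_r * F@_m else 0)) => [|n hn]; last first.
  rewrite raddf_sum /= (eq_bigr _ (fun k _ => hc n k)).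
  have dn := dhomog_mf hp hn.
  case: eqP => [->|ne].
    rewrite (eq_big_seq (fun k => if k == m then p@_r * F@_m else 0)) => [|k _]; last first.
      case: (eqVneq k m) => [->|nek]; first by rewrite eqxx mulr1.
      case: eqP => [e|]; last by rewrite mulr0.
      have e' : (r + k *+ 2 == r + m *+ 2)%MM by apply/eqP.
      move/mnmP: e => e; case/eqP: nek; apply/mnmP => i; have := e i.
      by rewrite !mnmDE; lia.
    rewrite -big_mkcond; case: (boolP (m \in msupp F)) => hm.
      rewrite -big_filter; have -> : [seq k <- msupp F | k == m] = [:: m].
        exact: filter_pred1_uniq (msupp_uniq F) hm.
      by rewrite big_seq1.
    by rewrite (memN_msupp_eq0 hm) mulr0 big1.
  rewrite big1 // => k _; case: eqP => [e|]; last by rewrite mulr0.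
  by case: ne; apply: (proj1 (key _ k dn _)); apply/eqP.
rewrite -big_mkcond; case: (boolP (r \in msupp p)) => hm.
  rewrite -big_filter; have -> : [seq n <- msupp p | n == r] = [:: r].
    exact: filter_pred1_uniq (msupp_uniq p) hm.
  by rewrite big_seq1.
by rewrite (memN_msupp_eq0 hm) mul0r big1.
Qed.

(** * Linear substitutions and the Kameko map *)

Lemma act_is_additive g : additive (act g).
Proof. exact: comp_mpoly_is_additive. Qed.
Lemma act_is_multiplicative g : multiplicative (act g).
Proof. exact: comp_mpoly_is_multiplicative. Qed.
HB.instance Definition _ g := GRing.isAdditive.Build P4 P4 (act g) (act_is_additive g).
HB.instance Definition _ g :=
  GRing.isMultiplicative.Build P4 P4 (act g) (act_is_multiplicative g).

Lemma actX g i : act g 'X_i = \sum_(j < 4) g j i *: 'X_j.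
Proof. by rewrite /act comp_mpolyXU -tnth_nth tnth_mktuple. Qed.

Lemma actZ g c p : act g (c *: p) = c *: act g p.
Proof. exact: comp_mpolyZ. Qed.

Lemma act_0 g : act g 0 = 0.
Proof. exact: raddf0. Qed.

Lemma act_sum g I (r : seq I) (P : pred I) (F : I -> P4) :
  act g (\sum_(i <- r | P i) F i) = \sum_(i <- r | P i) act g (F i).
Proof. exact: raddf_sum. Qed.

Lemma rmorph_eq (R : comNzRingType) (f g : {rmorphism P4 -> R}) :
  (forall c, f c%:MP = g c%:MP) -> (forall i, f 'X_i = g 'X_i) -> f =1 g.
Proof.
move=> hc hX p; rewrite (mpolyE p) !raddf_sum; apply: eq_bigr => m _ /=.
rewrite -mul_mpolyC !rmorphM /= hc mpolyXE_id !rmorph_prod; congr (_ * _).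
by apply: eq_bigr => i _; rewrite !rmorphXn hX.
Qed.

Lemma act_Sqt g p : Sqt (act g p) = map_poly (act g) (Sqt p).
Proof.
pose u : {rmorphism P4 -> {poly P4}} := Sqt \o act g.
pose v : {rmorphism P4 -> {poly P4}} := map_poly (act g) \o Sqt.
apply: (@rmorph_eq _ u v) => [c|i]; rewrite /u /v /=.
  by rewrite /Sqt /act comp_mpolyC !mmapC /= map_polyC /= comp_mpolyC.
rewrite SqtX rmorphD rmorphM /= !map_polyC map_polyX /= rmorphXn /= actX.
rewrite raddf_sum sqr_sum !rmorph_sum mulr_suml -big_split; apply: eq_bigr => j _ /=.
rewrite SqtZ SqtX mulrDr mulrA -!polyCM !mul_mpolyC sqrZp.
by [].
Qed.

Lemma act_Sq g k p : Sq k (act g p) = act g (Sq k p).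
Proof. by rewrite !SqE act_Sqt coef_map. Qed.

Lemma act_hit g p : hit p -> hit (act g p).
Proof.
elim=> [|k f q k0 _ IH]; first by rewrite raddf0; apply: hit0.
by rewrite raddfD /= -act_Sq; constructor.
Qed.

Lemma actX_homog g i : act g 'X_i \is 1.-homog.
Proof.
by rewrite actX; apply: rpred_sum => j _; rewrite rpredZ // dhomogX; apply/eqP/mdeg1.
Qed.

Lemma actXm_homog g m : act g 'X_[m] \is (mdeg m).-homog.
Proof.
rewrite mpolyXE_id rmorph_prod mdegE.
elim/big_rec2: _ => [|i d p _ h]; first exact: dhomog1.
apply: dhomogM h; rewrite rmorphXn /= -[X in X.-homog]mul1n.
exact/dhomogMn/actX_homog.
Qed.

Lemma act_homog g d p : p \is d.-homog -> act g p \is d.-homog.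
Proof.
move=> hp; rewrite (mpolyE p) raddf_sum big_seq; apply: rpred_sum => m hm /=.
by rewrite actZ rpredZ // -(dhomog_mf hp hm) actXm_homog.
Qed.

Lemma act_comp h g p : act h (act g p) = act (h *m g) p.
Proof.
pose u : {rmorphism P4 -> P4} := act h \o act g.
pose v : {rmorphism P4 -> P4} := act (h *m g).
apply: (@rmorph_eq _ u v) => [c|i]; rewrite /u /v /=.
  by rewrite /act !comp_mpolyC.
rewrite !actX raddf_sum /= (eq_bigr (fun j => \sum_(k < 4) (h k j * g j i) *: 'X_k)).
  by rewrite exchange_big; apply: eq_bigr => k _ /=; rewrite mxE scaler_suml.
move=> j _; rewrite actZ actX scaler_sumr; apply: eq_bigr => k _.
by rewrite scalerA mulrC.
Qed.

Lemma act1 p : act 1%:M p = p.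
Proof.
pose v : {rmorphism P4 -> P4} := idfun.
apply: (@rmorph_eq _ (act 1%:M) v) => [c|i]; rewrite /v /=.
  by rewrite /act comp_mpolyC.
rewrite actX (bigD1 i) //= mxE eqxx scale1r big1 ?addr0 // => j ne.
by rewrite mxE (negPf ne) scale0r.
Qed.

Definition one4 : 'X_{1..4} := [multinom 1%N | i < 4].
Definition parm (m : 'X_{1..4}) : 'X_{1..4} := [multinom (odd (m i) : nat) | i < 4].

Lemma mnm_half m : m = (parm m + halfm m *+ 2)%MM.
Proof.
by apply/mnmP => i; rewrite mnmDE mnmDE !mnmE addnn odd_double_half.
Qed.

Lemma mdeg_dbl (r m : 'X_{1..4}) : mdeg (r + m *+ 2)%MM = (mdeg r + (mdeg m).*2)%N.
Proof. by rewrite mdegD mdegMn muln2. Qed.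

Lemma mpolyX_parm m : 'X_[m] = 'X_[parm m] * 'X_[halfm m] ^+ 2 :> P4.
Proof. by rewrite mpolyXn -mpolyXD -mnm_half. Qed.

Lemma parm_le1 m i : (parm m i <= 1)%N.
Proof. by rewrite mnmE; case: odd. Qed.

Lemma mdeg_one4 : mdeg one4 = 4%N.
Proof. by rewrite mdegE sum_ord4 !mnmE. Qed.

Lemma parm_one4 m : (parm m == one4) = [forall i, odd (m i)].
Proof.
apply/eqP/forallP => [h i|h].
  by have /mnmP/(_ i) := h; rewrite !mnmE; case: odd.
by apply/mnmP => i; rewrite !mnmE h.
Qed.

Lemma mdeg_parm m : (mdeg (parm m) <= 4)%N /\ (parm m != one4 -> mdeg (parm m) < 4)%N.
Proof.
have e4 : 4%N = \sum_(i < 4) 1%N by rewrite sum1_card card_ord.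
rewrite !mdegE; split; first by rewrite [X in (_ <= X)%N]e4 leq_sum // => i _; apply: parm_le1.
rewrite parm_one4 => /forallPn[i hi]; rewrite [X in (_ < X)%N]e4 (bigD1 i) //= [X in (_ < X)%N](bigD1 i) //=.
rewrite mnmE (negPf hi) add0n ltnS leq_sum // => j _; apply: parm_le1.
Qed.

Lemma mcoeff_kameko p m : (kameko p)@_m = p@_(one4 + m *+ 2).
Proof.
rewrite /kameko [in RHS](mpolyE p) !raddf_sum /=; apply: eq_bigr => k _.
rewrite !mcoeffZ mcoeffX; congr (_ * _).
rewrite -parm_one4; case: eqP => [h|h].
  rewrite mcoeffX [in RHS](mnm_half k) h; congr (nat_of_bool _)%:R.
  apply/eqP/eqP => [<-|e]; first by congr (_ + _ *+ 2)%MM; apply/mnmP => i; rewrite !mnmE.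
  by apply/mnmP => i; move/mnmP: e => /(_ i); rewrite !mnmDE !mnmE; lia.
rewrite mcoeff0; case: eqP => // e; case: h; rewrite e.
by apply/mnmP => i; rewrite !mnmE addnn oddD odd_double.
Qed.

Lemma kamekoD p q : kameko (p + q) = kameko p + kameko q.
Proof. by apply/mpolyP => m; rewrite mcoeffD !mcoeff_kameko mcoeffD. Qed.
Lemma kameko0 : kameko 0 = 0.
Proof. by apply/mpolyP => m; rewrite mcoeff_kameko !mcoeff0. Qed.
Lemma kamekoZ c p : kameko (c *: p) = c *: kameko p.
Proof. by apply/mpolyP => m; rewrite mcoeffZ !mcoeff_kameko mcoeffZ. Qed.
Lemma kameko_sum I (r : seq I) (P : pred I) (F : I -> P4) :
  kameko (\sum_(i <- r | P i) F i) = \sum_(i <- r | P i) kameko (F i).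
Proof. exact: (big_morph _ kamekoD kameko0). Qed.

Lemma kameko_mul_sqr d p F : p \is d.-homog -> (d <= 4)%N ->
  kameko (p * F ^+ 2) = p@_one4 *: F.
Proof.
move=> hp hd; apply/mpolyP => m; rewrite mcoeff_kameko mcoeffZ.
by apply: (mcoeff_mul_sqr _ _ hp); rewrite ?mdeg_one4 // => i; rewrite mnmE.
Qed.

Lemma kamekoX m : kameko 'X_[m] = if parm m == one4 then 'X_[halfm m] else 0.
Proof.
rewrite mpolyX_parm; have hp : 'X_[parm m] \is [in F2[4], (mdeg (parm m)).-homog] by rewrite dhomogX.
rewrite (kameko_mul_sqr _ hp (mdeg_parm m).1) mcoeffX.
by case: eqP; rewrite ?scale1r ?scale0r.
Qed.

Lemma homog_kameko d p : p \is (d.*2 + 4)%N.-homog -> kameko p \is d.-homog.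
Proof.
move=> hp; apply/dhomogP => m; rewrite mcoeff_msupp mcoeff_kameko => h.
have : mdeg (one4 + m *+ 2)%MM = (d.*2 + 4)%N.
  apply/eqP; apply: contraNT h => ne; apply/eqP.
  exact: (dhomog_nemf_coeff hp ne).
rewrite mdeg_dbl mdeg_one4 => e.
by apply: double_inj; apply/eqP; rewrite -(eqn_add2l 4) [X in X == _]e addnC.
Qed.

Lemma kameko_hit p : hit p -> hit (kameko p).
Proof.
elim=> [|k f q k0 _ IH]; first by rewrite kameko0; apply: hit0.
rewrite kamekoD; apply: hitD IH.
rewrite (mpolyE f) Sq_sum kameko_sum; apply: hit_sum => e _.
rewrite SqZ kamekoZ; apply: hitZ.
case: (boolP ((parm e == one4) && ~~ odd k)) => [/andP[/eqP he hk]|h].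
  have -> : kameko (Sq k 'X_[e]) = Sq k./2 'X_[halfm e].
    apply/mpolyP => m; rewrite mcoeff_kameko !mcoeff_SqX.
    congr (nat_of_bool _)%:R; congr andb.
      have de : mdeg e = (4 + (mdeg (halfm e)).*2)%N.
        by rewrite {1}(mnm_half e) he mdeg_dbl mdeg_one4.
      by rewrite mdeg_dbl mdeg_one4 de; apply/eqP/eqP; lia.
    apply: eq_forallb => i; have ei : e i = (halfm e i).*2.+1.
      have /mnmP/(_ i) := he; rewrite !mnmE => h.
      by rewrite -{1}(odd_double_half (e i)) h add1n.
    by rewrite ei !mnmE addnn add1n sqbin_SS.
  by apply: hit_Sq; move: k0 hk; case: k => [|[|k]].
suff -> : kameko (Sq k 'X_[e]) = 0 by apply: hit0.
apply/mpolyP => m; rewrite mcoeff_kameko mcoeff_SqX mcoeff0.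
case: (boolP (_ && _)) => // /andP[/eqP hd /forallP hs]; case/negP: h.
have he i : odd (e i).
  have := hs i; rewrite !mnmE addnn add1n -{1}[e i]odd_double_half.
  by case: (odd (e i)) => //=; rewrite add0n sqbin_dS.
have -> : parm e == one4 by rewrite parm_one4; apply/forallP.
move: hd; rewrite mdeg_dbl mdeg_one4 (mdegE e) sum_ord4.
by have := he (inord 0); have := he (inord 1); have := he (inord 2); have := he (inord 3); lia.
Qed.

Lemma kameko_act g f : g \in unitmx -> kameko (act g f) = act g (kameko f).
Proof.
have semi h p : kameko (act h p) = (act h 'X_[one4])@_one4 *: act h (kameko p).
  rewrite [in LHS](mpolyE p) [in RHS](mpolyE p) act_sum !kameko_sum act_sum scaler_sumr.
  apply: eq_bigr => m _ /=; rewrite actZ !kamekoZ actZ scalerA mulrC -scalerA.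
  congr (_ *: _); rewrite kamekoX mpolyX_parm rmorphM rmorphXn /=.
  rewrite (kameko_mul_sqr _ (actXm_homog h _) (mdeg_parm m).1).
  case: eqP => [e|/eqP ne]; first by rewrite [X in 'X_[X]]e.
  have h0 : (act h 'X_[parm m])@_one4 = 0.
    apply: (dhomog_nemf_coeff (actXm_homog h _)).
    by rewrite [X in X != _]mdeg_one4 gtn_eqF // (mdeg_parm m).2.
  by rewrite [X in X *: _ = _]h0 [LHS]scale0r act_0 [RHS]scaler0.
move=> hg; rewrite semi; have [e|->] := F2_cases (act g 'X_[one4])@_one4; last by rewrite scale1r.
have := semi g (act (invmx g) 'X_[one4]); rewrite act_comp (mulmxV hg) act1 e [RHS]scale0r kamekoX.
have -> : parm one4 == one4 by apply/eqP/mnmP => i; rewrite !mnmE.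
move/(congr1 (mcoeff (halfm one4))); rewrite mcoeffX eqxx mcoeff0 => /eqP.
by rewrite oner_eq0.
Qed.

Local Open Scope nat_scope.

(** * Tables for quadratic and cubic letters *)

Fixpoint lists_over (T : Type) (s : seq T) n : seq (seq T) :=
  if n is n'.+1 then [seq x :: l | x <- s, l <- lists_over s n'] else [:: [::]].
Definition bits4 := lists_over [:: false; true] 4.
Definition bit (r : seq (seq bool)) i j := nth false (nth [::] r i) j.
Definition minor2 r i j := (bit r 0 i && bit r 1 j) (+) (bit r 0 j && bit r 1 i).
Definition minor3 r i j k :=
  (bit r 0 i && (bit r 1 j && bit r 2 k (+) bit r 1 k && bit r 2 j)) (+)
  (bit r 0 j && (bit r 1 i && bit r 2 k (+) bit r 1 k && bit r 2 i)) (+)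
  (bit r 0 k && (bit r 1 i && bit r 2 j (+) bit r 1 j && bit r 2 i)).

(* The letter x_i x_j with i < j has code 4 * i + j; the cubic letters have
   codes 0..3, the code of the missing variable. *)
Definition lets2 := [:: 1; 2; 3; 6; 7; 11].
Definition table2 r : seq bool * seq bool :=
  ([seq minor2 r (c %/ 4) (c %% 4) | c <- iota 0 16], [seq bit r 0 v | v <- iota 0 4]).

Definition supports : seq (seq nat) :=
  [:: [:: 0]; [:: 1]; [:: 2]; [:: 3]; [:: 0; 1]; [:: 0; 2]; [:: 0; 3]; [:: 1; 2];
      [:: 1; 3]; [:: 2; 3]; [:: 0; 1; 2]; [:: 0; 1; 3]; [:: 0; 2; 3]; [:: 1; 2; 3]].
Definition table3 r : seq bool * seq bool :=
  ([:: minor3 r 1 2 3; minor3 r 0 2 3; minor3 r 0 1 3; minor3 r 0 1 2],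
   [seq all (bit r 0) s | s <- supports]).

(* One matrix of rows for each functional of a separating family. *)
Definition rows2 := Eval vm_compute in
  let v := behead bits4 in
  flatten [seq [:: [:: a; b]; [:: b; a]] | a <- v, b <- [seq b <- v | (index a v < index b v) && (index b v < index (vxor a b) v)]].
Definition rows3 := Eval vm_compute in
  let v := behead bits4 in
  foldr (fun t acc => if has id (table3 t).1 && ~~ (table3 t \in map table3 acc) then t :: acc else acc) [::]
  (lists_over v 3).
Definition idx2 := Eval vm_compute in map table2 rows2.
Definition idx3 := Eval vm_compute in map table3 rows3.

Definition pair_code i j := if i < j then 4 * i + j else 4 * j + i.

Definition kos_rel m (p : seq nat) : seq word :=
  let i := nth 0 p 0 in let j := nth 0 p 1 in let k := nth 0 p 2 in
  [:: (nseq m (pair_code j k), i); (nseq m (pair_code i k), j); (nseq m (pair_code i j), k)].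
Definition plucker_rel v : seq word :=
  [:: ([:: pair_code 1 2; pair_code 0 3], v); ([:: pair_code 0 2; pair_code 1 3], v); ([:: pair_code 0 1; pair_code 2 3], v)].
Definition perms := filter uniq (lists_over (iota 0 4) 4).
Definition swap_rel2 (p : seq nat) v : seq word :=
  let x := nth 0 p 0 in let y := nth 0 p 1 in let z := nth 0 p 2 in
  [:: ([:: pair_code x z; pair_code x z; pair_code x y], v); ([:: pair_code x y; pair_code x y; pair_code x z], v)].
Definition mixed_rel2 (p : seq nat) : seq word :=
  let x := nth 0 p 0 in let y := nth 0 p 1 in
  let b := nth 0 p 2 in let l := nth 0 p 3 in
  [:: ([:: pair_code y b; pair_code y b; pair_code y l], x); ([:: pair_code x b; pair_code x b; pair_code x l], y);
      ([:: pair_code x y; pair_code x b; pair_code x l], y); ([:: pair_code x y; pair_code y b; pair_code y l], x)].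

Definition base2 n : seq (seq word) :=
  match n with
  | 1 => map (kos_rel 1) perms
  | 2 => map (kos_rel 2) perms ++ map plucker_rel (iota 0 4)
  | 3 => map (kos_rel 3) perms ++ map mixed_rel2 perms ++
         [seq swap_rel2 p v | p <- perms, v <- iota 0 4]
  | _ => [::]
  end.
Definition rels_of lets (base : nat -> seq (seq word)) n : seq (seq word) :=
  flatten [seq [seq normalize (catw t r) | t <- sorted_lists lets (n - k), r <- base k]
          | k <- [seq k <- [:: 1; 2; 3] | k <= n]].
Definition rels2 := rels_of lets2 base2.

Definition dual_words2_at2 := Eval vm_compute in dual_basis lets2 4 2 idx2.
Definition dual_words2_at3 := Eval vm_compute in dual_basis lets2 4 3 idx2.

Definition union (s t : seq nat) := [seq i <- iota 0 4 | (i \in s) || (i \in t)].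
Definition code s := index s supports.
Definition kosq_rel m (s : seq nat) : seq word :=
  [seq (nseq m i, code (union [:: i] s)) | i <- iota 0 4].
Definition swap_rel3 a b v : seq word := [:: ([:: a; a; b], v); ([:: b; b; a], v)].
Definition lets3 := iota 0 4.
Definition base3 n : seq (seq word) :=
  match n with
  | 1 => map (kosq_rel 1) (take 10 supports)
  | 2 => map (kosq_rel 2) (take 10 supports)
  | 3 => map (kosq_rel 3) (take 10 supports) ++
         [seq swap_rel3 ab.1 ab.2 v | ab <- [:: (0,1);(0,2);(0,3);(1,2);(1,3);(2,3)], v <- iota 0 14]
  | _ => [::]
  end.
Definition rels3 := rels_of lets3 base3.
Definition f0w : seq word := [seq ([:: i], i) | i <- iota 0 4].
Definition dual_words3_at0 := Eval vm_compute in dual_basis lets3 14 0 idx3.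
Definition dual_words3_at1 := Eval vm_compute in dual_basis lets3 14 1 idx3.
Definition dual_words3_at2 := Eval vm_compute in dual_basis lets3 14 2 idx3.
Definition dual_words3_at3 := Eval vm_compute in dual_basis lets3 14 3 idx3.
Local Open Scope ring_scope.

Fixpoint deg2 n := if n is n'.+1 then (deg2 n').*2.+2 else 1%N.
Definition let2 c : P4 := xv (c %/ 4) * xv (c %% 4).

Lemma let2_homog c n f : f \is (deg2 n).-homog -> let2 c * f ^+ 2 \is (deg2 n.+1).-homog.
Proof.
move=> hf; have -> : deg2 n.+1 = (1 + 1 + deg2 n * 2)%N by rewrite /= muln2; lia.
by apply: dhomogM (dhomogMn 2 hf); apply: dhomogM; apply: xv_homog.
Qed.

Definition sys2 := @Wordsys let2 xv deg2 let2_homog xv_homog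
  (fun c n f _ hf => hit_lift2 (lin_xv _) (lin_xv _) hf)
  (fun b c n g _ => comm2 g (lin_xv _) (lin_xv _) (lin_xv _) (lin_xv _)).

Fixpoint deg3 n := if n is n'.+1 then ((deg3 n').*2 + 3)%N else 3%N.

Lemma odd_deg3 n : odd (deg3 n).
Proof. by case: n => //= n; rewrite oddD odd_double. Qed.

Definition support_poly (s : seq nat) : P4 :=
  match s with
  | [:: a; b] => xv a * xv b ^+ 2
  | [:: a; b; c] => xv a * xv b * xv c
  | _ => xv (head 0%N s) ^+ 3
  end.
Definition inn3 v := support_poly (nth [::] supports v).

Lemma inn3_homog v : inn3 v \is 3.-homog.
Proof.
rewrite /inn3; move: (nth _ _ _) => s.
have h1 a : xv a ^+ 3 \is (1 * 3)%N.-homog by apply/dhomogMn/xv_homog.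
have h2 a b : xv a * xv b ^+ 2 \is (1 + 1 * 2)%N.-homog.
  by apply: dhomogM (xv_homog a) (dhomogMn 2 (xv_homog b)).
have h3 a b c : xv a * xv b * xv c \is (1 + 1 + 1)%N.-homog.
  exact: dhomogM (dhomogM (xv_homog a) (xv_homog b)) (xv_homog c).
case: s => [|a [|b [|c [|d s]]]].
- exact: h1.
- exact: h1.
- exact: h2.
- exact: h3.
- exact: h1.
Qed.

Lemma let3_homog c n f : f \is (deg3 n).-homog -> qv c * f ^+ 2 \is (deg3 n.+1).-homog.
Proof.
move=> hf; have -> : deg3 n.+1 = (3 + deg3 n * 2)%N by rewrite /= muln2 addnC.
exact: dhomogM (qv_homog c) (dhomogMn 2 hf).
Qed.

Definition sys3 := @Wordsys qv inn3 deg3 let3_homog inn3_homog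
  (fun c n f hf h => hit_lift_cubic c hf (odd_deg3 n) h)
  (fun b c n g hg => comm_cubic b c hg (odd_deg3 n)).

Lemma rels_of_hit W lets base n :
  (forall k r, r \in base k -> len k r /\ hit (evs W r)) ->
  allH W hit (rels_of lets base n).
Proof.
move=> hb x /flattenP[s /mapP[k _ ->]] /allpairsP[[t r] [_ /hb[hl hr] ->]].
apply: (heq_hit (normalize_heq W _)); rewrite evs_catw.
exact: (evl_hit t (evs_homog W hl) hr).
Qed.

Lemma let2_pair_code i j : (i < 4)%N -> (j < 4)%N -> let2 (pair_code i j) = xv i * xv j.
Proof.
have h a b : (b < 4)%N -> let2 (4 * a + b) = xv a * xv b.
  by move=> hb; rewrite /let2 mulnC divnMDl // divn_small // addn0 modnMDl modn_small.
by move=> hi hj; rewrite /pair_code; case: ifP => _; rewrite h // mulrC.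
Qed.

Lemma permsP p : p \in perms ->
  [/\ nth 0 p 0 < 4, nth 0 p 1 < 4, nth 0 p 2 < 4 & nth 0 p 3 < 4]%N.
Proof.
have /allP h : all (fun p => [&& nth 0 p 0 < 4, nth 0 p 1 < 4, nth 0 p 2 < 4 & nth 0 p 3 < 4]%N) perms.
  by vm_compute.
by move/h => /and4P.
Qed.

Lemma evs_seq3 W a b c : evs W [:: a; b; c] = evw W a + evw W b + evw W c.
Proof. by rewrite !evs_cons evs_nil addr0 addrA. Qed.
Lemma evs_seq2 W a b : evs W [:: a; b] = evw W a + evw W b.
Proof. by rewrite !evs_cons evs_nil addr0. Qed.
Lemma evs_seq4 W a b c d : evs W [:: a; b; c; d] = evw W a + evw W b + evw W c + evw W d.
Proof. by rewrite !evs_cons evs_nil addr0 !addrA. Qed.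

Lemma base2_hit k r : r \in base2 k -> len k r /\ hit (evs sys2 r).
Proof.
have kos m p : p \in perms -> (0 < m <= 3)%N -> hit (evs sys2 (kos_rel m p)).
  case/permsP; rewrite /kos_rel; move: (nth _ _ _) (nth _ _ 1%N) (nth _ _ 2) => i j l hi hj hl _.
  have h1 := koszul3 1 (lin_xv i) (lin_xv j) (lin_xv l).
  have h2 := koszul3_level2 1 (lin_xv i) (lin_xv j) (lin_xv l).
  have h3 := koszul3_level3 1 (lin_xv i) (lin_xv j) (lin_xv l).
  rewrite !mulr1 in h1 h2 h3.
  case: m => [|[|[|[|m]]]] // _; rewrite evs_seq3 /evw /= (let2_pair_code hj hl) (let2_pair_code hi hl) (let2_pair_code hi hj).
  - exact: h1.
  - exact: h2.
  - exact: h3.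
case: k => [|[|[|[|k]]]]; rewrite /base2.
- by [].
- by move=> /mapP[p hp ->]; split; [ | apply: kos].
- rewrite mem_cat => /orP[] /mapP[p hp ->]; split=> //; first exact: kos.
  rewrite evs_seq3 /evw /= !let2_pair_code; try by [].
  exact: (plucker (xv p) (lin_xv 0) (lin_xv 1) (lin_xv 2) (lin_xv 3)).
- rewrite mem_cat => /orP[|]; last rewrite mem_cat => /orP[].
  + by move=> /mapP[p hp ->]; split; [ | apply: kos].
  + move=> /mapP[p /permsP[+ + + +] ->]; rewrite /mixed_rel2.
    move: (nth _ _ _) (nth _ _ 1%N) (nth _ _ 2) (nth _ _ 3) => x y b l hx hy hb hl.
    split; first by [].
    rewrite evs_seq4 /evw /= (let2_pair_code hy hb) (let2_pair_code hy hl) (let2_pair_code hx hb) (let2_pair_code hx hl) (let2_pair_code hx hy).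
    by have := mixed_rel 1 (lin_xv x) (lin_xv y) (lin_xv b) (lin_xv l); rewrite !mulr1.
  + move=> /allpairsP[[p v] [/permsP[+ + + _] _ ->]]; rewrite /swap_rel2 /=.
    move: (nth _ _ _) (nth _ _ 1%N) (nth _ _ 2) => x y z hx hy hz.
    split; first by [].
    rewrite evs_seq2 /evw /= (let2_pair_code hx hz) (let2_pair_code hx hy).
    exact: (square_swap2 (xv v) (lin_xv x) (lin_xv y) (lin_xv z)).
- by [].
Qed.

Definition support_quad (s : seq nat) : P4 :=
  match s with [:: a; b] => xv a * xv b | _ => xv (head 0%N s) ^+ 2 end.

Lemma sqr_swap a b : xv a ^+ 2 * xv b ~= xv a * xv b ^+ 2.
Proof.
by rewrite /heq -(Sq1_lin2 (lin_xv a) (lin_xv b)); apply: hit_Sq.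
Qed.

Lemma support_mul i s : (i < 4)%N -> s \in take 10 supports ->
  xv i * support_quad s ~= inn3 (code (union [:: i] s)).
Proof.
move=> hi hs; have sw a b p : p = xv a ^+ 2 * xv b -> p ~= xv a * xv b ^+ 2.
  by move=> ->; apply: sqr_swap.
have rf p q : p = q -> p ~= q by move=> ->; apply: heq_refl.
have -> : inn3 (code (union [:: i] s)) = support_poly (union [:: i] s).
  rewrite /inn3 /code nth_index //; move: i hi s hs.
  have /allP h : all (fun i => all (fun s => union [:: i] s \in supports) (take 10 supports)) (iota 0 4).
    by vm_compute.
  by move=> i hi s hs; apply: (allP (h i _) s hs); rewrite mem_iota.
have : (i, s) \in [seq (i, s) | i <- iota 0 4, s <- take 10 supports].
  by apply/allpairsP; exists (i, s); rewrite mem_iota.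
rewrite /= !inE.
do ![case/predU1P=> [[-> ->]|]; [by first [apply: rf; rewrite /support_quad /=; ring | apply: sw; rewrite /support_quad /=; ring] |]].
by move=> /eqP[-> ->]; apply: rf; rewrite /support_quad /=; ring.
Qed.

Lemma quad_homog s i : xv i * support_quad s \is (deg3 0).-homog.
Proof.
have h1 a : xv a ^+ 2 \is (1 * 2)%N.-homog by apply/dhomogMn/xv_homog.
have h2 a b : xv a * xv b \is (1 + 1)%N.-homog by apply: dhomogM; apply: xv_homog.
have h : support_quad s \is 2.-homog.
  by case: s => [|a [|b [|c s]]]; [apply: h1 | apply: h1 | apply: h2 | apply: h1].
exact: dhomogM (xv_homog i) h.
Qed.

Lemma base3_hit k r : r \in base3 k -> len k r /\ hit (evs sys3 r).
Proof.
have kos m s : s \in take 10 supports -> (0 < m <= 3)%N ->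
    len m (kosq_rel m s) /\ hit (evs sys3 (kosq_rel m s)).
  move=> hs hm; split; first by rewrite /len /= !size_nseq !eqxx.
  have h i : (i < 4)%N -> evw sys3 (nseq m i, code (union [:: i] s)) ~=
      evl sys3 (nseq m i) (xv i * support_quad s).
    move=> hi; exact: (@evl_heq sys3 0 (nseq m i) _ _ (inn3_homog _) (quad_homog s i)
      (heqS (support_mul hi hs))).
  rewrite /kosq_rel evs_seq4; set h4 := (X in hit X).
  have h' := heqD (heqD (heqD (h 0%N isT) (h 1%N isT)) (h 2%N isT)) (h 3%N isT).
  apply: (heq_hit h'); move: {h h' h4} (support_quad s) => g.
  case: m hm => [|[|[|[|m]]]] // _.
  - exact: (koszul_cubic1 g).
  - exact: (koszul_cubic2 g).
  - exact: (koszul_cubic3 g).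
case: k => [|[|[|[|k]]]]; rewrite /base3.
- by [].
- by move=> /mapP[s hs ->]; apply: kos.
- by move=> /mapP[s hs ->]; apply: kos.
- rewrite mem_cat => /orP[/mapP[s hs ->]|]; first exact: kos.
  move=> /allpairsP[[[a b] v] [_ _ ->]]; split; first by [].
  rewrite evs_seq2; exact: (square_swap_cubic a b (inn3_homog v) isT).
- by [].
Qed.

Definition mnm4 (a b c d : nat) : 'X_{1..4} := [multinom nth 0%N [:: a; b; c; d] i | i < 4].

Lemma mcoeffXM i (q : P4) (m : 'X_{1..4}) :
  ('X_i * q)@_m = if (0 < m i)%N then q@_(m - U_(i))%MM else 0.
Proof.
case: ltnP => h.
  have {1}-> : m = (U_(i) + (m - U_(i)))%MM.
    apply/mnmP => j; rewrite mnmDE mnmBE mnm1E.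
    by case: eqP => [<-|_]; rewrite ?add0n ?subn0 // subnKC.
  by rewrite mulrC mcoeffMX.
rewrite (mpolyE q) mulr_sumr raddf_sum big1 // => k _ /=.
rewrite -scalerAr -mpolyXD mcoeffZ mcoeffX; case: eqP => [e|]; last by rewrite mulr0.
by move: h; rewrite -e mnmDE mnm1E eqxx.
Qed.

Lemma mnm4_sub (i a b c d : nat) : (i < 4)%N ->
  (mnm4 a b c d - U_(inord i))%MM = match i with
    | 0 => mnm4 a.-1 b c d | 1 => mnm4 a b.-1 c d | 2 => mnm4 a b c.-1 d | _ => mnm4 a b c d.-1 end.
Proof.
move=> hi; apply/mnmP => j; rewrite mnmBE mnm1E mnmE -val_eqE /= inordK //.
case: i hi => [|[|[|[|//]]]] _; rewrite mnmE;
  by case: j => [[|[|[|[|//]]]] hj]; rewrite /= ?subn0 ?subn1.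
Qed.

Lemma mcoeff_form M i (q : P4) a b c d :
  (act M (xv i) * q)@_(mnm4 a b c d) =
    (if a is a'.+1 then M (inord 0) (inord i) * q@_(mnm4 a' b c d) else 0)
  + (if b is b'.+1 then M (inord 1) (inord i) * q@_(mnm4 a b' c d) else 0)
  + (if c is c'.+1 then M (inord 2) (inord i) * q@_(mnm4 a b c' d) else 0)
  + (if d is d'.+1 then M (inord 3) (inord i) * q@_(mnm4 a b c d') else 0).
Proof.
rewrite /xv actX mulr_suml raddf_sum /= sumr_ord4.
have h k x : (M (inord k) (inord i) *: 'X_(inord k) * q)@_x =
    if (0 < x (inord k))%N then M (inord k) (inord i) * q@_(x - U_(inord k))%MM else 0.
  by rewrite -scalerAl mcoeffZ mcoeffXM; case: ifP => _; rewrite ?mulr0.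
have e k : (k < 4)%N -> mnm4 a b c d (inord k) = nth 0%N [:: a; b; c; d] k.
  by move=> hk; rewrite mnmE inordK.
rewrite (h 0%N) (h 1%N) (h 2) (h 3) (e 0%N isT) (e 1%N isT) (e 2 isT) (e 3 isT) {h e}.
rewrite (@mnm4_sub 0 _ _ _ _ isT) (@mnm4_sub 1 _ _ _ _ isT) (@mnm4_sub 2 _ _ _ _ isT) (@mnm4_sub 3 _ _ _ _ isT).
by case: a => [|a]; case: b => [|b]; case: c => [|c]; case: d => [|d].
Qed.

Lemma mcoeff1_mnm4 a b c d : (1 : P4)@_(mnm4 a b c d) = ((a == 0) && (b == 0) && (c == 0) && (d == 0))%N%:R.
Proof.
rewrite mcoeff1; congr (nat_of_bool _)%:R; apply/eqP/idP.
  move/mnmP => h; have := h (inord 0); have := h (inord 1); have := h (inord 2).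
  by have := h (inord 3); rewrite !mnmE !inordK //= => -> -> -> ->.
by move=> /andP[/andP[/andP[/eqP-> /eqP->] /eqP->] /eqP->]; apply/mnmP => -[[|[|[|[|//]]]] hj]; rewrite !mnmE.
Qed.

Definition sp2 n := mnm4 (ones n.+1) (ones n) 0 0.
Definition sp3 n := mnm4 (ones n.+2) (ones n) (ones n) 0.

Lemma spike_mnm4 a b c d : spike (mnm4 (ones a) (ones b) (ones c) (ones d)).
Proof. by move=> -[[|[|[|[|//]]]] hi]; rewrite mnmE /=; eexists. Qed.
Lemma spike2 n : spike (sp2 n). Proof. exact: (spike_mnm4 n.+1 n 0 0). Qed.
Lemma spike3 n : spike (sp3 n). Proof. exact: (spike_mnm4 n.+2 n n 0). Qed.

Lemma mnm4_dbl r0 r1 r2 r3 a b c d :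
  mnm4 (r0 + a.*2) (r1 + b.*2) (r2 + c.*2) (r3 + d.*2) = (mnm4 r0 r1 r2 r3 + mnm4 a b c d *+ 2)%MM.
Proof. by apply/mnmP => -[[|[|[|[|//]]]] hj]; rewrite mnmDE mnmDE !mnmE /= addnn. Qed.

Lemma mdeg_mnm4 a b c d : mdeg (mnm4 a b c d) = (a + b + c + d)%N.
Proof. by rewrite mdegE sum_ord4 !mnmE !inordK. Qed.

Lemma mnm4_le1 (r0 r1 r2 r3 : bool) i : (mnm4 r0 r1 r2 r3 i <= 1)%N.
Proof. by case: i => [[|[|[|[|//]]]] hi]; rewrite mnmE /= leq_b1. Qed.

Definition rows_of_mx (M : 'M[F2]_4) : seq (seq bool) :=
  [seq [seq M (inord i) (inord j) == 1 | j <- iota 0 4] | i <- iota 0 4].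

Lemma F2_bool (c : F2) : c = (c == 1)%:R.
Proof. by case: (F2_cases c) => ->. Qed.

Lemma bit_rows_of_mx (M : 'M[F2]_4) i j : (i < 4)%N -> (j < 4)%N ->
  M (inord i) (inord j) = (bit (rows_of_mx M) i j)%:R.
Proof.
move=> hi hj; rewrite /bit (nth_map 0%N) ?size_iota // (nth_map 0%N) ?size_iota //.
by rewrite !nth_iota //; apply: F2_bool.
Qed.

Lemma F2_add (a b : bool) : a%:R + b%:R = (a (+) b)%:R :> F2.
Proof. by apply/eqP; case: a; case: b. Qed.
Lemma F2_mul (a b : bool) : a%:R * b%:R = (a && b)%:R :> F2.
Proof. by apply/eqP; case: a; case: b. Qed.

Lemma act_let2 M i j : (i < 4)%N -> (j < 4)%N ->
  (act M (xv i * xv j))@_(mnm4 1 1 0 0) = (minor2 (rows_of_mx M) i j)%:R.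
Proof.
move=> hi hj; rewrite rmorphM /= -[act M (xv j)]mulr1 !mcoeff_form !mcoeff1_mnm4 /=.
rewrite !(mulr1, mulr0, addr0, add0r) !bit_rows_of_mx // !F2_mul F2_add /minor2.
by rewrite [X in _ (+) X]andbC.
Qed.

Lemma act_let3 M i j k : (i < 4)%N -> (j < 4)%N -> (k < 4)%N ->
  (act M (xv i * xv j * xv k))@_(mnm4 1 1 1 0) = (minor3 (rows_of_mx M) i j k)%:R.
Proof.
move=> hi hj hk; rewrite !rmorphM /= -[act M (xv k)]mulr1 -mulrA !mcoeff_form !mcoeff1_mnm4 /=.
rewrite !(mulr1, mulr0, addr0, add0r) !bit_rows_of_mx // !(F2_mul, F2_add) /minor3.
congr (nat_of_bool _)%:R.
by case: (bit _ 0 i); case: (bit _ 0 j); case: (bit _ 0 k); case: (bit _ 1 i);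
  case: (bit _ 1 j); case: (bit _ 1 k); case: (bit _ 2 i); case: (bit _ 2 j); case: (bit _ 2 k).
Qed.

Lemma phi_cons i c l v : phi i (c :: l, v) = lam i c && phi i (l, v).
Proof. by rewrite /phi /= andbA. Qed.

Lemma eval2 M w n : valid lets2 4 w -> size w.1 = n ->
  (act M (evw sys2 w))@_(sp2 n) = (phi (table2 (rows_of_mx M)) w)%:R.
Proof.
case: w => l v hw <- /=; elim: l hw => [|c l IH].
  rewrite /valid /= => hv; rewrite /evw /= -[act M _]mulr1 /sp2 /= mcoeff_form !mcoeff1_mnm4 /=.
  by rewrite mulr1 !addr0 bit_rows_of_mx // /phi /= /mu /=.
rewrite /valid /= -andbA => /andP[hc hl].
have hc4 : (c %/ 4 < 4)%N /\ (c < 16)%N.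
  by move: hc; rewrite !inE => /or4P[||| /or3P[||]] /eqP ->.
have -> : act M (evw sys2 (c :: l, v)) = act M (let2 c) * act M (evw sys2 (l, v)) ^+ 2.
  by rewrite -rmorphXn -rmorphM.
have -> : sp2 (size l).+1 = (mnm4 true true false false + sp2 (size l) *+ 2)%MM by rewrite -mnm4_dbl.
have ho : act M (let2 c) \is (1 + 1)%N.-homog.
  by apply/act_homog/dhomogM; apply: xv_homog.
rewrite (mcoeff_mul_sqr _ _ ho) ?mdeg_mnm4 //; last exact: mnm4_le1.
rewrite (IH hl) /let2 act_let2 ?ltn_mod ?hc4.1 // F2_mul phi_cons; congr (nat_of_bool (_ && _))%:R.
rewrite /lam /table2 (nth_map 0%N) ?size_iota ?hc4.2 //.
by rewrite nth_iota ?hc4.2.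
Qed.

Lemma act_cube M i j k : (i < 4)%N -> (j < 4)%N -> (k < 4)%N ->
  (act M (xv i * xv j * xv k))@_(mnm4 3 0 0 0) =
    [&& bit (rows_of_mx M) 0 i, bit (rows_of_mx M) 0 j & bit (rows_of_mx M) 0 k]%:R.
Proof.
move=> hi hj hk; rewrite !rmorphM /= -[act M (xv k)]mulr1 -mulrA !mcoeff_form !mcoeff1_mnm4 /=.
by rewrite !(mulr1, addr0) !bit_rows_of_mx // !F2_mul.
Qed.

Lemma eval3 M w n : valid lets3 14 w -> size w.1 = n ->
  (act M (evw sys3 w))@_(sp3 n) = (phi (table3 (rows_of_mx M)) w)%:R.
Proof.
case: w => l v hw <- /=; elim: l hw => [|c l IH].
  rewrite /valid /= => hv; rewrite -[LHS]/((act M (inn3 v))@_(mnm4 3 0 0 0)) /inn3.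
  have -> : phi (table3 (rows_of_mx M)) ([::], v) = all (bit (rows_of_mx M) 0) (nth [::] supports v).
    rewrite -[LHS]/(nth false [seq all (bit (rows_of_mx M) 0) s | s <- supports] v).
    by rewrite (nth_map [::]).
  have /allP/(_ v) h : all (fun v => all (fun a => a < 4)%N (nth [::] supports v) &&
     (0 < size (nth [::] supports v) < 4)%N) (iota 0 14) by [].
  have /h {h} : v \in iota 0 14 by rewrite mem_iota.
  case: (nth _ _ _) => [|a [|b [|d [|e s]]]] //=; rewrite ?andbT.
  - by move=> ha; rewrite exprS expr2 mulrA act_cube // !andbb.
  - by move=> /andP[ha hb]; rewrite expr2 mulrA act_cube // andbb.
  - by move=> /and3P[ha hb hd]; rewrite act_cube.
  - by rewrite andbF.
rewrite /valid /= -andbA => /andP[hc hl].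
have -> : act M (evw sys3 (c :: l, v)) = act M (qv c) * act M (evw sys3 (l, v)) ^+ 2.
  by rewrite -rmorphXn -rmorphM.
have -> : sp3 (size l).+1 = (mnm4 true true true false + sp3 (size l) *+ 2)%MM by rewrite -mnm4_dbl.
have ho := act_homog M (qv_homog c).
rewrite (mcoeff_mul_sqr _ _ ho) ?mdeg_mnm4 //; last exact: mnm4_le1.
rewrite (IH hl) phi_cons -[RHS]F2_mul; congr (_ * _).
by move: hc {IH hl ho}; rewrite !inE => /or4P[] /eqP ->; rewrite /qv act_let3.
Qed.

Section Span.
Variables (W : wordsys) (lets : seq nat) (V : nat).

Definition spanned s p := exists2 ws, len s ws && all (valid lets V) ws & p ~= evs W ws.

Lemma spanned_hit s p : hit p -> spanned s p.
Proof. by move=> h; exists [::] => //; rewrite evs_nil; apply: heq0. Qed.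

Lemma spannedD s p q : spanned s p -> spanned s q -> spanned s (p + q).
Proof.
move=> [u /andP[hu hu'] eu] [v /andP[hv hv'] ev]; exists (u ++ v).
  by rewrite /len !all_cat -/(len s u) -/(len s v) hu hu' hv hv'.
by rewrite evs_cat; apply: heqD.
Qed.

Lemma spanned_heq s p q : p ~= q -> spanned s q -> spanned s p.
Proof. by move=> h [ws hw e]; exists ws => //; apply: heqT h e. Qed.

Lemma spannedZ s c p : spanned s p -> spanned s (c *: p).
Proof.
by case: (F2_cases c) => ->; rewrite ?scale0r ?scale1r // => _; apply/spanned_hit/hit0.
Qed.

Lemma spanned_sum s I (r : seq I) (P : pred I) (F : I -> P4) :
  (forall i, P i -> spanned s (F i)) -> spanned s (\sum_(i <- r | P i) F i).
Proof. by move=> h; elim/big_ind: _ => //; [apply/spanned_hit/hit0 | exact: spannedD]. Qed.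

Lemma spanned_word s w : size w.1 = s -> valid lets V w -> spanned s (evw W w).
Proof.
move=> hs hw; exists [:: w]; first by rewrite /= hs hw eqxx.
by rewrite evs_cons evs_nil addr0; apply: heq_refl.
Qed.

Lemma spanned_cons s c p : c \in lets -> p \is (wdeg W s).-homog -> spanned s p ->
  spanned s.+1 (wlet W c * p ^+ 2).
Proof.
move=> hc hp [ws /andP[hl hv] e]; exists (consw c ws).
  rewrite len_consw //= /consw all_map; apply/allP => w /(allP hv).
  by rewrite /= /valid /= hc.
rewrite evs_consw /heq -mulrDr -sqrDp.
by apply: wlift e; apply: rpredD hp _; apply: evs_homog.
Qed.
End Span.

Definition spanned2 := spanned sys2 lets2 4.
Definition spanned3 := spanned sys3 lets3 14.

Lemma spanned2_cons s i j p : (i < j)%N -> (j < 4)%N -> spanned2 s p -> p \is (deg2 s).-homog ->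
  spanned2 s.+1 (xv i * xv j * p ^+ 2).
Proof.
move=> hij hj h hp; have hi : (i < 4)%N by apply: ltn_trans hj.
rewrite -(let2_pair_code hi hj); apply: (@spanned_cons sys2) => //.
by move: i j hij hj {hi} => [|[|[|[|i]]]] [|[|[|[|j]]]].
Qed.

Lemma spanned2_pair s i j k l (m : 'X_{1..4}) :
  (i < j)%N -> (j < 4)%N -> (k < 4)%N -> (l < 4)%N -> uniq [:: i; j; k; l] ->
  xv 0 * xv 1 * xv 2 * xv 3 = xv i * xv j * xv k * xv l ->
  (forall m', mdeg m' = deg2 s -> parm m' != one4 -> spanned2 s 'X_[m']) ->
  mdeg m = deg2 s -> spanned2 s.+1 (xv i * xv j * 'X_[m] ^+ 2).
Proof.
move=> hij hj hk hl un e4 IH hm; have hi : (i < 4)%N by apply: ltn_trans hj.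
have ho n : mdeg n = deg2 s -> 'X_[n] \is [in F2[4], (deg2 s).-homog].
  by move=> <-; rewrite dhomogX.
case: (boolP (parm m == one4)) => [ho4|ne]; last first.
  by apply: spanned2_cons => //; [apply: IH | apply: ho].
have Em : 'X_[m] = xv i * xv j * xv k * xv l * 'X_[halfm m] ^+ 2.
  rewrite mpolyX_half -e4; move/eqP/mnmP: ho4 => h4.
  have o a : odd (m (inord a)) = true by have := h4 (inord a); rewrite !mnmE; case: odd.
  by rewrite !o !expr1.
rewrite Em; apply: spanned_heq (all_odd_conv 'X_[halfm m] (lin_xv i) (lin_xv j) (lin_xv k) (lin_xv l)) _.
have dh : mdeg m = (4 + (mdeg (halfm m)).*2)%N.
  by rewrite {1}(mnm_half m) (eqP ho4) mdeg_dbl mdeg_one4.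
have aux a b c : (a < 4)%N -> (b < 4)%N -> (c < 4)%N -> b != a -> b != c ->
    spanned2 s (xv a * xv c * (xv b * 'X_[halfm m]) ^+ 2) /\
    xv a * xv c * (xv b * 'X_[halfm m]) ^+ 2 \is (deg2 s).-homog.
  move=> ha hb hc nea nec.
  pose m1 := (U_(inord a) + U_(inord c) + (U_(inord b) + halfm m) *+ 2)%MM : 'X_{1..4}.
  have -> : xv a * xv c * (xv b * 'X_[halfm m]) ^+ 2 = 'X_[m1].
    rewrite /m1 /xv (mpolyXD _ (U_(inord a) + U_(inord c))%MM) (mpolyXD _ U_(inord a)%MM).
    by rewrite -mpolyXn mpolyXD.
  have d1 : mdeg m1 = deg2 s.
    by rewrite /m1 mdeg_dbl !mdegD !mdeg1 -hm dh; lia.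
  split; last exact: ho.
  apply: IH => //; rewrite parm_one4; apply/forallPn; exists (inord b).
  rewrite /m1 !mnmDE !mnm1E -!val_eqE /= !inordK // eq_sym (negPf nea) eq_sym (negPf nec).
  by rewrite !add0n addnn odd_double.
have mv x y F : spanned2 s F -> F \is (deg2 s).-homog -> (x < 4)%N -> (y < 4)%N -> x != y ->
    spanned2 s.+1 (xv x * xv y * F ^+ 2).
  move=> h1 h2 hx hy; rewrite neq_ltn => /orP[h|h]; first exact: spanned2_cons.
  by rewrite (mulrC (xv x)); apply: spanned2_cons.
move: un; rewrite /= !inE !negb_or => /and4P[/and3P[n1 n2 n3] /andP[n4 n5] n6 _].
have [a1 a2] : spanned2 s (xv i * xv l * (xv j * 'X_[halfm m]) ^+ 2) /\
    xv i * xv l * (xv j * 'X_[halfm m]) ^+ 2 \is (deg2 s).-homog.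
  by apply: aux => //; rewrite eq_sym.
have [b1 b2] := aux j i l hj hi hl n1 n3.
apply: spannedD; first exact: mv a1 a2 hi hk n2.
exact: mv b1 b2 hj hk n4.
Qed.

Lemma X_spanned2 s m : mdeg m = deg2 s -> parm m != one4 -> spanned2 s 'X_[m].
Proof.
elim: s m => [|s IH] m hm hp.
  have /mdeg1P[i /eqP ->] : mdeg m == 1%N by rewrite hm.
  have -> : 'X_i = evw sys2 ([::], val i) by rewrite /evw /= /xv inord_val.
  by apply: spanned_word => //; rewrite /valid /= ltn_ord.
have hd := mdeg_half m; rewrite hm in hd; rewrite mpolyX_half.
have h0 : parm m != one4 -> ~~ [&& odd (m (inord 0)), odd (m (inord 1)),
    odd (m (inord 2)) & odd (m (inord 3))].
  apply: contra => /and4P[o0 o1 o2 o3]; rewrite parm_one4; apply/forallP => i.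
  rewrite -[i]inord_val; case: i => [[|[|[|[|//]]]] hi] //=.
move: (h0 hp) hd; have P2 i j k l := @spanned2_pair s i j k l (halfm m).
have sq : (0 < mdeg (halfm m))%N -> hit ('X_[halfm m] ^+ 2) := @hit_sqrX _.
case: (odd _) => /=; case: (odd _) => /=; case: (odd _) => /=; case: (odd _) => //= _;
  rewrite ?expr0 ?expr1 ?mul1r ?mulr1 => hd; try by lia.
- by apply: (P2 0 1 2 3)%N => //; lia.
- by apply: (P2 0 2 1 3)%N => //; [ring | lia].
- by apply: (P2 0 3 1 2)%N => //; [ring | lia].
- by apply: (P2 1 2 0 3)%N => //; [ring | lia].
- by apply: (P2 1 3 0 2)%N => //; [ring | lia].
- by apply: (P2 2 3 0 1)%N => //; [ring | lia].
by apply/spanned_hit/sq; lia.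
Qed.

Lemma spanned2_ker s p : p \is (deg2 s).-homog -> kameko p = 0 -> spanned2 s p.
Proof.
move=> hp k0; rewrite (mpolyE p) big_seq; apply: spanned_sum => m hm.
apply: spannedZ; apply: X_spanned2; first exact: (dhomog_mf hp hm).
apply: contraL hm => /eqP h; rewrite mcoeff_msupp negbK.
by rewrite (mnm_half m) h -mcoeff_kameko k0 mcoeff0.
Qed.

Definition prod_xv : P4 := xv 0 * xv 1 * xv 2 * xv 3.

Lemma prod_xv_homog : prod_xv \is 4.-homog.
Proof.
exact: dhomogM (dhomogM (dhomogM (xv_homog 0) (xv_homog 1)) (xv_homog 2)) (xv_homog 3).
Qed.

Lemma kameko_prod_xv F : kameko (prod_xv * F ^+ 2) = F.
Proof.
rewrite (kameko_mul_sqr _ prod_xv_homog) // (_ : prod_xv = 'X_[one4]).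
  by rewrite mcoeffX eqxx scale1r.
by rewrite mpolyXE_id prod_ord4 !mnmE !expr1.
Qed.

Lemma kameko_small d p F : p \is d.-homog -> (d < 4)%N -> kameko (p * F ^+ 2) = 0.
Proof.
move=> hp hd; rewrite (kameko_mul_sqr _ hp (ltnW hd)).
rewrite (dhomog_nemf_coeff hp) ?scale0r //= [X in X != _]mdeg_one4.
by rewrite neq_ltn hd orbT.
Qed.

Lemma spanned2_prod_xv s f : deg2 s = (f.2 * 2 + 4)%N -> ghit f.2 f.1 ->
  spanned2 s (prod_xv * f.1 ^+ 2).
Proof.
case: f => f d /= hs; elim=> [|[//|k] m p _ dm _ IH].
  by rewrite expr0n mulr0; apply/spanned_hit/hit0.
rewrite sqrDp mulrDr; apply: spannedD IH.
apply: (spanned_heq (lift4 k 'X_[m] (lin_xv 0) (lin_xv 1) (lin_xv 2) (lin_xv 3))).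
have hh a b i j : spanned2 s (xv a * xv b * (xv i * xv j * Sq k 'X_[m]) ^+ 2).
  have h2 x y : xv x * xv y \is (1 + 1)%N.-homog by apply: dhomogM; apply: xv_homog.
  apply: spanned2_ker; last exact: kameko_small (h2 a b) _.
  have -> : deg2 s = (1 + 1 + (1 + 1 + (mdeg m + k)) * 2)%N by rewrite hs -dm; lia.
  apply: dhomogM (h2 a b) (dhomogMn 2 _); apply: dhomogM (h2 i j) _.
  by apply: Sq_homog; rewrite dhomogX.
by do !apply: spannedD; apply: hh.
Qed.

Lemma spanned2_kameko s d p : deg2 s = (d * 2 + 4)%N -> p \is (deg2 s).-homog ->
  hit (kameko p) -> spanned2 s p.
Proof.
move=> hs hp hk.
have hkd : kameko p \is d.-homog by apply: homog_kameko; rewrite -muln2 -hs.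
have hg := hit_ghit hkd hk.
have hx : prod_xv * kameko p ^+ 2 \is (deg2 s).-homog.
  by rewrite hs addnC; apply: dhomogM prod_xv_homog (dhomogMn 2 hkd).
have -> : p = (p + prod_xv * kameko p ^+ 2) + prod_xv * kameko p ^+ 2.
  by rewrite -addrA addpp addr0.
apply: spannedD; last exact: (@spanned2_prod_xv s (kameko p, d) hs hg).
apply: spanned2_ker; first exact: rpredD.
by rewrite kamekoD kameko_prod_xv addpp.
Qed.

Lemma code_union_lt i s : (i < 4)%N -> s \in take 10 supports -> (code (union [:: i] s) < 14)%N.
Proof.
have /allP h : all (fun i => all (fun s => code (union [:: i] s) < 14)%N (take 10 supports)) (iota 0 4).
  by [].
by move=> hi; apply/allP: s; apply: h; rewrite mem_iota.
Qed.

Lemma spanned3_quad i s : (i < 4)%N -> s \in take 10 supports -> spanned3 0 (xv i * support_quad s).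
Proof.
move=> hi hs; apply: (spanned_heq (support_mul hi hs)).
exact: (@spanned_word sys3 lets3 14 0 ([::], code (union [:: i] s)) erefl (code_union_lt hi hs)).
Qed.

Lemma X_spanned3 j m : mdeg m = deg3 j -> spanned3 j 'X_[m].
Proof.
elim: j m => [|j IH] m hm; have hd := mdeg_half m; rewrite hm in hd.
  move: hd; rewrite mpolyX_half.
  have h1 : (mdeg (halfm m)).*2.+1 = 3%N -> exists2 k, (k < 4)%N & 'X_[halfm m] = xv k.
    move=> h; have /mdeg1P[i /eqP ->] : mdeg (halfm m) == 1%N by apply/eqP; lia.
    by exists (val i); rewrite ?ltn_ord // /xv inord_val.
  have h3 : (mdeg (halfm m)).*2.+3 = 3%N -> 'X_[halfm m] = 1 :> P4.
    move=> h; have /eqP -> : halfm m == 0%MM by rewrite -mdeg_eq0; apply/eqP; lia.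
    exact: mpolyX0.
  have q1 i : (i < 4)%N -> (mdeg (halfm m)).*2.+1 = 3%N -> spanned3 0 (xv i * 'X_[halfm m] ^+ 2).
    move=> hi /h1[k hk ->]; apply: (@spanned3_quad i [:: k] hi).
    by move: k hk => [|[|[|[|//]]]].
  case: (odd _) => /=; case: (odd _) => /=; case: (odd _) => /=; case: (odd _) => /=;
    rewrite ?expr0 ?expr1 ?mul1r ?mulr1 => hd; try by lia.
  - by rewrite h3 // expr1n mulr1 -mulrA; apply: (@spanned3_quad 0 [:: 1; 2]%N).
  - by rewrite h3 // expr1n mulr1 -mulrA; apply: (@spanned3_quad 0 [:: 1; 3]%N).
  - by rewrite h3 // expr1n mulr1 -mulrA; apply: (@spanned3_quad 0 [:: 2; 3]%N).
  - by apply: q1.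
  - by rewrite h3 // expr1n mulr1 -mulrA; apply: (@spanned3_quad 1 [:: 2; 3]%N).
  - by apply: q1.
  - by apply: q1.
  - by apply: q1.
rewrite mpolyX_half.
have q1 i : (i < 4)%N -> (deg3 j).*2 + 3 = (mdeg (halfm m)).*2.+1 -> spanned3 j.+1 (xv i * 'X_[halfm m] ^+ 2).
  move=> hi h; apply: spanned_hit; have ho := odd_deg3 j.
  by apply: single_odd_X => //; lia.
have q3 a : (a < 4)%N -> (deg3 j).*2 + 3 = (mdeg (halfm m)).*2.+3 -> spanned3 j.+1 (qv a * 'X_[halfm m] ^+ 2).
  move=> ha h; have hh : mdeg (halfm m) = deg3 j by lia.
  apply: (@spanned_cons sys3); first by rewrite mem_iota.
    by rewrite dhomogX; apply/eqP.
  exact: IH.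
move: hd; rewrite [deg3 _]/=.
case: (odd _) => /=; case: (odd _) => /=; case: (odd _) => /=; case: (odd _) => /=;
  rewrite ?expr0 ?expr1 ?mul1r ?mulr1 => hd; try by lia.
- exact: (q3 3).
- exact: (q3 2).
- exact: (q3 1%N).
- exact: q1.
- exact: (q3 0%N).
- exact: q1.
- exact: q1.
- exact: q1.
Qed.

Lemma spanned3_homog j p : p \is (deg3 j).-homog -> spanned3 j p.
Proof.
move=> hp; rewrite (mpolyE p) big_seq; apply: spanned_sum => m hm.
by apply/spannedZ/X_spanned3; apply: (dhomog_mf hp hm).
Qed.

Section Represent.
Variables (W : wordsys) (lets : seq nat) (V n : nat) (H : P4 -> Prop).
Hypotheses (H0 : forall p, hit p -> H p) (HD : forall p q, H p -> H q -> H (p + q)).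
Variables (idx : seq (seq bool * seq bool)) (func : seq bool * seq bool -> P4 -> F2).
Hypotheses (funcD : forall i p q, func i (p + q) = func i p + func i q)
  (func_hit : forall i p, hit p -> func i p = 0)
  (func_word : forall i w, i \in idx -> valid lets V w -> size w.1 = n ->
     func i (evw W w) = (phi i w)%:R).

Lemma represents_spanned DW p : all (fun e => e.1 \in idx) DW -> represents W lets V H n DW ->
  spanned W lets V n p -> H (p + \sum_(e <- DW) func e.1 p *: evs W e.2).
Proof.
move=> /allP hE hr [ws /andP[/allP hl /allP hv] hp].
have fe i : func i p = func i (evs W ws).
  have := func_hit i hp; rewrite funcD => /eqP; rewrite addr_eq0 => /eqP ->.
  by case: (F2_cases (func i (evs W ws))) => ->; rewrite ?oppr0 //; apply/eqP.
have -> : p + \sum_(e <- DW) func e.1 p *: evs W e.2 =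
    (p + evs W ws) + (evs W ws + \sum_(e <- DW) func e.1 (evs W ws) *: evs W e.2).
  rewrite -addrA (addrA (evs W ws)) addpp add0r; congr (_ + _).
  by apply: eq_bigr => e _; rewrite fe.
apply: HD (H0 hp) _; elim: ws hl hv {hp fe} => [|w ws IH] hl hv.
  rewrite evs_nil add0r big1 => [|e _]; first by apply/H0/hit0.
  by rewrite (func_hit _ hit0) scale0r.
have {}IH : H (evs W ws + \sum_(e <- DW) func e.1 (evs W ws) *: evs W e.2).
  by apply: IH => x hx; [apply: hl | apply: hv]; rewrite in_cons hx orbT.
have hs : size w.1 = n by apply/eqP/hl/mem_head.
have hvw := hv _ (mem_head _ _).
have := HD (hr _ hs hvw) IH; rewrite addrACA -evs_cons; congr (H (_ + _)).
rewrite big_mkcond -big_split !(big_seq_cond xpredT) /=; apply: eq_bigr => e /andP[he _].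
rewrite evs_cons funcD (func_word (hE _ he)) // scalerDl; congr (_ + _).
by case: ifP => _; rewrite ?scale1r ?scale0r.
Qed.
End Represent.

Definition mx_of_rows (r : seq (seq bool)) : 'M[F2]_4 := \matrix_(i, j) (bit r i j)%:R.

Lemma F2_eq1 (b : bool) : (b%:R == 1 :> F2) = b.
Proof. by case: b. Qed.

Lemma mx_of_rowsK r i j : (i < 4)%N -> (j < 4)%N -> bit (rows_of_mx (mx_of_rows r)) i j = bit r i j.
Proof.
move=> hi hj; have := bit_rows_of_mx (mx_of_rows r) hi hj; rewrite mxE !inordK // => e.
by rewrite -(F2_eq1 (bit r i j)) e F2_eq1.
Qed.

Lemma table2_rows r : table2 (rows_of_mx (mx_of_rows r)) = table2 r.
Proof.
congr pair; apply/eq_in_map => c; rewrite mem_iota => /andP[_ hc]; rewrite ?mx_of_rowsK //.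
have h : (c %/ 4 < 4)%N by rewrite ltn_divLR.
by rewrite /minor2 !mx_of_rowsK ?ltn_mod.
Qed.

Lemma table3_rows r : table3 (rows_of_mx (mx_of_rows r)) = table3 r.
Proof.
have h i j k : (i < 4)%N -> (j < 4)%N -> (k < 4)%N -> minor3 (rows_of_mx (mx_of_rows r)) i j k = minor3 r i j k.
  by move=> hi hj hk; rewrite /minor3 !mx_of_rowsK.
rewrite /table3 !h //; congr pair; apply/eq_in_map => s hs; apply: eq_in_all => a ha.
have /allP h4 : all (all (fun a => a < 4)%N) supports by [].
by rewrite mx_of_rowsK //; apply: (allP (h4 _ hs)).
Qed.

Section Stable.
Variables (W : wordsys) (lets : seq nat) (V : nat) (idx : seq (seq bool * seq bool)).
Variable DW : seq ((seq bool * seq bool) * seq word).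

Definition stable k := iter k (extend lets) DW.
Hypotheses (fstE : map fst DW = idx) (lenE : all (fun e => len 3 e.2) DW)
  (repE : represents W lets V hit 3 DW) (absE : absorbs W lets DW).

Lemma stable_fst k : map fst (stable k) = idx.
Proof. by elim: k => //= k <-; rewrite /extend -map_comp; apply: eq_map. Qed.

Lemma stable_len k e : e \in stable k -> len (3 + k)%N e.2.
Proof.
elim: k e => [|k IH] e; first exact: (allP lenE).
by rewrite addnS; apply: len_extend.
Qed.

Lemma stable_absorbs k : absorbs W lets (stable k).
Proof. by elim: k => //= k IH; apply: absorbs_extend IH; apply: stable_len. Qed.

Lemma stable_represents k : represents W lets V hit (3 + k)%N (stable k).
Proof.
elim: k => //= k IH; rewrite addnS.
apply: represents_extend IH; [exact: stable_len | exact: stable_absorbs].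
Qed.

Definition dual (L : seq ((seq bool * seq bool) * seq word)) :=
  all (fun e => all (fun i => odd (count (phi i) e.2) == (i == e.1)) idx) L.

Hypotheses (leadE : all (fun i => lam i (lead lets i)) idx) (dualE : dual DW).

Lemma stable_dual k : dual (stable k).
Proof.
elim: k => //= k IH; rewrite /dual /extend all_map.
apply/allP => e he; apply/allP => i hi /=.
have hidx : e.1 \in idx by rewrite -(stable_fst k); apply: map_f.
rewrite count_map (eq_count (a2 := fun w => lam i (lead lets e.1) && phi i w)); last first.
  by case=> l v; rewrite /= phi_cons.
have := allP (allP IH _ he) _ hi.
case: (eqVneq i e.1) => [->|ne]; first by rewrite (allP leadE).
by case: (lam i _) => //=; rewrite count_pred0.
Qed.
End Stable.

Lemma rels2_hit n : allH sys2 hit (rels2 n).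
Proof. exact/rels_of_hit/base2_hit. Qed.
Lemma rels3_hit n : allH sys3 hit (rels3 n).
Proof. exact/rels_of_hit/base3_hit. Qed.

Lemma represents2_2 : represents sys2 lets2 4 hit 2 dual_words2_at2.
Proof.
apply: (rep_checkP (fun p h => h) hitD (@rels2_hit 2)).
by vm_compute.
Qed.
Lemma represents2_3 : represents sys2 lets2 4 hit 3 dual_words2_at3.
Proof.
apply: (rep_checkP (fun p h => h) hitD (@rels2_hit 3)).
by vm_compute.
Qed.
Lemma absorbs2_3 : absorbs sys2 lets2 dual_words2_at3.
Proof. by apply: (absorb_checkP (@rels2_hit 4)); vm_compute. Qed.
Lemma represents3_0 : represents sys3 lets3 14 hit 0 dual_words3_at0.
Proof.
apply: (rep_checkP (fun p h => h) hitD (@rels3_hit 0)).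
by vm_compute.
Qed.
Lemma represents3_3 : represents sys3 lets3 14 hit 3 dual_words3_at3.
Proof.
apply: (rep_checkP (fun p h => h) hitD (@rels3_hit 3)).
by vm_compute.
Qed.
Lemma absorbs3_3 : absorbs sys3 lets3 dual_words3_at3.
Proof. by apply: (absorb_checkP (@rels3_hit 4)); vm_compute. Qed.

Definition f0 : P4 := evs sys3 f0w.

Definition hit_mod_f0 (p : P4) := exists c : F2, hit (p + c *: f0).
Lemma represents3_1 : represents sys3 lets3 14 hit_mod_f0 1 dual_words3_at1.
Proof.
apply: (@rep_checkP sys3 lets3 14 hit_mod_f0 (f0w :: rels3 1)).
- by move=> p h; exists 0; rewrite scale0r addr0.
- by move=> p q [c hc] [d hd]; exists (c + d); rewrite scalerDl addrACA; apply: hitD.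
- apply/allH_cons; split; first by exists 1; rewrite scale1r addpp; apply: hit0.
  by move=> r /rels3_hit h; exists 0; rewrite scale0r addr0.
by vm_compute.
Qed.

Definition lincomb_f0 (c : nat -> F2) : P4 := \sum_(0 <= i < 4) c i *: (qv i * f0 ^+ 2).
Definition hit_mod_lincomb (p : P4) := exists c : nat -> F2, hit (p + lincomb_f0 c).

Lemma hit_mod_lincomb_hit p : hit p -> hit_mod_lincomb p.
Proof.
move=> h; exists (fun=> 0); rewrite /lincomb_f0 big1 ?addr0 // => i _.
by rewrite scale0r.
Qed.

Lemma represents3_2 : represents sys3 lets3 14 hit_mod_lincomb 2 dual_words3_at2.
Proof.
apply: (@rep_checkP sys3 lets3 14 hit_mod_lincomb ([seq normalize (consw i f0w) | i <- iota 0 4] ++ rels3 2)).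
- exact: hit_mod_lincomb_hit.
- move=> p q [c hc] [d hd]; exists (fun i => c i + d i).
  rewrite /lincomb_f0 (eq_bigr (fun i => c i *: (qv i * f0 ^+ 2) + d i *: (qv i * f0 ^+ 2))).
    by rewrite big_split addrACA; apply: hitD.
  by move=> i _; rewrite scalerDl.
- move=> r; rewrite mem_cat => /orP[/mapP[i hi ->]|/rels3_hit]; last exact: hit_mod_lincomb_hit.
  exists (fun k => (k == i)%:R); rewrite /lincomb_f0.
  have -> : \sum_(0 <= k < 4) (k == i)%:R *: (qv k * f0 ^+ 2) = qv i * f0 ^+ 2.
    rewrite (bigD1_seq i) ?iota_uniq //= eqxx scale1r big1 ?addr0 // => k ne.
    by rewrite (negPf ne) scale0r.
  by have := normalize_heq sys3 (consw i f0w); rewrite /heq evs_consw.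
by vm_compute.
Qed.

Lemma lead2E : all (fun i => lam i (lead lets2 i)) idx2. Proof. by vm_compute. Qed.
Lemma lead3E : all (fun i => lam i (lead lets3 i)) idx3. Proof. by vm_compute. Qed.
Lemma dual2E : dual idx2 dual_words2_at3. Proof. by vm_compute. Qed.
Lemma dual3E : dual idx3 dual_words3_at3. Proof. by vm_compute. Qed.

(** * Functionals and invariant classes *)

Definition ginv p := forall g, g \in unitmx -> act g p ~= p.

Definition proj4 (k : nat) : 'M[F2]_4 := \matrix_(i, j) ((i == j) && (i < k)%N)%:R.

Lemma act_proj k p (m : 'X_{1..4}) :
  (act (proj4 k) p)@_m = if [forall i : 'I_4, (k <= i)%N ==> (m i == 0)%N] then p@_m else 0.
Proof.
have hX i : act (proj4 k) 'X_i = (i < k)%N%:R *: 'X_i.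
  rewrite actX (bigD1 i) //= mxE eqxx big1 ?addr0 // => j ne.
  by rewrite mxE (negPf ne) scale0r.
rewrite (mpolyE p) act_sum !raddf_sum /=.
have hm n : (act (proj4 k) 'X_[n])@_m =
    ([forall i : 'I_4, (k <= i)%N ==> (m i == 0)%N] && (n == m))%:R.
  rewrite mpolyXE_id rmorph_prod /=.
  have -> : \prod_(i < 4) act (proj4 k) ('X_i ^+ n i) =
      (\prod_(i < 4) (i < k)%N%:R ^+ n i) *: 'X_[n] :> P4.
    rewrite mpolyXE_id -scaler_prod; apply: eq_bigr => i _.
    by rewrite rmorphXn /= hX exprZn.
  rewrite mcoeffZ mcoeffX; case: eqP => [->|_]; last by rewrite mulr0 andbF.
  rewrite mulr1 andbT; case: forallP => [h|/forallP/forallPn[i]].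
    rewrite big1 // => i _; have := h i; case: ltnP => /=; rewrite ?expr1n //.
    by move=> _ /eqP ->.
  rewrite negb_imply => /andP[hi h0]; rewrite (bigD1 i) //= ltnNge hi.
  by rewrite expr0n (negPf h0) mul0r.
case: ifP => hf; last first.
  by rewrite big1 // => n _; rewrite actZ mcoeffZ hm hf mulr0.
by apply: eq_bigr => n _; rewrite actZ !mcoeffZ hm hf mcoeffX.
Qed.

Definition dot r i (x : seq bool) :=
  (bit r i 0 && nth false x 0) (+) (bit r i 1 && nth false x 1) (+)
  (bit r i 2 && nth false x 2) (+) (bit r i 3 && nth false x 3).
Definition dual_vector k r j : seq bool := if (j < k)%N then
  head [::] [seq x <- bits4 | all (fun i => dot r i x == (i == j)) (iota 0 4)] else [::].
Definition indep k (r : seq (seq bool)) := (size r <= k)%N &&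
  all (fun i => all (fun j => dot r i (dual_vector k r j) == ((i == j) && (i < k)%N)) (iota 0 4)) (iota 0 4).

Lemma mx_of_rows_trunc k r : (size r <= k)%N -> proj4 k *m mx_of_rows r = mx_of_rows r.
Proof.
move=> hr; apply/matrixP => i j; rewrite !mxE (bigD1 i) //= big1 => [|l ne].
  rewrite !mxE eqxx addr0 /=; case: ltnP => h; first by rewrite mul1r.
  by rewrite mul0r /bit (nth_default _ (leq_trans hr h)) nth_nil.
by rewrite mxE eq_sym (negPf ne) mul0r.
Qed.

Lemma mx_of_rows_unit k r : indep k r -> {g : 'M[F2]_4 | g \in unitmx & mx_of_rows r = proj4 k *m g}.
Proof.
case/andP=> hr /allP hs; pose B : 'M[F2]_4 := \matrix_(i, j) (nth false (dual_vector k r j) i)%:R.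
have eB : mx_of_rows r *m B = proj4 k.
  apply/matrixP => i j; rewrite !mxE sumr_ord4 !mxE !inordK // !F2_mul !F2_add.
  have hi : (i : nat) \in iota 0 4 by rewrite mem_iota ltn_ord.
  have hj : (j : nat) \in iota 0 4 by rewrite mem_iota ltn_ord.
  by rewrite -/(dot r i _) (eqP (allP (hs _ hi) _ hj)).
have e : \rank (proj4 k *m mx_of_rows r) = \rank (proj4 k).
  apply/eqP; rewrite eqn_leq mxrankM_maxl /= mx_of_rows_trunc // -{1}eB.
  exact: mxrankM_maxl.
by have [g ug eg] := complete_unitmx e; exists g => //; rewrite -eg mx_of_rows_trunc.
Qed.

Lemma ginv_mcoeff k r p m : indep k r -> ginv p -> spike m ->
  (forall i : 'I_4, (k <= i)%N -> m i = 0%N) -> (act (mx_of_rows r) p)@_m = p@_m.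
Proof.
move=> /mx_of_rows_unit[g ug ->] hp hm h0; rewrite -act_comp act_proj.
have -> : [forall i : 'I_4, (k <= i)%N ==> (m i == 0)%N].
  by apply/forallP => i; apply/implyP => /h0 ->.
have := mcoeff_hit_spike hm (hp g ug); rewrite mcoeffD => /eqP.
by rewrite addr_eq0 => /eqP ->; case: (F2_cases p@_m) => ->; apply/eqP.
Qed.

Lemma sp2_tail n (i : 'I_4) : (2 <= i)%N -> sp2 n i = 0%N.
Proof. by rewrite mnmE; case: i => [[|[|[|[|//]]]] hi]. Qed.
Lemma sp3_tail n (i : 'I_4) : (3 <= i)%N -> sp3 n i = 0%N.
Proof. by rewrite mnmE; case: i => [[|[|[|[|//]]]] hi]. Qed.

Definition func2 n r p := (act (mx_of_rows r) p)@_(sp2 n).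
Definition func3 n r p := (act (mx_of_rows r) p)@_(sp3 n).

Lemma func2D n r p q : func2 n r (p + q) = func2 n r p + func2 n r q.
Proof. by rewrite /func2 raddfD mcoeffD. Qed.
Lemma func3D n r p q : func3 n r (p + q) = func3 n r p + func3 n r q.
Proof. by rewrite /func3 raddfD mcoeffD. Qed.
Lemma func2_hit n r p : hit p -> func2 n r p = 0.
Proof. by move=> h; apply: mcoeff_hit_spike; [apply: spike2 | apply: act_hit]. Qed.
Lemma func3_hit n r p : hit p -> func3 n r p = 0.
Proof. by move=> h; apply: mcoeff_hit_spike; [apply: spike3 | apply: act_hit]. Qed.
Lemma func2_word n r w : valid lets2 4 w -> size w.1 = n ->
  func2 n r (evw sys2 w) = (phi (table2 r) w)%:R.
Proof. by move=> h1 h2; rewrite /func2 eval2 // table2_rows. Qed.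
Lemma func3_word n r w : valid lets3 14 w -> size w.1 = n ->
  func3 n r (evw sys3 w) = (phi (table3 r) w)%:R.
Proof. by move=> h1 h2; rewrite /func3 eval3 // table3_rows. Qed.

Definition row2 i := nth [::] rows2 (index i idx2).
Definition row3 i := nth [::] rows3 (index i idx3).
Lemma row2K i : i \in idx2 -> table2 (row2 i) = i.
Proof.
have e : idx2 = map table2 rows2 by vm_compute.
move=> hi; have h : (index i idx2 < size rows2)%N by rewrite -(size_map table2) -e index_mem.
by rewrite /row2 -(nth_map _ (table2 [::])) // -e nth_index.
Qed.
Lemma row3K i : i \in idx3 -> table3 (row3 i) = i.
Proof.
have e : idx3 = map table3 rows3 by vm_compute.
move=> hi; have h : (index i idx3 < size rows3)%N by rewrite -(size_map table3) -e index_mem.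
by rewrite /row3 -(nth_map _ (table3 [::])) // -e nth_index.
Qed.

Definition dual_words2 n := if n is n'.+3 then stable lets2 dual_words2_at3 n' else dual_words2_at2.
Definition dual_words3 n := match n with
  | 0 => dual_words3_at0 | 1 => dual_words3_at1 | 2 => dual_words3_at2 | n'.+3 => stable lets3 dual_words3_at3 n' end.

Lemma fst2 : map fst dual_words2_at3 = idx2. Proof. by vm_compute. Qed.
Lemma fst3 : map fst dual_words3_at3 = idx3. Proof. by vm_compute. Qed.
Lemma len2 : all (fun e => len 3 e.2) dual_words2_at3. Proof. by vm_compute. Qed.
Lemma len3 : all (fun e => len 3 e.2) dual_words3_at3. Proof. by vm_compute. Qed.

Lemma fst_dual_words2 n : map fst (dual_words2 n) = idx2.
Proof.
by case: n => [|[|[|n]]]; [vm_compute | vm_compute | vm_compute | exact: (stable_fst lets2 fst2)].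
Qed.
Lemma fst_dual_words3 n : map fst (dual_words3 n) = idx3.
Proof.
by case: n => [|[|[|n]]]; [vm_compute | vm_compute | vm_compute | exact: (stable_fst lets3 fst3)].
Qed.

Lemma dual_words2_idx n : all (fun e => e.1 \in idx2) (dual_words2 n).
Proof. by apply/allP => e he; rewrite -(fst_dual_words2 n) map_f. Qed.
Lemma dual_words3_idx n : all (fun e => e.1 \in idx3) (dual_words3 n).
Proof. by apply/allP => e he; rewrite -(fst_dual_words3 n) map_f. Qed.

Lemma words2_expansion n p : (2 <= n)%N -> spanned2 n p ->
  p ~= \sum_(e <- dual_words2 n) func2 n (row2 e.1) p *: evs sys2 e.2.
Proof.
move=> hn; apply: (@represents_spanned sys2 lets2 4 n hit (fun p h => h) hitD idx2 (fun i => func2 n (row2 i))).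
- by move=> i q r; apply: func2D.
- by move=> i q; apply: func2_hit.
- by move=> i w hi hv hs; rewrite func2_word // row2K.
- exact: dual_words2_idx.
case: n hn => [|[|[|n]]] // _; first exact: represents2_2.
exact: (stable_represents len2 represents2_3 absorbs2_3).
Qed.

Lemma words3_expansion n p : (3 <= n)%N -> spanned3 n p ->
  p ~= \sum_(e <- dual_words3 n) func3 n (row3 e.1) p *: evs sys3 e.2.
Proof.
move=> hn; apply: (@represents_spanned sys3 lets3 14 n hit (fun p h => h) hitD idx3 (fun i => func3 n (row3 i))).
- by move=> i q r; apply: func3D.
- by move=> i q; apply: func3_hit.
- by move=> i w hi hv hs; rewrite func3_word // row3K.
- exact: dual_words3_idx.
case: n hn => [|[|[|n]]] // _.
exact: (stable_represents len3 represents3_3 absorbs3_3).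
Qed.

Definition unit0 := [:: true; false; false; false].
Definition unit1 := [:: false; true; false; false].
Definition unit01 := [:: true; true; false; false].

Lemma F2_add_eq0 (a b : F2) : a + b = 0 -> a = b.
Proof.
by case: (F2_cases a) => ->; case: (F2_cases b) => -> //; rewrite ?addr0 ?add0r // => ->.
Qed.

Lemma func2_rel n (rs : seq (seq (seq bool))) p : spanned2 n p ->
  (forall w, valid lets2 4 w -> size w.1 = n -> \sum_(r <- rs) (phi (table2 r) w)%:R = 0 :> F2) ->
  \sum_(r <- rs) func2 n r p = 0.
Proof.
move=> [ws /andP[/allP hl /allP hv] e] h.
have ep r : func2 n r p = func2 n r (evs sys2 ws).
  by apply: F2_add_eq0; rewrite -func2D func2_hit.
rewrite (eq_bigr _ (fun r _ => ep r)) {e ep p}.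
elim: ws hl hv => [|w ws IH] hl hv.
  by rewrite evs_nil big1 // => r _; apply: func2_hit hit0.
have hvw := hv _ (mem_head _ _); have hs := eqP (hl _ (mem_head _ _)).
rewrite (eq_bigr (fun r => (phi (table2 r) w)%:R + func2 n r (evs sys2 ws))) => [|r _].
  rewrite big_split /= h // add0r; apply: IH => x hx.
    by apply: hl; rewrite in_cons hx orbT.
  by apply: hv; rewrite in_cons hx orbT.
by rewrite evs_cons func2D func2_word.
Qed.

Lemma sum_seq2 (V : nmodType) I (a b : I) (F : I -> V) : \sum_(r <- [:: a; b]) F r = F a + F b.
Proof. by rewrite !big_cons big_nil addr0. Qed.
Lemma sum_seq3 (V : nmodType) I (a b c : I) (F : I -> V) :
  \sum_(r <- [:: a; b; c]) F r = F a + F b + F c.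
Proof. by rewrite !big_cons big_nil addr0 addrA. Qed.

(* Flags: the first rows range over the lines of a plane. *)
Lemma func2_plane n p : spanned2 n p ->
  func2 n [:: unit0; unit1] p + func2 n [:: unit1; unit0] p + func2 n [:: unit01; unit1] p = 0.
Proof.
move=> hp; rewrite -(sum_seq3 _ _ _ (fun r => func2 n r p)); apply: (func2_rel hp).
move=> [l v] /andP[_ hv] _; rewrite sum_seq3 /phi /lam.
have -> : (table2 [:: unit1; unit0]).1 = (table2 [:: unit0; unit1]).1 by vm_compute.
have -> : (table2 [:: unit01; unit1]).1 = (table2 [:: unit0; unit1]).1 by vm_compute.
case: (all _ _); last by rewrite !andFb !F2_add.
by rewrite !andTb !F2_add; case: v hv => [|[|[|[|v]]]].
Qed.

Lemma func2_shear n p : spanned2 n p -> func2 n [:: unit0; unit01] p = func2 n [:: unit0; unit1] p.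
Proof.
move=> hp; apply: F2_add_eq0; rewrite -(sum_seq2 _ _ (fun r => func2 n r p)).
apply: (func2_rel hp) => -[l v] _ _; rewrite sum_seq2.
have -> : table2 [:: unit0; unit01] = table2 [:: unit0; unit1] by vm_compute.
by rewrite F2_add addbb.
Qed.

Lemma ginv_func2 n p r : r \in rows2 -> ginv p -> func2 n r p = p@_(sp2 n).
Proof.
have /allP h : all (indep 2) rows2 by vm_compute.
move=> /h hr hp; apply: (ginv_mcoeff hr hp (spike2 n)); exact: sp2_tail.
Qed.

Lemma ginv_func3 n p r : r \in rows3 -> ginv p -> func3 n r p = p@_(sp3 n).
Proof.
have /allP h : all (indep 3) rows3 by vm_compute.
move=> /h hr hp; apply: (ginv_mcoeff hr hp (spike3 n)); exact: sp3_tail.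
Qed.

Lemma row2_mem i : i \in idx2 -> row2 i \in rows2.
Proof. by move: i; apply/allP; vm_compute. Qed.
Lemma row3_mem i : i \in idx3 -> row3 i \in rows3.
Proof. by move: i; apply/allP; vm_compute. Qed.

Lemma func2_indep n p r : ginv p -> indep 2 r -> func2 n r p = p@_(sp2 n).
Proof. by move=> hp hr; apply: (ginv_mcoeff hr hp (spike2 n)); apply: sp2_tail. Qed.

Lemma lines_indep : [&& indep 2 [:: unit0; unit1], indep 2 [:: unit1; unit0] & indep 2 [:: unit01; unit1]].
Proof. by vm_compute. Qed.

Lemma F2_add3_eq0 (a b c x : F2) : a = x -> b = x -> c = x -> a + b + c = 0 -> x = 0.
Proof. by move=> -> -> ->; case: (F2_cases x) => -> // /eqP. Qed.

Lemma ginv_mcoeff_sp2 n p : ginv p -> spanned2 n p -> p@_(sp2 n) = 0.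
Proof.
move=> hp hs; have /and3P[i1 i2 i3] := lines_indep.
exact: (F2_add3_eq0 (func2_indep n hp i1) (func2_indep n hp i2) (func2_indep n hp i3) (func2_plane hs)).
Qed.

Lemma ginv_words2_hit n p : (2 <= n)%N -> ginv p -> spanned2 n p -> hit p.
Proof.
move=> hn hp hs; apply: (heq_hit (words2_expansion hn hs)); rewrite big_seq; apply: hit_sum => e he.
have hi := allP (dual_words2_idx n) _ he.
by rewrite (ginv_func2 n (row2_mem hi) hp) (ginv_mcoeff_sp2 hp hs) scale0r; apply: hit0.
Qed.

Definition compose_rows (c r : seq (seq bool)) : seq (seq bool) :=
  [seq [seq (bit c i 0 && bit r 0 j) (+) (bit c i 1 && bit r 1 j) | j <- iota 0 4] | i <- iota 0 2].

Lemma bit_nil r i j : (size r <= i)%N -> bit r i j = false.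
Proof. by move=> h; rewrite /bit (nth_default _ h) nth_nil. Qed.

Lemma mx_of_rows_compose c r : (size c <= 2)%N -> (size r <= 2)%N ->
  mx_of_rows c *m mx_of_rows r = mx_of_rows (compose_rows c r).
Proof.
move=> hc hr; apply/matrixP => i j; rewrite !mxE sumr_ord4 !mxE !inordK //.
rewrite !F2_mul (bit_nil j hr) (@bit_nil r 3) ?(leq_trans hr) // !andbF !F2_add !addbF.
congr (nat_of_bool _)%:R; have [h|h] := ltnP i 2; last first.
  by rewrite !(bit_nil _ (leq_trans hc h)) (@bit_nil (compose_rows c r) i j h).
by rewrite [in RHS]/bit /compose_rows (nth_map 0%N) ?size_iota // (nth_map 0%N) ?size_iota // !nth_iota.
Qed.

Lemma kameko_proj k p : (k < 4)%N -> kameko (act (proj4 k) p) = 0.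
Proof.
move=> hk; apply/mpolyP => m; rewrite mcoeff_kameko act_proj mcoeff0.
case: forallP => // /(_ (inord k)); rewrite inordK // leqnn /= !mnmE; lia.
Qed.

Lemma func2_compose n c r p : (size c <= 2)%N -> (size r <= 2)%N ->
  func2 n c (act (mx_of_rows r) p) = func2 n (compose_rows c r) p.
Proof. by move=> hc hr; rewrite /func2 act_comp mx_of_rows_compose. Qed.

Lemma spanned2_restrict n r p : (size r <= 2)%N -> p \is (deg2 n).-homog ->
  spanned2 n (act (mx_of_rows r) p).
Proof.
move=> hr hp; apply: spanned2_ker; first exact: act_homog.
by rewrite -(mx_of_rows_trunc hr) -act_comp kameko_proj.
Qed.

Lemma func2_all0 n p : (0 < n)%N -> p \is (deg2 n).-homog ->
  (forall r, r \in rows2 -> func2 n r p = 0) ->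
  forall a b, a \in bits4 -> b \in bits4 -> func2 n [:: a; b] p = 0.
Proof.
move=> hn hp h0.
pose degs := [:: [:: unit0; unit0]; [:: unit0; [::]]; [:: [::]; unit1]; [:: [::]; [::]]].
have hdeg c r : c \in degs -> (size r <= 2)%N -> func2 n (compose_rows c r) p = 0.
  move=> hc hr; have sc : (size c <= 2)%N.
    by move: c hc; apply/allP.
  rewrite -func2_compose //; have := @func2_rel n [:: c] _ (spanned2_restrict hr hp).
  rewrite !big_seq1; apply=> -[[|b l] v] hw hs; first by move: hn; rewrite -hs.
  rewrite big_seq1 phi_cons.
  have -> : lam (table2 c) b = false.
    have : ~~ has id (table2 c).1 by move: c hc {sc}; apply/allP; vm_compute.
    rewrite /lam -all_predC => /all_nthP h; have [hb|hb] := ltnP b (size (table2 c).1).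
      by apply/negbTE/h.
    by rewrite nth_default.
  by [].
have hsz r : r \in rows2 -> (size r <= 2)%N /\ compose_rows [:: unit1; unit0] r \in rows2 /\
    compose_rows [:: unit0; unit1] r = r.
  move=> hr; have : [&& (size r <= 2)%N, compose_rows [:: unit1; unit0] r \in rows2 & compose_rows [:: unit0; unit1] r == r].
    by move: r hr; apply/allP; vm_compute.
  by move=> /and3P[-> -> /eqP ->].
have hsh r : r \in rows2 -> func2 n (compose_rows [:: unit0; unit01] r) p = 0.
  move=> hr; have [s1 [s2 s3]] := hsz r hr.
  rewrite -func2_compose // func2_shear; last exact: spanned2_restrict.
  by rewrite func2_compose // s3 h0.
have hpl r : r \in rows2 -> func2 n (compose_rows [:: unit01; unit1] r) p = 0.
  move=> hr; have [s1 [s2 s3]] := hsz r hr.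
  have := func2_plane (spanned2_restrict s1 hp); rewrite !func2_compose // s3.
  by rewrite (h0 _ hr) (h0 _ s2) !add0r.
move=> a b ha hb.
have : [|| has (fun c => compose_rows c [:: a; b] == [:: a; b]) degs, [:: a; b] \in rows2,
    [:: a; b] \in map (compose_rows [:: unit0; unit01]) rows2 |
    [:: a; b] \in map (compose_rows [:: unit01; unit1]) rows2].
  by move: b hb; apply/allP; move: a ha; apply/allP; vm_compute.
case/or4P.
- by move=> /hasP[c hc /eqP <-]; apply: hdeg.
- exact: h0.
- by move=> /mapP[r hr ->]; apply: hsh.
- by move=> /mapP[r hr ->]; apply: hpl.
Qed.

Lemma mx_of_rows_take k (M : 'M[F2]_4) : (forall i : 'I_4, (k <= i)%N -> forall j, M i j = 0) ->
  M = mx_of_rows (take k (rows_of_mx M)).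
Proof.
move=> h; apply/matrixP => i j; rewrite mxE; have [hi|hi] := ltnP i k; last first.
  by rewrite h // bit_nil // size_take; case: ifP; rewrite ?size_map ?size_iota //; lia.
by rewrite /bit nth_take // -/(bit _ i j) -bit_rows_of_mx // !inord_val.
Qed.

Lemma rows_of_mx_bits4 M : all (mem bits4) (rows_of_mx M).
Proof.
apply/allP => _ /mapP[i _ ->] /=.
by case: (_ == _); case: (_ == _); case: (_ == _); case: (_ == _).
Qed.

Lemma mx_of_rows_mul k r g : (size r <= k)%N ->
  mx_of_rows r *m g = mx_of_rows (take k (rows_of_mx (mx_of_rows r *m g))).
Proof.
move=> hr; apply: mx_of_rows_take => i hi j; rewrite mxE big1 // => l _.
by rewrite mxE bit_nil ?mul0r // (leq_trans hr).
Qed.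

Lemma kameko_evs2 n ws : len n.+1 ws -> kameko (evs sys2 ws) = 0.
Proof.
elim: ws => [|[[//|c l] v] ws IH] /=; first by rewrite evs_nil kameko0.
move=> /andP[_ /IH e]; rewrite evs_cons kamekoD e addr0.
have ho : let2 c \is (1 + 1)%N.-homog by apply: dhomogM; apply: xv_homog.
exact: (kameko_small _ ho).
Qed.

Lemma dual_sum (func : seq bool * seq bool -> P4 -> F2) W idx
    (L : seq ((seq bool * seq bool) * seq word)) (c : seq bool * seq bool -> F2) i :
  uniq idx -> map fst L = idx -> i \in idx ->
  (forall p q, func i (p + q) = func i p + func i q) -> func i 0 = 0 ->
  (forall e, e \in L -> func i (evs W e.2) = (i == e.1)%:R) ->
  func i (\sum_(e <- L) c e.1 *: evs W e.2) = c i.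
Proof.
move=> hu hf hi hD hz h.
have hZ a p : func i (a *: p) = a * func i p.
  by case: (F2_cases a) => ->; rewrite ?scale0r ?scale1r ?mul0r ?mul1r.
rewrite (big_morph (func i) hD hz).
rewrite (eq_big_seq (fun e => if e.1 == i then c i else 0)) => [|e he].
  rewrite -(big_map fst xpredT (fun j => if j == i then c i else 0)) hf (bigD1_seq i) //= eqxx.
  by rewrite big1 ?addr0 // => j /negPf ->.
by rewrite hZ h // eq_sym; case: eqP => [->|_]; rewrite ?mulr1 ?mulr0.
Qed.

Lemma stable_dual2 n e i : e \in dual_words2 n.+3 -> i \in idx2 ->
  func2 n.+3 (row2 i) (evs sys2 e.2) = (i == e.1)%:R.
Proof.
move=> he hi; have hd := allP (allP (stable_dual fst2 lead2E dual2E n) _ he) _ hi.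
have hl := stable_len len2 he.
have hv : all (valid lets2 4) e.2.
  elim: n {i hi hd hl} e he => [|n IH] e.
    by move: e; apply/allP; vm_compute.
  move=> /mapP[e' he' ->] /=; rewrite all_map; have hi : e'.1 \in idx2.
    by rewrite -(stable_fst lets2 fst2 n) map_f.
  have hlead : lead lets2 e'.1 \in lets2 by move: (e'.1) hi; apply/allP; vm_compute.
  by apply/allP => w /(allP (IH _ he')); rewrite /= /valid /= hlead.
rewrite -(eqP hd) -F2_odd.
elim: (e.2) hl hv {he hd} => [|w ws IH]; first by rewrite evs_nil => _ _; apply: func2_hit hit0.
move=> /andP[/eqP hs hl] /andP[hw hv]; rewrite evs_cons func2D IH // func2_word // row2K //.
by rewrite /= natrD.
Qed.

Lemma stable_valid3 n e : e \in dual_words3 n.+3 -> all (valid lets3 14) e.2.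
Proof.
elim: n e => [|n IH] e; first by move: e; apply/allP; vm_compute.
move=> /mapP[e' he' ->] /=; rewrite all_map; have hi : e'.1 \in idx3.
  by rewrite -(stable_fst lets3 fst3 n) map_f.
have hlead : lead lets3 e'.1 \in lets3 by move: (e'.1) hi; apply/allP; vm_compute.
by apply/allP => w /(allP (IH _ he')); rewrite /= /valid /= hlead.
Qed.

Lemma stable_dual3 n e i : e \in dual_words3 n.+3 -> i \in idx3 ->
  func3 n.+3 (row3 i) (evs sys3 e.2) = (i == e.1)%:R.
Proof.
move=> he hi; have hd := allP (allP (stable_dual fst3 lead3E dual3E n) _ he) _ hi.
have hl := stable_len len3 he; have hv := stable_valid3 he.
rewrite -(eqP hd) -F2_odd.
elim: (e.2) hl hv {he hd} => [|w ws IH]; first by rewrite evs_nil => _ _; apply: func3_hit hit0.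
move=> /andP[/eqP hs hl] /andP[hw hv]; rewrite evs_cons func3D IH // func3_word // row3K //.
by rewrite /= natrD.
Qed.

Lemma kameko_lift_ginv n d g : deg2 n.+3 = (d * 2 + 4)%N -> g \is d.-homog -> ginv g ->
  exists f, [/\ f \is (deg2 n.+3).-homog, kameko f = g & ginv f].
Proof.
move=> hd hg ig; pose u := prod_xv * g ^+ 2; pose N := n.+3.
pose c := \sum_(e <- dual_words2 N) func2 N (row2 e.1) u *: evs sys2 e.2.
have hu : u \is (deg2 N).-homog.
  by rewrite hd addnC; apply: dhomogM prod_xv_homog (dhomogMn 2 hg).
have lenE e : e \in dual_words2 N -> len N e.2 by apply: (stable_len len2).
have hc : c \is (deg2 N).-homog.
  rewrite /c big_seq; apply: rpred_sum => e he; rewrite rpredZ //.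
  exact: (@evs_homog sys2) (lenE e he).
have kc : kameko c = 0.
  rewrite /c kameko_sum big1_seq // => e /andP[_ he].
  by rewrite kamekoZ (kameko_evs2 (lenE e he)) scaler0.
have hf : u + c \is (deg2 N).-homog by apply: rpredD.
exists (u + c); split=> //; first by rewrite kamekoD kc addr0 kameko_prod_xv.
have f0 r : r \in rows2 -> func2 N r (u + c) = 0.
  move=> hr; have er : row2 (table2 r) = r.
    by apply/eqP; move: r hr; apply/allP; vm_compute.
  have hi : table2 r \in idx2 by move: r hr {er}; apply/allP; vm_compute.
  rewrite func2D -er /c (@dual_sum (fun i => func2 N (row2 i)) sys2 idx2 (dual_words2 N)
    (fun i => func2 N (row2 i) u) (table2 r)) //.
  - by case: (F2_cases (func2 N (row2 (table2 r)) u)) => ->; apply/eqP.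
  - exact: fst_dual_words2.
  - by move=> p q; apply: func2D.
  - exact: func2_hit hit0.
  - by move=> e he; apply: stable_dual2.
move=> h uh; have ho : act h (u + c) + (u + c) \is (deg2 N).-homog.
  by apply: rpredD => //; apply: act_homog.
have hk : hit (kameko (act h (u + c) + (u + c))).
  rewrite kamekoD kameko_act // kamekoD kc addr0 kameko_prod_xv.
  exact: ig.
apply: (heq_hit (words2_expansion (isT : (2 <= N)%N) (spanned2_kameko hd ho hk))).
rewrite big_seq; apply: hit_sum => e he.
have hr := row2_mem (allP (dual_words2_idx N) _ he); set r := row2 _ in hr *.
have sr : (size r <= 2)%N by move: r hr; apply/allP; vm_compute.
rewrite func2D (f0 _ hr) addr0 /func2 act_comp (mx_of_rows_mul _ sr).
have := rows_of_mx_bits4 (mx_of_rows r *m h).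
rewrite /rows_of_mx [map _ _]/= => /and4P[h1 h2 _ _].
rewrite [take _ _]/= -/(func2 N _ _) (func2_all0 (isT : (0 < N)%N) hf f0 h1 h2) scale0r.
exact: hit0.
Qed.

Lemma func3_rel n (rs : seq (seq (seq bool))) p : spanned3 n p ->
  (forall w, valid lets3 14 w -> size w.1 = n -> \sum_(r <- rs) (phi (table3 r) w)%:R = 0 :> F2) ->
  \sum_(r <- rs) func3 n r p = 0.
Proof.
move=> [ws /andP[/allP hl /allP hv] e] h.
have ep r : func3 n r p = func3 n r (evs sys3 ws).
  by apply: F2_add_eq0; rewrite -func3D func3_hit.
rewrite (eq_bigr _ (fun r _ => ep r)) {e ep p}.
elim: ws hl hv => [|w ws IH] hl hv.
  by rewrite evs_nil big1 // => r _; apply: func3_hit hit0.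
have hvw := hv _ (mem_head _ _); have hs := eqP (hl _ (mem_head _ _)).
rewrite (eq_bigr (fun r => (phi (table3 r) w)%:R + func3 n r (evs sys3 ws))) => [|r _].
  rewrite big_split /= h // add0r; apply: IH => x hx.
    by apply: hl; rewrite in_cons hx orbT.
  by apply: hv; rewrite in_cons hx orbT.
by rewrite evs_cons func3D func3_word.
Qed.

Lemma func3_eq n r r' p : spanned3 n p -> table3 r = table3 r' -> func3 n r p = func3 n r' p.
Proof.
move=> hp e; apply: F2_add_eq0; rewrite -(sum_seq2 _ _ (fun r => func3 n r p)).
by apply: (func3_rel hp) => w _ _; rewrite sum_seq2 e F2_add addbb.
Qed.

Lemma func3_degenerate n r p : spanned3 n.+1 p -> ~~ has id (table3 r).1 -> func3 n.+1 r p = 0.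
Proof.
move=> hp hr; have := @func3_rel n.+1 [:: r] p hp; rewrite !big_seq1; apply.
move=> [[//|c l] v] _ _; rewrite big_seq1 phi_cons.
suff -> : lam (table3 r) c = false by [].
rewrite /lam; move: hr; rewrite -all_predC => /all_nthP h.
have [hb|hb] := ltnP c (size (table3 r).1); first by apply/negbTE/h.
by rewrite nth_default.
Qed.

Lemma table3_cases r : r \in lists_over bits4 3 -> ~~ has id (table3 r).1 \/ table3 r \in idx3.
Proof. by move=> hr; apply/orP; move: r hr; apply/allP; vm_compute. Qed.

Lemma lists_overP (T : eqType) (s l : seq T) :
  all (mem s) l -> l \in lists_over s (size l).
Proof.
elim: l => //= x l IH /andP[hx /IH hl].
by apply/allpairsP; exists (x, l).
Qed.

Lemma act_row3 g r : (size r <= 3)%N ->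
  exists2 r', r' \in lists_over bits4 3 & forall n p, func3 n r (act g p) = func3 n r' p.
Proof.
move=> sr; exists (take 3 (rows_of_mx (mx_of_rows r *m g))); last first.
  by move=> n p; rewrite /func3 act_comp -(mx_of_rows_mul _ sr).
have := rows_of_mx_bits4 (mx_of_rows r *m g); rewrite /rows_of_mx [map _ _]/= => /and4P[h1 h2 h3 _].
rewrite [take _ _]/=.
apply: (@lists_overP _ bits4 [:: _; _; _]); apply/and4P; split=> //.
Qed.

Lemma act_idx3 n g r : r \in rows3 -> g \in unitmx -> exists2 i, i \in idx3 &
  forall p, p \is (deg3 n.+1).-homog -> func3 n.+1 r (act g p) = func3 n.+1 (row3 i) p.
Proof.
move=> hr ug; have sr : (size r <= 3)%N by move: r hr; apply/allP; vm_compute.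
have [r' hr' e] := act_row3 g sr.
case: (table3_cases hr') => [hd|hi]; last first.
  exists (table3 r'); first exact: hi.
  move=> p hp; rewrite e; apply: (func3_eq (spanned3_homog hp)).
  by rewrite (row3K hi).
pose ok c v := phi (table3 r) ([:: c], v).
have : has (fun c => has (ok c) (iota 0 14)) lets3.
  by move: r hr {sr e ug} @ok; apply/allP; vm_compute.
case/hasP=> c hc /hasP[v hv]; rewrite /ok /phi /= andbT => /andP[hl hm].
pose w : word := (nseq n.+1 c, v).
have sw : size w.1 = n.+1 by rewrite size_nseq.
have vw : valid lets3 14 w by rewrite /valid all_nseq [mem _ c]hc orbT; move: hv; rewrite mem_iota.
have pw : phi (table3 r) w by rewrite /phi all_nseq hl orbT.
have hw : evw sys3 w \is (deg3 n.+1).-homog by rewrite -sw; apply: evw_homog.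
have h1 := func3_word r vw sw; move: h1 hw; rewrite pw; move: (evw _ _) => q h1 hw.
have hs : spanned3 n.+1 (act (invmx g) q) by apply/spanned3_homog/act_homog.
have h0 := func3_degenerate hs hd; rewrite -e act_comp (mulmxV ug) act1 h1 in h0.
by move/eqP: h0; rewrite oner_eq0.
Qed.

Definition top3 n := \sum_(e <- dual_words3 n) evs sys3 e.2.

Lemma len_dual_words3 n e : e \in dual_words3 n.+3 -> len n.+3 e.2.
Proof. exact: (stable_len len3). Qed.

Lemma top3_homog n : top3 n.+3 \is (deg3 n.+3).-homog.
Proof.
rewrite /top3 big_seq; apply: rpred_sum => e he.
exact: (@evs_homog sys3) (len_dual_words3 he).
Qed.

Lemma func3_top n i : i \in idx3 -> func3 n.+3 (row3 i) (top3 n.+3) = 1.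
Proof.
move=> hi; rewrite /top3 (eq_bigr (fun e => (1 : F2) *: evs sys3 e.2)); last first.
  by move=> e _; rewrite scale1r.
apply: (@dual_sum (fun i => func3 n.+3 (row3 i)) sys3 idx3 (dual_words3 n.+3) (fun _ => 1) i) => //.
- exact: fst_dual_words3.
- by move=> p q; apply: func3D.
- exact: func3_hit hit0.
- by move=> e he; apply: stable_dual3.
Qed.

Lemma top3_nonhit n : ~ hit (top3 n.+3).
Proof.
have hi : head ([::], [::]) idx3 \in idx3 by vm_compute.
by move=> /(func3_hit n.+3 (row3 (head ([::], [::]) idx3))); rewrite func3_top // => /eqP; rewrite oner_eq0.
Qed.

Lemma top3_ginv n : ginv (top3 n.+3).
Proof.
move=> g ug; have ht := top3_homog n.
have hs : spanned3 n.+3 (act g (top3 n.+3) + top3 n.+3).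
  by apply/spanned3_homog/rpredD => //; apply: act_homog.
apply: (heq_hit (words3_expansion (isT : (3 <= n.+3)%N) hs)).
rewrite big_seq; apply: hit_sum => e he; have hi := allP (dual_words3_idx n.+3) _ he.
have [i hi' ei] := act_idx3 n.+2 (row3_mem hi) ug.
rewrite func3D ei // !func3_top //.
have -> : 1 + 1 = 0 :> F2 by apply/eqP.
by rewrite scale0r; apply: hit0.
Qed.

Definition mnm_of_seq (l : seq nat) := mnm4 (nth 0 l 0) (nth 0 l 1) (nth 0 l 2) (nth 0 l 3).

Lemma sqbin_mnm_of_seq (e : 'X_{1..4}) l : [forall i, sqbin (e i) (mnm_of_seq l i)] =
  all (fun k => sqbin (e (inord k)) (nth 0%N l k)) (iota 0 4).
Proof.
apply/forallP/allP => [h k|h i].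
  rewrite mem_iota => /andP[_ hk]; have := h (inord k); rewrite mnmE inordK //.
  by case: k hk => [|[|[|[|//]]]].
have := h i; rewrite inord_val mem_iota ltn_ord mnmE; case: i => [[|[|[|[|//]]]] hi]; exact.
Qed.

(* The sum of these four coefficients vanishes on hit polynomials of degree 9
   and is 1 on f0. *)
Definition psi_supp := [:: [:: 3; 1; 1; 4]; [:: 3; 2; 1; 3]; [:: 5; 1; 1; 2]; [:: 6; 1; 1; 1]]%N.
Definition psi (p : P4) := \sum_(l <- psi_supp) p@_(mnm_of_seq l).

Lemma psiD p q : psi (p + q) = psi p + psi q.
Proof. by rewrite /psi -big_split; apply: eq_bigr => l _; apply: mcoeffD. Qed.

Lemma psi_hit p : hit p -> psi p = 0.
Proof.
elim=> [|k f q k0 _ IH]; first by rewrite /psi big1 // => l _; apply: mcoeff0.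
rewrite psiD IH addr0 (mpolyE f) Sq_sum /psi.
rewrite (eq_bigr (fun l => \sum_(e <- msupp f) (Sq k (f@_e *: 'X_[e]))@_(mnm_of_seq l))) => [|l _]; last first.
  by rewrite raddf_sum.
rewrite exchange_big big1 // => e _ /=.
rewrite (eq_bigr (fun l => f@_e * (Sq k 'X_[e])@_(mnm_of_seq l))) => [|l _]; last first.
  by rewrite SqZ mcoeffZ.
rewrite -mulr_sumr; apply/eqP; rewrite mulf_eq0; apply/orP; right; apply/eqP.
pose s := [seq e (inord k) | k <- iota 0 4].
pose sqb (t l : seq nat) := all (fun k => sqbin (nth 0%N t k) (nth 0%N l k)) (iota 0 4).
have hd : mdeg e = sumn s by rewrite mdegE sum_ord4 /= !addnA addn0.
have eS l : l \in psi_supp ->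
    (Sq k 'X_[e])@_(mnm_of_seq l) = ((9 == sumn s + k) && sqb s l)%N%:R.
  move=> hl; rewrite mcoeff_SqX sqbin_mnm_of_seq mdeg_mnm4 hd; congr (nat_of_bool (_ && _))%:R.
  by congr (_ == _); apply/eqP; move: l hl; apply/allP.
rewrite (eq_big_seq _ eS); case: eqP => [h9|_]; last by rewrite big1.
have hs : (sumn s < 9)%N by lia.
have [hall|] := boolP (all (fun x => x < 7)%N s); last first.
  move=> /allPn[x /mapP[j hj ->]]; rewrite -leqNgt => hx; rewrite big1_seq // => l /andP[_ hl].
  rewrite (_ : sqb s l = false) ?andbF //; apply/negbTE/allPn; exists j => //.
  have hj4 : (j < 4)%N by move: hj; rewrite mem_iota.
  rewrite /s (nth_map 0%N) ?size_iota // nth_iota // add0n /sqbin leqNgt negb_and negbK.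
  rewrite (leq_trans _ hx) // ltnS.
  have : all (all (fun x => x <= 6)%N) psi_supp by [].
  move=> /allP/(_ _ hl)/allP h; have [hj'|hj'] := ltnP j (size l); first exact/h/mem_nth.
  by rewrite nth_default.
have hm : s \in lists_over (iota 0 7) 4.
  apply: (@lists_overP _ (iota 0 7) s); apply/allP => x /(allP hall) hx.
  by have : x \in iota 0 7 by rewrite mem_iota; exact: hx.
have : ~~ odd (count (sqb s) psi_supp).
  have /allP h : all (fun s => (sumn s < 9)%N ==> ~~ odd (count (sqb s) psi_supp)) (lists_over (iota 0 7) 4).
    by vm_compute.
  exact: implyP (h _ hm) hs.
rewrite -sum1_count => ho.
rewrite (eq_bigr (fun l => (sqb s l)%:R)) => [|l _]; last by rewrite andTb.
rewrite -natr_sum F2_odd -big_mkcond /=.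
by rewrite (negPf ho).
Qed.

Lemma psi_f0 : psi f0 = 1.
Proof.
have m1 a b c d : xv 0 ^+ a * xv 1 ^+ b * xv 2 ^+ c * xv 3 ^+ d = 'X_[mnm4 a b c d].
  by rewrite mpolyXE_id prod_ord4 !mnmE !inordK.
have e : f0 = 'X_[mnm_of_seq [:: 6; 1; 1; 1]%N] + 'X_[mnm_of_seq [:: 1; 6; 1; 1]%N] +
    'X_[mnm_of_seq [:: 1; 1; 6; 1]%N] + 'X_[mnm_of_seq [:: 1; 1; 1; 6]%N].
  rewrite /f0 /f0w [map _ _]/= evs_seq4 /evw /= /mnm_of_seq /= -!m1 /inn3 /support_poly /qv /=.
  ring.
have cf a b : (mnm_of_seq a == mnm_of_seq b) = all (fun k => nth 0%N a k == nth 0%N b k) (iota 0 4).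
  apply/eqP/allP => [h k|h].
    rewrite mem_iota => /andP[_ hk]; have /mnmP/(_ (inord k)) := h.
    by rewrite !mnmE inordK //; case: k hk => [|[|[|[|//]]]] _ /= ->.
  apply/mnmP => i; rewrite !mnmE; have := h i; rewrite mem_iota ltn_ord => /(_ isT)/eqP.
  by case: i => [[|[|[|[|//]]]] hi].
rewrite e /psi !big_cons big_nil !mcoeffD !mcoeffX !cf.
by apply/eqP.
Qed.

Lemma f0_nonhit : ~ hit f0.
Proof. by move/psi_hit/eqP; rewrite psi_f0 oner_eq0. Qed.

Lemma f0_homog : f0 \is (deg3 1).-homog.
Proof. exact: (@evs_homog sys3 1 f0w isT). Qed.

Lemma func3_f0 i : i \in idx3 -> func3 1 (row3 i) f0 = 0.
Proof.
move=> hi; have /allP/(_ _ hi) : all (fun i => ~~ odd (count (phi i) f0w)) idx3 by vm_compute.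
have : all (valid lets3 14) f0w by [].
have : len 1 f0w by [].
move=> /allP hl /allP hv /negPf ho.
rewrite -[RHS]/(false%:R) -ho -F2_odd /f0.
elim: f0w hl hv {ho} => [|w ws IH] hl hv.
  by rewrite evs_nil func3_hit //; apply: hit0.
rewrite evs_cons func3D IH => [|x hx|x hx]; last 2 first.
- by apply: hl; rewrite in_cons hx orbT.
- by apply: hv; rewrite in_cons hx orbT.
rewrite func3_word ?row3K //=; first by rewrite natrD.
  by apply/hv/mem_head.
by apply/eqP/hl/mem_head.
Qed.

Lemma words3_expansion1 p : spanned3 1 p ->
  exists c : F2, hit (p + \sum_(e <- dual_words3_at1) func3 1 (row3 e.1) p *: evs sys3 e.2 + c *: f0).
Proof.
apply: (@represents_spanned sys3 lets3 14 1 hit_mod_f0 _ _ idx3 (fun i => func3 1 (row3 i))).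
- by move=> q h; exists 0; rewrite scale0r addr0.
- by move=> q r [c hc] [d hd]; exists (c + d); rewrite scalerDl addrACA; apply: hitD.
- by move=> i q r; apply: func3D.
- by move=> i q; apply: func3_hit.
- by move=> i w hi hv hs; rewrite func3_word // row3K.
- exact: (dual_words3_idx 1).
exact: represents3_1.
Qed.

Lemma f0_ginv : ginv f0.
Proof.
move=> g ug; have ho : act g f0 + f0 \is (deg3 1).-homog.
  by apply: rpredD f0_homog; apply: act_homog f0_homog.
have [c] := words3_expansion1 (spanned3_homog ho).
rewrite big1_seq ?addr0 => [|e /andP[_ he]]; last first.
  have hi := allP (dual_words3_idx 1) _ he; have [i hi' ei] := act_idx3 0 (row3_mem hi) ug.
  by rewrite func3D (ei _ f0_homog) !func3_f0 // addr0 scale0r.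
case: (F2_cases c) => ->; first by rewrite scale0r addr0.
rewrite scale1r -addrA addpp addr0 => h.
have h2 := act_hit (invmx g) h; move: h2; rewrite act_comp mulVmx // act1 => h2; exact: (hitD h h2).
Qed.

Lemma even_sum3 j : (j < 3)%N -> forall w, valid lets3 14 w -> size w.1 = j ->
  \sum_(r <- rows3) (phi (table3 r) w)%:R = 0 :> F2.
Proof.
move=> hj w hw hs.
have /allP/(_ j) h : all (fun j => all (fun w => ~~ odd (count (fun i => phi i w) idx3))
    (words lets3 14 j)) (iota 0 3) by vm_compute.
rewrite mem_iota in h; have := wordsP hw; rewrite hs => /(allP (h hj)).
rewrite (eq_count (a2 := fun i => phi i w)); last by move=> i; case: (w) => l v; apply: phi_sort_letters.
have -> : idx3 = map table3 rows3 by vm_compute.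
rewrite count_map -sum1_count => /negPf ho.
rewrite -natr_sum F2_odd (eq_bigr (fun r => if phi (table3 r) w then 1 else 0)%N).
  by rewrite -big_mkcond [X in odd X](_ : _ = \sum_(r <- rows3 | phi (table3 r) w) 1)%N // ho.
by move=> r _; case: phi.
Qed.

Lemma ginv_func3_eq0 j p i : (j < 3)%N -> ginv p -> spanned3 j p -> i \in idx3 -> func3 j (row3 i) p = 0.
Proof.
move=> hj ip hs hi; rewrite (ginv_func3 j (row3_mem hi) ip).
have := func3_rel hs (even_sum3 hj).
rewrite (eq_big_seq (fun _ => p@_(sp3 j))) => [|r hr]; last exact: ginv_func3.
move: (p@_(sp3 j)) => c; rewrite big_const_seq count_predT iter_addr_0.
have -> : size rows3 = 105%N by vm_compute.
by rewrite -mulr_natl (F2_odd 105) mul1r.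
Qed.

Lemma words3_expansion0 p : spanned3 0 p -> p ~= \sum_(e <- dual_words3_at0) func3 0 (row3 e.1) p *: evs sys3 e.2.
Proof.
apply: (@represents_spanned sys3 lets3 14 0 hit (fun p h => h) hitD idx3 (fun i => func3 0 (row3 i))).
- by move=> i q r; apply: func3D.
- by move=> i q; apply: func3_hit.
- by move=> i w hi hv hs; rewrite func3_word // row3K.
- exact: (dual_words3_idx 0).
exact: represents3_0.
Qed.

Lemma ginv_deg3_0 p : p \is (deg3 0).-homog -> ginv p -> hit p.
Proof.
move=> hp ip; have hs := spanned3_homog hp; apply: (heq_hit (words3_expansion0 hs)).
rewrite big_seq; apply: hit_sum => e he.
by rewrite (ginv_func3_eq0 _ ip hs (allP (dual_words3_idx 0) _ he)) // scale0r; apply: hit0.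
Qed.

Lemma ginv_deg3_1 p : p \is (deg3 1).-homog -> ginv p -> hit p \/ hit (p + f0).
Proof.
move=> hp ip; have hs := spanned3_homog hp; have [c] := words3_expansion1 hs.
rewrite big1_seq ?addr0 => [|e /andP[_ he]]; last first.
  by rewrite (ginv_func3_eq0 _ ip hs (allP (dual_words3_idx 1) _ he)) // scale0r.
by case: (F2_cases c) => ->; rewrite ?scale0r ?scale1r ?addr0; [left | right].
Qed.

Lemma ginv_deg3_large n p : p \is (deg3 n.+3).-homog -> ginv p -> hit p \/ hit (p + top3 n.+3).
Proof.
move=> hp ip; have := words3_expansion (isT : (3 <= n.+3)%N) (spanned3_homog hp).
rewrite (eq_big_seq (fun e => p@_(sp3 n.+3) *: evs sys3 e.2)) => [|e he]; last first.
  by rewrite (ginv_func3 _ (row3_mem (allP (dual_words3_idx n.+3) _ he)) ip).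
rewrite -scaler_sumr -/(top3 n.+3); case: (F2_cases p@_(sp3 n.+3)) => ->.
  by rewrite scale0r /heq addr0; left.
by rewrite scale1r; right.
Qed.

Lemma words3_expansion2 p : spanned3 2 p ->
  hit_mod_lincomb (p + \sum_(e <- dual_words3_at2) func3 2 (row3 e.1) p *: evs sys3 e.2).
Proof.
apply: (@represents_spanned sys3 lets3 14 2 hit_mod_lincomb hit_mod_lincomb_hit _ idx3 (fun i => func3 2 (row3 i))).
- move=> q r [c hc] [d hd]; exists (fun i => c i + d i); apply: (hit_eq (hitD hc hd)).
  rewrite addrACA; congr (_ + _); rewrite /lincomb_f0 -big_split; apply: eq_bigr => i _.
  by rewrite scalerDl.
- by move=> i q r; apply: func3D.
- by move=> i q; apply: func3_hit.
- by move=> i w hi hv hs; rewrite func3_word // row3K.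
- exact: (dual_words3_idx 2).
exact: represents3_2.
Qed.

Definition transvection (a b : nat) : 'M[F2]_4 := 1%:M + delta_mx (inord b) (inord a).

Lemma act_transvection a b k : (a < 4)%N -> (b < 4)%N -> (k < 4)%N ->
  act (transvection a b) (xv k) = xv k + (if k == a then xv b else 0).
Proof.
move=> ha hb hk; rewrite /xv actX (eq_bigr (fun j : 'I_4 => (j == inord k)%:R *: 'X_j +
   (j == inord b)%:R *: (if k == a then 'X_j else 0))) => [|j _].
  rewrite big_split; congr (_ + _).
    rewrite (bigD1 (inord k)) //= eqxx scale1r big1 ?addr0 // => j /negPf ->.
    by rewrite scale0r.
  rewrite (bigD1 (inord b)) //= eqxx scale1r big1 ?addr0 // => j /negPf ->.
  by rewrite scale0r.
rewrite !mxE scalerDl; congr (_ + _).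
have -> : (inord k == inord a :> 'I_4) = (k == a) by rewrite -val_eqE /= !inordK.
by case: (j == _); case: (k == a); rewrite ?scale0r ?scaler0.
Qed.

Lemma transvection_unit a b : (a < 4)%N -> (b < 4)%N -> a != b -> transvection a b \in unitmx.
Proof.
move=> ha hb ne; suff h : transvection a b *m transvection a b = 1%:M by have [] := mulmx1_unit h.
rewrite /transvection mulmxDl !mulmxDr !mul1mx mulmx1 mul_delta_mx_0; last first.
  by rewrite -val_eqE /= !inordK.
rewrite addr0 -addrA -mulr2n -scaler_nat (F2_odd 2) scale0r addr0 //.
Qed.

Definition other_index a b k := head 0%N [seq l <- iota 0 4 | l \notin [:: a; b; k]].

Lemma act_qv a b k : (a < 4)%N -> (b < 4)%N -> (k < 4)%N -> a != b ->
  act (transvection a b) (qv k) = qv k + (if k == b then qv a else 0) +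
    (if (k != a) && (k != b) then xv (other_index a b k) * xv b ^+ 2 else 0).
Proof.
move=> ha hb hk ne; have e j : (j < 4)%N -> _ := fun hj => act_transvection ha hb hj.
have {e} : [/\ act (transvection a b) (xv 0) = xv 0 + (if 0%N == a then xv b else 0),
  act (transvection a b) (xv 1) = xv 1 + (if 1%N == a then xv b else 0),
  act (transvection a b) (xv 2) = xv 2 + (if 2 == a then xv b else 0) &
  act (transvection a b) (xv 3) = xv 3 + (if 3 == a then xv b else 0)] by split; apply: e.
move: (transvection a b) => T [unit0 unit1 e2 e3].
have : act T (qv k) = match k with
    | 0 => act T (xv 1) * act T (xv 2) * act T (xv 3)
    | 1 => act T (xv 0) * act T (xv 2) * act T (xv 3)
    | 2 => act T (xv 0) * act T (xv 1) * act T (xv 3)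
    | _ => act T (xv 0) * act T (xv 1) * act T (xv 2) end.
  by case: k {hk} => [|[|[|k]]]; rewrite !rmorphM.
move=> ->; rewrite unit0 unit1 e2 e3 {unit0 unit1 e2 e3 T}.
move: a b k ha hb hk ne => [|[|[|[|//]]]] [|[|[|[|//]]]] [|[|[|[|//]]]] _ _ _ ne //.
all: rewrite /other_index /qv /=; ring.
Qed.

Lemma act_qf0 a b k : (a < 4)%N -> (b < 4)%N -> (k < 4)%N -> a != b ->
  act (transvection a b) (qv k * f0 ^+ 2) ~= qv k * f0 ^+ 2 + (if k == b then qv a * f0 ^+ 2 else 0).
Proof.
move=> ha hb hk ne; have ut := transvection_unit ha hb ne.
have [h [ef ho hh]] : exists h : P4,
    [/\ act (transvection a b) f0 = f0 + h, h \is (deg3 1).-homog & hit h].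
  exists (act (transvection a b) f0 + f0); split; first by rewrite addrCA addpp addr0.
    by apply: rpredD f0_homog; apply: act_homog f0_homog.
  exact: f0_ginv ut.
have hl : (other_index a b k < 4)%N.
  by move: a b k {ef ho hh ut ne} ha hb hk; do 3![case=> [|[|[|[|//]]]]].
rewrite rmorphM rmorphXn /= act_qv // ef.
have hs g : g \is (deg3 1).-homog -> hit (xv (other_index a b k) * (xv b * g) ^+ 2).
  by move=> hg; apply: (@single_odd _ 10) => //; apply: (dhomogM (xv_homog b) hg).
have h1 := hit_lift_cubic k ho isT hh; have h2 := hit_lift_cubic a ho isT hh.
have h3 : hit (if k == b then qv a * h ^+ 2 else 0).
  by case: ifP => _; [exact: h2 | exact: hit0].
have h4 : hit (if (k != a) && (k != b) then xv (other_index a b k) * (xv b * (f0 + h)) ^+ 2 else 0).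
  by case: ifP => _; [apply/hs/rpredD; [apply: f0_homog | apply: ho] | apply: hit0].
apply: (hit_eq (hitD (hitD h1 h3) h4)).
rewrite exprMn !sqrDp -[LHS]addr0 -[X in _ + X = _](addpp (qv k * f0 ^+ 2 + (if k == b then qv a * f0 ^+ 2 else 0))).
by case: (k == b); case: (_ && _); ring.
Qed.

Lemma ginv_deg3_2 p : p \is (deg3 2).-homog -> ginv p -> hit p.
Proof.
move=> hp ip; have hs := spanned3_homog hp; have [c] := words3_expansion2 hs.
rewrite big1_seq ?addr0 => [|e /andP[_ he]]; last first.
  by rewrite (ginv_func3_eq0 _ ip hs (allP (dual_words3_idx 2) _ he)) // scale0r.
move=> hc; apply: (heq_hit hc).
have il a b : (a < 4)%N -> (b < 4)%N -> a != b -> hit (c b *: (qv a * f0 ^+ 2)).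
  move=> ha hb ne; have ut := transvection_unit ha hb ne.
  have h1 : act (transvection a b) (lincomb_f0 c) ~= lincomb_f0 c.
    have h2 := act_hit (transvection a b) hc; rewrite raddfD /= in h2.
    apply: heqT (heqT (ip _ ut) hc).
    by rewrite /heq addrC.
  have h2 : act (transvection a b) (lincomb_f0 c) ~= lincomb_f0 c + c b *: (qv a * f0 ^+ 2).
    have -> : c b *: (qv a * f0 ^+ 2) =
        \sum_(0 <= i < 4) c i *: (if i == b then qv a * f0 ^+ 2 else 0).
      rewrite (bigD1_seq b) ?iota_uniq ?mem_index_iota //= eqxx big1 ?addr0 // => i /negPf ->.
      by rewrite scaler0.
    rewrite /lincomb_f0 -big_split act_sum /= big_seq [X in _ ~= X]big_seq.
    apply: heq_sum => i; rewrite mem_index_iota => /andP[_ hi].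
    rewrite actZ -scalerDr; have := act_qf0 ha hb hi ne.
    by rewrite /heq -scalerDr; apply: hitZ.
  have := heqT (heqS h1) h2; rewrite /heq addrA addpp add0r; exact.
have [hz|] := boolP (all (fun i => c i == 0) (iota 0 4)).
  rewrite /lincomb_f0 big1_seq; first exact: hit0.
  by move=> i /andP[_ /(allP hz)/eqP ->]; rewrite scale0r.
case/allPn=> b hb nz; have hb4 : (b < 4)%N by move: hb; rewrite mem_iota.
have ia a : (a < 4)%N -> a != b -> hit (qv a * f0 ^+ 2).
  move=> ha ne; have := il a b ha hb4 ne.
  by case: (F2_cases (c b)) nz => -> //; rewrite scale1r.
have [a ha nab] : exists2 a, (a < 4)%N & a != b by case: (b); [exists 1%N | exists 0%N].
have ib : hit (qv b * f0 ^+ 2).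
  have nba : b != a by rewrite eq_sym.
  have := act_qf0 hb4 ha ha nba; rewrite eqxx => h.
  have h1 := heq_hit (heqS h) (act_hit (transvection b a) (ia a ha nab)).
  have := hitD h1 (ia a ha nab).
  by rewrite addrAC addpp add0r.
rewrite /lincomb_f0 big_seq; apply: hit_sum => i; rewrite mem_index_iota => /andP[_ hi].
by apply: hitZ; have [->|ne] := eqVneq i b; [exact: ib | exact: ia].
Qed.

(** * The theorem in coordinates *)

Lemma deg2_deg3 j : deg2 j.+2 = (deg3 j * 2 + 4)%N.
Proof. by elim: j => [//|j]; rewrite /= => IH; lia. Qed.

Lemma deg2E s : deg2 s = (2 ^ s.+1 + 2 ^ s - 2)%N.
Proof.
elim: s => [//|s IH]; rewrite /= IH !expnS.
have : (0 < 2 ^ s)%N by rewrite expn_gt0.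
lia.
Qed.

Lemma kameko_ginv p : ginv p -> ginv (kameko p).
Proof.
by move=> ip g ug; rewrite /heq -kameko_act // -kamekoD; apply/kameko_hit/ip.
Qed.

Lemma ginv_kameko_hit j p : p \is (deg2 j.+2).-homog -> ginv p -> hit (kameko p) -> hit p.
Proof.
move=> hp ip hk; apply: (ginv_words2_hit (isT : (2 <= j.+2)%N) ip).
exact: (spanned2_kameko (deg2_deg3 j) hp hk).
Qed.

Lemma kameko_homog j p : p \is (deg2 j.+2).-homog -> kameko p \is (deg3 j).-homog.
Proof. by rewrite deg2_deg3 => hp; apply: homog_kameko; rewrite -muln2. Qed.

Lemma ginv_deg2_hit j p : (j == 0)%N || (j == 2)%N -> p \is (deg2 j.+2).-homog -> ginv p -> hit p.
Proof.
move=> hj hp ip; apply: (ginv_kameko_hit hp ip).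
have hk := kameko_homog hp; have ik := kameko_ginv ip.
by case/orP: hj hk => /eqP -> hk; [apply: ginv_deg3_0 | apply: ginv_deg3_2].
Qed.

Lemma ginv_deg2_line j : ~~ ((j == 0)%N || (j == 2)%N) -> exists f,
  [/\ f \is (deg2 j.+2).-homog, ginv f, ~ hit f &
      forall p, p \is (deg2 j.+2).-homog -> ginv p -> hit p \/ hit (p + f)].
Proof.
move=> hj; have [g [hg ig ng cg]] : exists g, [/\ g \is (deg3 j).-homog, ginv g, ~ hit g &
    forall p, p \is (deg3 j).-homog -> ginv p -> hit p \/ hit (p + g)].
  case: j hj => [|[|[|n]]] // _.
    by exists f0; split; [exact: f0_homog | exact: f0_ginv | exact: f0_nonhit | exact: ginv_deg3_1].
  exists (top3 n.+3); split; [exact: top3_homog | exact: top3_ginv | exact: top3_nonhit |].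
  exact: ginv_deg3_large.
case: j hj hg cg => [|j] // _ hg cg.
have [f [hf kf jf]] := kameko_lift_ginv (deg2_deg3 j.+1) hg ig.
exists f; split=> //; first by move=> /kameko_hit; rewrite kf.
move=> p hp ip; have [h|h] := cg _ (kameko_homog hp) (kameko_ginv ip); [left | right].
  exact: (ginv_kameko_hit hp ip h).
apply: (@ginv_kameko_hit j.+1); first exact: rpredD.
- move=> h' uh; rewrite /heq raddfD /= addrACA.
  by apply: hitD; [apply: ip | apply: jf].
by rewrite kamekoD kf.
Qed.

Local Notation coord := Defs.coord.
Local Notation invariant := Defs.invariant.

Section Coordinates.
Variable d : nat.
Implicit Types (v : Pd d) (p : P4) (e : monD d).

Lemma mdeg_mnm_of e : mdeg (mnm_of e) = d.
Proof.
by rewrite mdegE -[RHS](eqP (valP e)); apply: eq_bigr => i _; rewrite mnmE.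
Qed.

Lemma mnm_of_inj : injective (@mnm_of d).
Proof.
move=> e e' /mnmP h; apply: val_inj; apply/ffunP => i; apply: val_inj.
by have := h i; rewrite !mnmE.
Qed.

Lemma ffun_of_mnm (m : 'X_{1..4}) : (mdeg m <= d)%N ->
  exists e : {ffun 'I_4 -> 'I_d.+1}, m = [multinom (e i : nat) | i < 4].
Proof.
move=> hm; exists [ffun i => inord (m i)]; apply/mnmP => i; rewrite mnmE ffunE inordK //.
by rewrite ltnS (leq_trans _ hm) // mdegE (bigD1 i) //= leq_addr.
Qed.

Lemma mnm_of_surj m : mdeg m = d -> exists e, m = mnm_of e.
Proof.
move=> hm; have hle : (mdeg m <= d)%N by rewrite hm.
have [f ef] := ffun_of_mnm hle.
have hs : (\sum_(i < 4) (f i : nat) == d)%N.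
  by apply/eqP; rewrite -[RHS]hm mdegE; apply: eq_bigr => i _; rewrite ef mnmE.
by exists (exist _ f hs).
Qed.

Lemma poly_of_homog v : poly_of v \is d.-homog.
Proof.
by apply: rpred_sum => e _; rewrite rpredZ // dhomogX /= mdeg_mnm_of.
Qed.

Lemma coordK v : coord d (poly_of v) = v.
Proof.
apply/ffunP => e; rewrite ffunE raddf_sum /= (bigD1 e) //= mcoeffZ mcoeffX eqxx mulr1.
rewrite big1 ?addr0 // => e' /negPf ne; rewrite mcoeffZ mcoeffX.
by rewrite (inj_eq mnm_of_inj) ne mulr0.
Qed.

Lemma poly_ofK p : p \is d.-homog -> poly_of (coord d p) = p.
Proof.
move=> hp; apply/mpolyP => m; have hq := poly_of_homog (coord d p).
case: (eqVneq (mdeg m) d) => [/mnm_of_surj[e ->]|ne].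
  by have /ffunP/(_ e) := coordK (coord d p); rewrite !ffunE.
by rewrite (dhomog_nemf_coeff hq ne) (dhomog_nemf_coeff hp ne).
Qed.

Lemma coordD p q : coord d (p + q) = coord d p + coord d q.
Proof. by apply/ffunP => e; rewrite !ffunE mcoeffD. Qed.
Lemma coord0 : coord d 0 = 0.
Proof. by apply/ffunP => e; rewrite !ffunE mcoeff0. Qed.

Lemma Hit_coord p : p \is d.-homog -> hit p -> coord d p \in Hit d.
Proof.
move=> hp /(hit_ghit hp); elim=> [|k m q k0 dm _ IH]; first by rewrite coord0 mem0v.
rewrite coordD; apply: rpredD IH; apply: memv_span.
have hm : (mdeg m <= d)%N by rewrite -dm leq_addr.
have [e em] := ffun_of_mnm hm.
have hk : (k < d.+1)%N by rewrite ltnS -dm leq_addl.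
apply/mapP; exists (Ordinal hk, e); last by rewrite SqX em.
rewrite mem_enum inE /= k0 addnC -[X in _ == X]dm eqn_add2r mdegE.
by apply/eqP; apply: eq_bigr => i _; rewrite em mnmE.
Qed.

Lemma Hit_poly v : v \in Hit d -> hit (poly_of v).
Proof.
have poly_ofD (u w : Pd d) : poly_of (u + w) = poly_of u + poly_of w.
  by rewrite /poly_of -big_split; apply: eq_bigr => e _; rewrite ffunE scalerDl.
have poly_of0 : poly_of (0 : Pd d) = 0.
  by rewrite /poly_of big1 // => e _; rewrite ffunE scale0r.
rewrite /Hit -[hit_gens d]in_tupleE => /coord_span ->.
rewrite (big_morph _ poly_ofD poly_of0); apply: hit_sum => i _.
set c := vector.coord _ _ _; case: (F2_cases c) => ->.
  by rewrite scale0r poly_of0; apply: hit0.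
rewrite scale1r /=; have /mapP[[k e] hke ->] := mem_nth 0 (ltn_ord i).
move: hke; rewrite mem_enum inE /= => /andP[k0 /eqP dk].
rewrite -SqX poly_ofK; first exact: hit_Sq.
set m := [multinom _ | _ < _].
have dm : (mdeg m + k = d)%N.
  rewrite -[RHS]dk addnC mdegE; congr addn.
  by apply: eq_bigr => j _; rewrite mnmE.
have : Sq k 'X_[m] \is (mdeg m + k)%N.-homog by apply: Sq_homog; rewrite dhomogX.
by rewrite [X in _ \is X.-homog]dm.
Qed.

Lemma invariantP v : reflect (ginv (poly_of v)) (invariant v).
Proof.
have ho g : act g (poly_of v) - poly_of v \is d.-homog.
  by apply: rpredB; [apply/act_homog|]; apply: poly_of_homog.
apply: (iffP forallP) => h g.
  move=> ug; have /implyP/(_ ug)/Hit_poly := h g.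
  by rewrite (poly_ofK (ho g)) oppp; exact.
apply/implyP => ug; apply: Hit_coord; first exact: ho.
by rewrite oppp; apply: h.
Qed.

Lemma hit_ginv p : hit p -> ginv p.
Proof. by move=> h g _; exact: (hitD (act_hit g h) h). Qed.

Lemma InvPre_sub (U : {vspace Pd d}) : (forall v, invariant v -> v \in U) -> (InvPre d <= U)%VS.
Proof. by move=> h; apply/span_subvP => v; rewrite mem_filter => /andP[/h]. Qed.

Lemma mem_InvPre v : invariant v -> v \in InvPre d.
Proof. by move=> h; apply: memv_span; rewrite mem_filter h mem_enum. Qed.

Lemma dimQG0 : (forall p, p \is d.-homog -> ginv p -> hit p) -> dimQG d = 0%N.
Proof.
move=> h; apply/eqP; rewrite subn_eq0; apply/dimvS/InvPre_sub => v /invariantP iv.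
have hv := poly_of_homog v.
by rewrite -(coordK v); apply: Hit_coord hv (h _ hv iv).
Qed.

Lemma dimQG1 f : f \is d.-homog -> ginv f -> ~ hit f ->
  (forall p, p \is d.-homog -> ginv p -> hit p \/ hit (p + f)) -> dimQG d = 1%N.
Proof.
move=> hf jf nf h; pose v0 := coord d f.
have nv : v0 \notin Hit d by apply/negP => /Hit_poly; rewrite poly_ofK.
have e : InvPre d = (Hit d + <[v0]>)%VS.
  apply/eqP; rewrite eqEsubv; apply/andP; split.
    apply: InvPre_sub => v /invariantP iv; have hv := poly_of_homog v.
    rewrite -(coordK v); case: (h _ hv iv) => hh.
      by apply: (subvP (addvSl _ _)); apply: Hit_coord.
    have -> : poly_of v = (poly_of v + f) + f by rewrite -addrA addpp addr0.
    rewrite coordD memv_add ?memv_line //; apply: Hit_coord hh.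
    by apply: rpredD.
  rewrite subv_add; apply/andP; split.
    apply/subvP => v /Hit_poly/hit_ginv/invariantP; exact: mem_InvPre.
  by apply/mem_InvPre/invariantP; rewrite poly_ofK.
rewrite /dimQG e dimv_disjoint_sum.
  rewrite addKn dim_vline; suff -> : v0 != 0 by [].
  by apply: contraNneq nv => ->; apply: mem0v.
apply/eqP; rewrite -subv0; apply/subvP => w; rewrite memv_cap => /andP[hw /vlineP[k ek]].
move: hw; rewrite ek; case: (F2_cases k) => ->; first by rewrite scale0r => _; exact: mem0v.
by rewrite scale1r (negPf nv).
Qed.
End Coordinates.

Theorem theorem2p2p1 (s : nat) (hs : (2 <= s)%N) :
  let n := (2 ^ s.+1 + 2 ^ s - 2)%N in
  (KerInvPre n <= Hit n)%VS /\
  dimQG n = (if (s == 2%N) || (s == 4%N) then 0%N else 1%N).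
Proof.
move=> n; have en : n = deg2 s by rewrite deg2E.
move: n en; case: s hs => [|[|j]] // _ _ ->; split.
  have e : ((deg2 j.+2 - 4) %/ 2 = deg3 j)%N by rewrite deg2_deg3 addnK mulnK.
  apply/span_subvP => v; rewrite mem_filter => /andP[/andP[/invariantP iv hk] _].
  have hv := poly_of_homog v; rewrite -(coordK v); apply: (Hit_coord hv).
  apply: (ginv_kameko_hit hv iv); move: hk; rewrite e => /Hit_poly.
  by rewrite poly_ofK //; apply: kameko_homog.
rewrite !eqSS; case: ifP => hj.
  by apply: dimQG0 => p; apply: ginv_deg2_hit.
have [f [hf jf nf h]] := ginv_deg2_line (negbT hj).
exact: (dimQG1 hf jf nf h).
Qed.
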